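(* Let $1\le p<\infty$ and $\alpha>-1$. There exists a constant $C>0$ (independent of $f$ and $g$) such that for all $f\in AT_p^\infty(\alpha)$ and all $g\in A^1$, $$\|\mathbb{K}_g f\|_{AT_p^\infty(\alpha)}\le C\,\|f\|_{AT_p^\infty(\alpha)}\,\|g\|_{A^1}.$$
   Context: $\mathbb{D}$ is the open unit disk in $\mathbb{C}$, $\mathbb{T}$ its boundary, $H(\mathbb{D})$ the set of analytic functions on $\mathbb{D}$, and $dA=\frac1\pi\,dx\,dy$ the normalized area measure on $\mathbb{D}$. The Bergman space $A^1$ consists of all $g\in H(\mathbb{D})$ with $\|g\|_{A^1}=\int_{\mathbb{D}}|g(z)|\,dA(z)<\infty$. Fix $\zeta>\frac12$ and for $\eta\in\mathbb{T}$ let $\Gamma(\eta)=\Gamma_\zeta(\eta)=\{z\in\mathbb{D}:|z-\eta|<\zeta(1-|z|^2)\}$. For $re^{i\theta}\in\mathbb{D}\setminus\{0\}$ let $S(re^{i\theta})=\{\lambda e^{it}:|t-\theta|\le\frac{1-r}{2},\ 1-\lambda\le 1-r\}$ (a subset of $\mathbb{D}$), and $S(0)=\mathbb{D}$. For $0<p<\infty$, the tent space $T_p^\infty(\alpha)$ consists of all measurable functions $f$ on $\mathbb{D}$ with $$\|f\|_{T_p^\infty(\alpha)}^p=\operatorname*{ess\,sup}_{\eta\in\mathbb{T}}\left(\sup_{u\in\Gamma(\eta)}\frac{1}{1-|u|^2}\int_{S(u)}|f(z)|^p(1-|z|^2)^{\alpha+1}\,dA(z)\right)<\infty.$$ The Hardy-Carleson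 type tent space is $AT_p^\infty(\alpha)=T_p^\infty(\alpha)\cap H(\mathbb{D})$, with $\|f\|_{AT_p^\infty(\alpha)}=\|f\|_{T_p^\infty(\alpha)}$. The Hadamard–Bergman convolution operator with kernel $g$ is $$\mathbb{K}_g f(z)=\int_{\mathbb{D}}g(w)f(\overline{w}z)\,dA(w),\quad z\in\mathbb{D};$$ if $f(z)=\sum_{n\ge0} c_nz^n$ and $g(z)=\sum_{n\ge0} d_nz^n$, then $\mathbb{K}_gf(z)=\sum_{n\ge0}\frac{c_nd_n}{n+1}z^n$. *)

(* Defs.v *)
From HB Require Import structures.
From mathcomp Require Import all_boot all_order all_algebra.
From mathcomp Require Import all_classical all_reals all_analysis.
From mathcomp Require Import ess_sup_inf.
From mathcomp Require Import complex.

Set Implicit Arguments.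
Unset Strict Implicit.
Unset Printing Implicit Defensive.

Import Order.TTheory GRing.Theory Num.Theory.
Import numFieldNormedType.Exports.

Local Open Scope classical_set_scope.
Local Open Scope ring_scope.

(* The modulus as an element of R; the norm `|z| of the field R[i] has values
   in R[i]. *)
Notation cmod := ComplexField.Normc.normc.

Definition cexpi (R : realType) (t : R) : R[i] := Complex (cos t) (sin t).

Definition unit_disk (R : realType) : set R[i] := [set z | cmod z < 1].
Arguments unit_disk R : clear implicits.

(* Complex differentiability at every point of the disk: the source and the
   target are R[i] as a normed space over itself, so the increments are
   complex. *)
Definition analytic_on_disk (R : realType) (f : R[i] -> R[i]) : Prop :=
  forall z, unit_disk R z -> derivable (f : R[i]^o -> R[i]^o) z 1.

(* R[i] has no measurable structure in the library, so integration over subsets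
   of the plane is done on R * R through the identification (x, y) = x + iy. *)
Definition plane (R : realType) (q : measurableTypeR R * measurableTypeR R) :
    R[i] := Complex q.1 q.2.

Definition dA (R : realType) :
    {measure set (measurableTypeR R * measurableTypeR R) -> \bar R} :=
  mscale (NngNum (ltW (divr_gt0 ltr01 (pi_gt0 R))))
    (lebesgue_measure \x lebesgue_measure)%E.

Definition area_integral (R : realType) (D : set R[i]) (F : R[i] -> \bar R) :
    \bar R :=
  (\int[@dA R]_(q in @plane R @^-1` D) F (plane q))%E.

Definition area_cintegral (R : realType) (D : set R[i]) (F : R[i] -> R[i]) :
    R[i] :=
  Complex (Rintegral (@dA R) (@plane R @^-1` D) (fun q => complex.Re (F (plane q))))
          (Rintegral (@dA R) (@plane R @^-1` D) (fun q => complex.Im (F (plane q)))).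

Definition measurable_on_disk (R : realType) (f : R[i] -> R[i]) : Prop :=
  measurable_fun (@plane R @^-1` unit_disk R) (fun q => complex.Re (f (plane q))) /\
  measurable_fun (@plane R @^-1` unit_disk R) (fun q => complex.Im (f (plane q))).

Definition bergman_norm (R : realType) (g : R[i] -> R[i]) : \bar R :=
  area_integral (unit_disk R) (fun z => (cmod (g z))%:E).

Definition bergman_A1 (R : realType) (g : R[i] -> R[i]) : Prop :=
  analytic_on_disk g /\ (bergman_norm g < +oo)%E.

Definition approach_region (R : realType) (zeta : R) (eta : R[i]) : set R[i] :=
  [set z | unit_disk R z /\ cmod (z - eta) < zeta * (1 - cmod z ^+ 2)].

(* For u != 0 the set does not depend on the chosen argument theta of u, since
   t may be shifted by the same multiple of 2 pi. *)
Definition carleson_box (R : realType) (u : R[i]) : set R[i] :=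
  if u == 0 then unit_disk R else
  [set z | unit_disk R z /\
    exists theta lambda t : R,
      [/\ u = (cmod u)%:C%C * cexpi theta, z = lambda%:C%C * cexpi t,
          `|t - theta| <= (1 - cmod u) / 2 & 1 - lambda <= 1 - cmod u]].

Definition tent_functional (R : realType) (zeta p alpha : R) (f : R[i] -> R[i])
    (eta : R[i]) : \bar R :=
  ereal_sup [set ((1 - cmod u ^+ 2)^-1%:E *
      area_integral (carleson_box u) (fun z =>
        (cmod (f z) `^ p * (1 - cmod z ^+ 2) `^ (alpha + 1))%:E))%E
    | u in approach_region zeta eta].

(* The essential supremum over the unit circle, parametrized by
   eta = e^{i theta} with 0 <= theta < 2 pi, is taken for arc length. *)
Definition tent_norm (R : realType) (zeta p alpha : R) (f : R[i] -> R[i]) :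
    \bar R :=
  (ess_sup (mrestr (@lebesgue_measure R) (measurable_itv `[0%R, (2 * pi)%R[))
     (fun theta : R => tent_functional zeta p alpha f (cexpi theta)) `^ p^-1)%E.

Definition tent_space (R : realType) (zeta p alpha : R) (f : R[i] -> R[i]) :
    Prop :=
  measurable_on_disk f /\ (tent_norm zeta p alpha f < +oo)%E.

Definition analytic_tent_space (R : realType) (zeta p alpha : R)
    (f : R[i] -> R[i]) : Prop :=
  tent_space zeta p alpha f /\ analytic_on_disk f.

Definition hadamard_bergman (R : realType) (g f : R[i] -> R[i]) (z : R[i]) :
    R[i] :=
  area_cintegral (unit_disk R) (fun w => g w * f (conjc w * z)).

(* Main.v *)
From HB Require Import structures.
Require Import Defs.
From mathcomp Require Import all_boot all_order all_algebra.
From mathcomp Require Import all_classical all_reals all_analysis.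
From mathcomp Require Import complex ess_sup_inf measurable_realfun.
From mathcomp Require Import ring lra.

Import Order.TTheory GRing.Theory Num.Theory.
Import numFieldNormedType.Exports.

(** Write f_c (z) = f (c z) for |c| < 1. By its integral formula the convolution
    is the average of the functions f_(conj w) with the weight g (w) dA (w), so
    two facts are enough: the tent norm of f_c is at most a constant times that
    of f, uniformly in c, and averaging against g costs only the factor ||g||.

    The averaging step is an inequality of Jensen type for the finite measure
    |g| dA [weighted_power_mean]: |K_g f (z)| ^ p is at most a constant times
    ||g|| ^ (p - 1) * int |g (w)| |f (conj w z)| ^ p dA (w). Integrating over a
    Carleson box and exchanging the integrals leaves the integral of |g (w)|
    against box integrals of f_(conj w) [convolution_box_integral].

    The tent norm is read off the means over boxes. It is at most the supremum of
    all of them [tent_sup_le]. Conversely, a point u lies in the approach regions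
    of an arc of boundary points of positive length as soon as
    zeta (1 + |u|) > 1, hence the means over the boxes of such u are at most
    ||f|| ^ p [box_mean_le_tent_sup]. For zeta < 1 points near the origin are in
    no approach region at all; so the hypothesis kept on f is a bound on the
    boxes with r0 < |u| for some r0 < 1 [box_bounded], and the boxes of the
    other points have to be recovered from it.

    Let h = 1 - |u|. For f_c on the box at u [dilated_box_bound]: if 1 - |c| is
    at least h / 2, then f_c is controlled pointwise by
    |f (z)| ^ p <= C N / (1 - |z|) ^ (alpha + 2) [pointwise_bound] and the box
    has area of order h ^ 2; if 1 - |c| < h / 2 and h is small, multiplication
    by c maps the box into the box of height 2 h at a rotated point; if h is
    bounded below, the integral over the whole disk is enough, and
    [whole_disk_bound] covers the disk by a compact disk and finitely many boxes.
    The pointwise bound is the area mean value inequality for |f| ^ p on a disk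
    of radius comparable to 1 - |z|, which fits into one box
    [near_boundary_bound]; inside, a Cauchy estimate takes over.

    Analyticity enters through Cauchy's formula on circles [cauchy_formula]. It
    is derived from complex differentiability alone: Goursat's bisection on
    rectangles, first without and then with one exceptional point, is pulled back
    by the exponential, which maps vertical segments to circles about 0; applied
    to the difference quotient of f this gives the formula. Rotating and
    averaging it gives the area mean value inequality [area_mean_le]; expanding
    its kernel gives uniform approximation by polynomials, whence measurability
    [cmeasurable_analytic], and a second order expansion that is uniform on
    compact disks [second_order], whence K_g f is analytic by differentiation
    under the integral [cdiff_hadamard_bergman].

    The modulus of a complex integral is estimated through its real and imaginary
    parts, which costs a factor 2 each time; only the existence of a constant
    matters. *)

Local Open Scope classical_set_scope.
Local Open Scope ring_scope.

Set Implicit Arguments.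
Unset Strict Implicit.
Unset Printing Implicit Defensive.

(** * The modulus and the unit circle *)

Section modulus.
Context {R : realType}.
Implicit Types z w : R[i].

Lemma cmodE z : cmod z = Num.sqrt (complex.Re z ^+ 2 + complex.Im z ^+ 2).
Proof. by case: z. Qed.

Lemma normcE z : `|z| = (cmod z)%:C%C.
Proof. by rewrite normc_def cmodE. Qed.

Lemma cmod_ge0 z : 0 <= cmod z. Proof. by rewrite cmodE sqrtr_ge0. Qed.

Lemma cmod0 : cmod (0 : R[i]) = 0. Proof. exact: ComplexField.Normc.normc0. Qed.

Lemma cmod1 : cmod (1 : R[i]) = 1. Proof. exact: ComplexField.Normc.normc1. Qed.

Lemma cmodM z w : cmod (z * w) = cmod z * cmod w.
Proof. exact: ComplexField.Normc.normcM. Qed.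

Lemma cmodV z : cmod z^-1 = (cmod z)^-1.
Proof. exact: ComplexField.Normc.normcV. Qed.

Lemma cmodD z w : cmod (z + w) <= cmod z + cmod w.
Proof. exact: (@le_normcD R). Qed.

Lemma cmodN z : cmod (- z) = cmod z. Proof. exact: normcN. Qed.

Lemma cmodB z w : cmod (z - w) = cmod (w - z).
Proof. by rewrite -cmodN opprB. Qed.

Lemma cmodBD z w : cmod (z - w) <= cmod z + cmod w.
Proof. by rewrite -(cmodN w) cmodD. Qed.

Lemma cmod_eq0 z : (cmod z == 0) = (z == 0).
Proof.
by apply/eqP/eqP => [/ComplexField.Normc.eq0_normc|->//]; rewrite ?cmod0.
Qed.

Lemma cmod_gt0 z : (0 < cmod z) = (z != 0).
Proof. by rewrite lt_def cmod_ge0 andbT cmod_eq0. Qed.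

Lemma cmodX z n : cmod (z ^+ n) = cmod z ^+ n.
Proof. by elim: n => [|n IH]; rewrite ?expr0 ?cmod1// !exprS cmodM IH. Qed.

Lemma cmod_sqr z : cmod z ^+ 2 = complex.Re z ^+ 2 + complex.Im z ^+ 2.
Proof. by rewrite cmodE sqr_sqrtr// addr_ge0 ?sqr_ge0. Qed.

Lemma cmodC (x : R) : cmod x%:C%C = `|x|.
Proof. by rewrite cmodE /= expr0n addr0 sqrtr_sqr. Qed.

Lemma Re_le_cmod z : `|complex.Re z| <= cmod z.
Proof.
rewrite -(ger0_norm (cmod_ge0 z)) -ler_sqr ?nnegrE// !real_normK ?num_real//.
by rewrite cmod_sqr lerDl sqr_ge0.
Qed.

Lemma Im_le_cmod z : `|complex.Im z| <= cmod z.
Proof.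
rewrite -(ger0_norm (cmod_ge0 z)) -ler_sqr ?nnegrE// !real_normK ?num_real//.
by rewrite cmod_sqr lerDr sqr_ge0.
Qed.

Lemma cmod_le z : cmod z <= `|complex.Re z| + `|complex.Im z|.
Proof.
rewrite -(ger0_norm (cmod_ge0 z)) -[leRHS]ger0_norm//.
rewrite -ler_sqr ?nnegrE// !real_normK ?num_real// cmod_sqr sqrrD.
rewrite !real_normK ?num_real// [leRHS]addrAC lerDl.
by rewrite mulrn_wge0// mulr_ge0.
Qed.

Lemma cmod_conj z : cmod (conjc z) = cmod z.
Proof. by rewrite !cmodE; case: z => a b /=; rewrite sqrrN. Qed.

Lemma cmodB_le z w : cmod z - cmod w <= cmod (z - w).
Proof. by rewrite lerBlDr -{1}(subrK w z) cmodD. Qed.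

Lemma cmod_cexpi (t : R) : cmod (cexpi t) = 1.
Proof. by rewrite cmodE /= cos2Dsin2 sqrtr1. Qed.

Lemma cexpiD (s t : R) : cexpi (s + t) = cexpi s * cexpi t.
Proof.
rewrite /cexpi cosD sinD; apply/eqP; rewrite eq_complex /=; apply/andP; split.
  by apply/eqP.
by apply/eqP; rewrite addrC (mulrC (sin s)) addrC; ring.
Qed.

Lemma cexpi0 : cexpi (0 : R) = 1.
Proof. by rewrite /cexpi cos0 sin0. Qed.

Lemma cexpi_neq0 (t : R) : cexpi t != 0.
Proof. by rewrite -cmod_eq0 cmod_cexpi oner_eq0. Qed.

Lemma cexpiN (t : R) : cexpi (- t) = (cexpi t)^-1.
Proof.
by apply: (mulfI (cexpi_neq0 t)); rewrite -cexpiD subrr cexpi0 mulfV ?cexpi_neq0.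
Qed.

Lemma conj_cexpi (t : R) : conjc (cexpi t) = cexpi (- t).
Proof. by rewrite /cexpi cosN sinN. Qed.

Lemma complex_ext z w : complex.Re z = complex.Re w ->
  complex.Im z = complex.Im w -> z = w.
Proof. by case: z w => [a b] [c d] /= -> ->. Qed.

End modulus.

(** * Complex differentiability *)

Lemma invrB_frac (F : fieldType) (a b : F) : a != 0 -> b != 0 ->
  a^-1 - b^-1 = (b - a) * (a * b)^-1.
Proof. by move=> a0 b0; field; rewrite a0 b0. Qed.

Section complex_differentiability.
Context {R : realType}.
Implicit Types (f g q : R[i] -> R[i]) (z w : R[i]).

(** Continuity with real radii: as a field, R[i] has a norm with complex values,
    and all the estimates below take place in R. *)
Definition ccont f z := forall e : R, 0 < e ->
  exists2 d : R, 0 < d & forall w, cmod (w - z) < d -> cmod (f w - f z) < e.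

Lemma ccont_cst (c : R[i]) z : ccont (fun=> c) z.
Proof. by move=> e e0; exists 1 => // w _; rewrite subrr cmod0. Qed.

Lemma ccont_id z : ccont id z.
Proof. by move=> e e0; exists e. Qed.

Lemma ccontD f g z : ccont f z -> ccont g z -> ccont (fun w => f w + g w) z.
Proof.
move=> cf cg e e0; have e20 : 0 < e / 2 by rewrite divr_gt0.
have [d d0 {}cf] := cf _ e20; have [d' d'0 {}cg] := cg _ e20.
exists (Num.min d d'); first by rewrite lt_min d0.
move=> w; rewrite lt_min => /andP[/cf fw /cg gw].
rewrite (_ : _ - _ = (f w - f z) + (g w - g z)); last by ring.
by rewrite (le_lt_trans (cmodD _ _))// (splitr e) ltrD.
Qed.

Lemma ccontM f g z : ccont f z -> ccont g z -> ccont (fun w => f w * g w) z.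
Proof.
move=> cf cg e e0.
pose K := cmod (f z) + cmod (g z) + 1.
have K0 : 0 < K by rewrite ltr_wpDl// addr_ge0 ?cmod_ge0.
pose e' := Num.min 1 (e / 2 / K).
have e'0 : 0 < e' by rewrite lt_min ltr01 !divr_gt0.
have [d d0 {}cf] := cf _ e'0; have [d' d'0 {}cg] := cg _ e'0.
exists (Num.min d d'); first by rewrite lt_min d0.
move=> w; rewrite lt_min => /andP[/cf fw /cg gw].
rewrite (_ : _ - _ = f z * (g w - g z) + g z * (f w - f z)
  + (f w - f z) * (g w - g z)); last by ring.
have e'1 : e' <= 1 by rewrite /e' ge_min lexx.
have e'K : e' * K <= e / 2 by rewrite -ler_pdivlMr// /e' ge_min lexx orbT.
apply: (@le_lt_trans _ _ (e' * K)); last by lra.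
rewrite (le_trans (cmodD _ _))// /K 2!(mulrDr e').
apply: lerD.
  apply: (le_trans (cmodD _ _)); rewrite !cmodM !(mulrC e') lerD//.
    by rewrite ler_wpM2l ?cmod_ge0// ltW.
  by rewrite ler_wpM2l ?cmod_ge0// ltW.
by rewrite cmodM ler_pM ?cmod_ge0// ?(ltW fw)// ltW// (lt_le_trans gw).
Qed.

Lemma ccontN f z : ccont f z -> ccont (fun w => - f w) z.
Proof.
move=> cf e /cf [d d0 {}cf]; exists d => // w /cf.
by rewrite -opprD cmodN.
Qed.

Lemma ccontV f z : f z != 0 -> ccont f z -> ccont (fun w => (f w)^-1) z.
Proof.
move=> fz cf e e0; have fz0 : 0 < cmod (f z) by rewrite cmod_gt0.
have [d d0 {}cf] : exists2 d : R, 0 < d & forall w, cmod (w - z) < d ->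
    cmod (f w - f z) < Num.min (cmod (f z) / 2) (e * (cmod (f z) ^+ 2 / 2)).
  by apply: cf; rewrite lt_min divr_gt0//= mulr_gt0// divr_gt0// exprn_gt0.
exists d => // w /cf; rewrite lt_min => /andP[f1 f2].
have fw2 : cmod (f z) / 2 < cmod (f w).
  have := cmodB_le (f z) (f w); rewrite cmodB; lra.
have fw0 : 0 < cmod (f w) by rewrite (lt_trans _ fw2)// divr_gt0.
have fwN : f w != 0 by rewrite -cmod_gt0.
rewrite (_ : _ - _ = (f z - f w) * (f w * f z)^-1); last first.
  exact: invrB_frac.
rewrite cmodM cmodV cmodM ltr_pdivrMr ?mulr_gt0// cmodB (lt_le_trans f2)//.
rewrite ler_pM2l// expr2 mulrAC ler_pM2r// ltW//.
Qed.

Lemma ccont_comp f g z : ccont f z -> ccont g (f z) -> ccont (fun w => g (f w)) z.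
Proof.
move=> cf cg e /cg [d d0 {}cg]; have [d' d'0 {}cf] := cf _ d0.
by exists d' => // w /cf /cg.
Qed.

Lemma ccont_near f g z (d : R) : 0 < d ->
  (forall w, cmod (w - z) < d -> f w = g w) -> ccont f z -> ccont g z.
Proof.
move=> d0 fg cf e /cf [d' d'0 {}cf].
exists (Num.min d d'); first by rewrite lt_min d0.
move=> w; rewrite lt_min => /andP[wd wd']; rewrite -!fg// ?cf//.
by rewrite subrr cmod0.
Qed.

(** Differentiability in the form of Caratheodory: the slope of f at z extends to
    a function continuous at z. Sums, products and composites then follow from
    the corresponding facts on continuity. *)
Definition cdiff f z := exists2 q : R[i] -> R[i], ccont q z &
  forall w, f w = f z + q w * (w - z).

Lemma cdiff_cont f z : cdiff f z -> ccont f z.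
Proof.
case=> q cq fE.
have -> : f = (fun w => f z + q w * (w - z)) by apply/funext.
apply: ccontD; first exact: ccont_cst.
by apply: ccontM => //; apply: ccontD; [exact: ccont_id|exact: ccont_cst].
Qed.

Lemma cdiff_cst c z : cdiff (fun=> c) z.
Proof. by exists (fun=> 0) => [|w]; [exact: ccont_cst|rewrite mul0r addr0]. Qed.

Lemma cdiff_id z : cdiff id z.
Proof. by exists (fun=> 1) => [|w]; [exact: ccont_cst|rewrite mul1r addrC subrK]. Qed.

Lemma cdiffD f g z : cdiff f z -> cdiff g z -> cdiff (fun w => f w + g w) z.
Proof.
move=> [q cq fE] [r cr gE]; exists (fun w => q w + r w); first exact: ccontD.
by move=> w; rewrite fE gE; ring.
Qed.

Lemma cdiffM f g z : cdiff f z -> cdiff g z -> cdiff (fun w => f w * g w) z.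
Proof.
move=> [q cq fE] dg; have cg := cdiff_cont dg; case: dg => r cr gE.
exists (fun w => q w * g w + f z * r w).
  by apply: ccontD; apply: ccontM => //; exact: ccont_cst.
by move=> w; rewrite fE (gE w); ring.
Qed.

Lemma cdiff_comp f g z : cdiff f z -> cdiff g (f z) -> cdiff (fun w => g (f w)) z.
Proof.
move=> df [r cr gE]; have cf := cdiff_cont df; case: df => q cq fE.
exists (fun w => r (f w) * q w).
  by apply: ccontM => //; exact: ccont_comp.
by move=> w; rewrite gE (fE w); ring.
Qed.

Lemma cdiff_near f g z (d : R) : 0 < d ->
  (forall w, cmod (w - z) < d -> f w = g w) -> cdiff f z -> cdiff g z.
Proof.
move=> d0 fg [q cq fE]; have fgz : f z = g z by apply: fg; rewrite subrr cmod0.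
exists (fun w => if w == z then q z else (g w - g z) / (w - z)).
  apply: (ccont_near d0 _ cq) => w wz.
  case: eqP => [->//|/eqP wNz].
  by rewrite -fg// -fgz fE addrC addKr mulfK// subr_eq0.
move=> w; case: eqP => [->|/eqP wNz]; first by rewrite subrr mulr0 addr0.
by rewrite divfK ?subr_eq0// addrC subrK.
Qed.

(** Near z the slope of 1 / f is - q w / (f w f z), which is continuous at z. The
    slope is defined by the difference quotient, since f may vanish elsewhere. *)
Lemma cdiffV f z : f z != 0 -> cdiff f z -> cdiff (fun w => (f w)^-1) z.
Proof.
move=> fz df; have cf := cdiff_cont df.
have /(_ (cmod (f z))) := cf; rewrite cmod_gt0 => /(_ fz) [d d0 fN0].
case: (df) => q cq fE.
exists (fun w => if w == z then - q z / (f z * f z) else ((f w)^-1 - (f z)^-1) / (w - z)).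
  have cr : ccont (fun w => - q w * (f w * f z)^-1) z.
    apply: ccontM; first exact: ccontN.
    apply: ccontV; first by rewrite mulf_neq0.
    by apply: ccontM => //; exact: ccont_cst.
  apply: (ccont_near d0 _ cr) => w wz.
  case: eqP => [->//|/eqP wNz].
  have fw : f w != 0.
    apply/eqP => fw0; have := fN0 _ wz.
    by rewrite fw0 sub0r cmodN ltxx.
  have wz0 : w - z != 0 by rewrite subr_eq0.
  have -> : q w = (f w - f z) / (w - z) by rewrite fE addrC addKr mulfK.
  by rewrite invrB_frac// -[f z - f w]opprB; ring.
move=> w; case: eqP => [->|/eqP wNz]; first by rewrite subrr mulr0 addr0.
by rewrite divfK ?subr_eq0// addrC subrK.
Qed.

(** Both sides say that the difference quotient has a limit at z; the slope is
    that quotient, completed by the limit at z itself. *)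
Lemma cdiffP f z : derivable (f : R[i]^o -> R[i]^o) z 1 <-> cdiff f z.
Proof.
split.
  move=> /cvg_ex[/= l /cvgrPdist_lt fl].
  exists (fun w => if w == z then l else (f w - f z) / (w - z)); last first.
    move=> w; case: eqP => [->|/eqP wNz]; first by rewrite subrr mulr0 addr0.
    by rewrite divfK ?subr_eq0// addrC subrK.
  move=> e e0.
  have e0C : 0 < e%:C%C :> R[i] by rewrite ltcR.
  have [/= d d0 {}fl] := (fl _ e0C).
  have [dI dR] : complex.Im d = 0 /\ 0 < complex.Re d.
    by move: d0; rewrite ltcE => /andP[/eqP-> ->].
  have dE : d = (complex.Re d)%:C%C by apply: complex_ext.
  exists (complex.Re d) => // w wz.
  rewrite /= eqxx; case: eqP => [_|/eqP wNz]; first by rewrite subrr cmod0.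
  have := fl (w - z); rewrite /ball_ /= sub0r normcE cmodN dE ltcR => /(_ wz).
  rewrite subr_eq0 => /(_ wNz).
  rewrite normcE ltcR cmodB.
  by rewrite /GRing.scale /= mulr1 subrK [_^-1 * _]mulrC.
move=> [q cq fE]; apply/cvg_ex; exists (q z); apply/cvgrPdist_lt => e e0.
have [eI eR] : complex.Im e = 0 /\ 0 < complex.Re e.
  by move: e0; rewrite ltcE => /andP[/eqP-> ->].
have eE : e = (complex.Re e)%:C%C by apply: complex_ext.
have /(_ _ eR) [d d0 {}cq] := cq.
exists d%:C%C => /=; first by rewrite ltcR.
move=> h; rewrite /ball_ /= sub0r normcE cmodN ltcR => hd h0.
rewrite normcE eE ltcR cmodB.
rewrite /GRing.scale /= mulr1 (_ : h^-1 * _ = q (h + z)); last first.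
  by rewrite (fE (h + z)) addrK [f z + _]addrC addrK mulrC mulfK.
by apply: cq; rewrite addrK.
Qed.

End complex_differentiability.

(** * Integrals of complex-valued functions *)

Section complex_integral.
Context d (T : measurableType d) (R : realType) (mu : {measure set T -> \bar R}).
Implicit Types (D : set T) (F G : T -> R[i]).

Definition cmeasurable D F :=
  measurable_fun D (fun x => complex.Re (F x)) /\
  measurable_fun D (fun x => complex.Im (F x)).

Definition cintegrable D F :=
  mu.-integrable D (EFin \o (fun x => complex.Re (F x))) /\
  mu.-integrable D (EFin \o (fun x => complex.Im (F x))).

Definition cintegral D F : R[i] :=
  Complex (Rintegral mu D (fun x => complex.Re (F x)))
          (Rintegral mu D (fun x => complex.Im (F x))).

Lemma cmeasurable_cst D c : cmeasurable D (fun=> c).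
Proof. by split; exact: measurable_cst. Qed.

Lemma cmeasurableD D F G : cmeasurable D F -> cmeasurable D G ->
  cmeasurable D (fun x => F x + G x).
Proof.
move=> [F1 F2] [G1 G2]; split.
  rewrite (_ : (fun _ => _) = (fun x => complex.Re (F x) + complex.Re (G x))).
    exact: measurable_funD.
  by apply/funext => x; case: (F x) (G x) => ? ? [].
rewrite (_ : (fun _ => _) = (fun x => complex.Im (F x) + complex.Im (G x))).
  exact: measurable_funD.
by apply/funext => x; case: (F x) (G x) => ? ? [].
Qed.

Lemma cmeasurableM D F G : cmeasurable D F -> cmeasurable D G ->
  cmeasurable D (fun x => F x * G x).
Proof.
move=> [F1 F2] [G1 G2]; split.
  rewrite (_ : (fun _ => _) = (fun x => complex.Re (F x) * complex.Re (G x)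
      - complex.Im (F x) * complex.Im (G x))).
    by apply: measurable_funB; exact: measurable_funM.
  by apply/funext => x; case: (F x) (G x) => ? ? [].
rewrite (_ : (fun _ => _) = (fun x => complex.Re (F x) * complex.Im (G x)
      + complex.Im (F x) * complex.Re (G x))).
  by apply: measurable_funD; exact: measurable_funM.
by apply/funext => x; case: (F x) (G x) => ? ? [].
Qed.

Lemma cmeasurableN D F : cmeasurable D F -> cmeasurable D (fun x => - F x).
Proof.
move=> F1; rewrite (_ : (fun _ => _) = (fun x => (-1) * F x)).
  by apply: cmeasurableM => //; exact: cmeasurable_cst.
by apply/funext => x; rewrite mulN1r.
Qed.

Lemma cmeasurableX D F n : cmeasurable D F -> cmeasurable D (fun x => F x ^+ n).
Proof.
move=> mF; elim: n => [|n IH].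
  rewrite (_ : (fun _ => _) = (fun=> 1)); first exact: cmeasurable_cst.
  by apply/funext => x; rewrite expr0.
rewrite (_ : (fun _ => _) = (fun x => F x * F x ^+ n)); first exact: cmeasurableM.
by apply/funext => x; rewrite exprS.
Qed.

Lemma cmeasurable_sum D I (r : seq I) (F : I -> T -> R[i]) :
  (forall i, cmeasurable D (F i)) -> cmeasurable D (fun x => \sum_(i <- r) F i x).
Proof.
move=> mF; elim: r => [|i r IH].
  rewrite (_ : (fun _ => _) = (fun=> 0)); first exact: cmeasurable_cst.
  by apply/funext => x; rewrite big_nil.
rewrite (_ : (fun _ => _) = (fun x => F i x + \sum_(i <- r) F i x)).
  exact: cmeasurableD.
by apply/funext => x; rewrite big_cons.
Qed.

Lemma cmeasurable_conj D F : cmeasurable D F -> cmeasurable D (fun x => conjc (F x)).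
Proof.
move=> [F1 F2]; split.
  rewrite (_ : (fun _ => _) = (fun x => complex.Re (F x)))//.
  by apply/funext => x; case: (F x).
rewrite (_ : (fun _ => _) = (fun x => - complex.Im (F x))).
  exact: measurable_funN.
by apply/funext => x; case: (F x).
Qed.

Lemma cmeasurable_cmod D F : cmeasurable D F ->
  measurable_fun D (fun x => cmod (F x)).
Proof.
move=> [F1 F2].
rewrite (_ : (fun _ => _) = (fun x => Num.sqrt (complex.Re (F x) ^+ 2 + complex.Im (F x) ^+ 2))).
  have ms : measurable_fun setT (@Num.sqrt R : R -> R).
    by apply: continuous_measurable_fun; exact: sqrt_continuous.
  by apply: (measurableT_comp ms); apply: measurable_funD; exact: measurable_funX.
by apply/funext => x; rewrite cmodE.
Qed.

Lemma cmeasurable_lim D (F : nat -> T -> R[i]) G :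
  (forall n, cmeasurable D (F n)) ->
  (forall x, D x -> forall e : R, 0 < e -> exists N, forall n, (N <= n)%N ->
     cmod (F n x - G x) < e) ->
  cmeasurable D G.
Proof.
move=> mF FG; split.
  apply: (measurable_fun_cvg (fun n => (mF n).1)) => x Dx.
  apply/cvgrPdist_lt => e e0; have [N FGN] := FG _ Dx _ e0.
  exists N => // n /= Nn; rewrite distrC.
  apply: le_lt_trans (FGN _ Nn).
  by have := Re_le_cmod (F n x - G x); case: (F n x) (G x) => ? ? [].
apply: (measurable_fun_cvg (fun n => (mF n).2)) => x Dx.
apply/cvgrPdist_lt => e e0; have [N FGN] := FG _ Dx _ e0.
exists N => // n /= Nn; rewrite distrC.
apply: le_lt_trans (FGN _ Nn).
by have := Im_le_cmod (F n x - G x); case: (F n x) (G x) => ? ? [].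
Qed.

Lemma cintegrable_measurable D F : cintegrable D F -> cmeasurable D F.
Proof.
by move=> [/integrableP[/measurable_EFinP F1 _] /integrableP[/measurable_EFinP F2 _]].
Qed.

Lemma cintegrable_dom D F (h : T -> R) : measurable D -> cmeasurable D F ->
  mu.-integrable D (EFin \o h) -> (forall x, D x -> cmod (F x) <= h x) ->
  cintegrable D F.
Proof.
move=> mD [F1 F2] ih Fh; split.
  apply: (le_integrable mD _ _ ih); first exact/measurable_EFinP.
  move=> x Dx /=; rewrite lee_fin (le_trans (Re_le_cmod _))//.
  by rewrite (le_trans (Fh _ Dx))// ler_norm.
apply: (le_integrable mD _ _ ih); first exact/measurable_EFinP.
move=> x Dx /=; rewrite lee_fin (le_trans (Im_le_cmod _))//.
by rewrite (le_trans (Fh _ Dx))// ler_norm.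
Qed.

Lemma cintegrable_cmod D F : measurable D -> cintegrable D F ->
  mu.-integrable D (EFin \o (fun x => cmod (F x))).
Proof.
move=> mD iF; have [F1 F2] := iF.
have := integrableD mD (integrable_norm F1) (integrable_norm F2).
apply: le_integrable => //.
  apply/measurable_EFinP; apply: cmeasurable_cmod.
  exact: cintegrable_measurable.
move=> x Dx /=; rewrite lee_fin ger0_norm ?cmod_ge0//.
by rewrite (le_trans (cmod_le _))// ler_norm.
Qed.

Lemma integrable_fin_cst D (k : R) : measurable D -> (mu D < +oo)%E ->
  mu.-integrable D (EFin \o cst k).
Proof.
move=> mD Doo; apply/integrableP; split; first exact/measurable_EFinP.
rewrite (eq_integral (cst `|k|%:E))// integral_cst//.
by rewrite lte_mul_pinfty.
Qed.

Lemma cintegrableD D F G : measurable D -> cintegrable D F -> cintegrable D G ->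
  cintegrable D (fun x => F x + G x).
Proof.
move=> mD iF iG.
have iH := integrableD mD (cintegrable_cmod mD iF) (cintegrable_cmod mD iG).
apply: (cintegrable_dom mD _ iH); last by move=> x _; exact: cmodD.
by apply: cmeasurableD; exact: cintegrable_measurable.
Qed.

Lemma cintegrableZ D F (c : R[i]) : measurable D -> cintegrable D F ->
  cintegrable D (fun x => c * F x).
Proof.
move=> mD iF.
have iH := integrableZl mD (cmod c) (cintegrable_cmod mD iF).
apply: (cintegrable_dom mD _ iH); last by move=> x _; rewrite cmodM.
by apply: cmeasurableM; [exact: cmeasurable_cst|exact: cintegrable_measurable].
Qed.

Lemma eq_cintegral D F G : (forall x, D x -> F x = G x) ->
  cintegral D F = cintegral D G.
Proof.
by move=> FG; congr Complex; apply: eq_Rintegral => x /set_mem/FG ->.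
Qed.

Lemma cintegralD D F G : measurable D -> cintegrable D F -> cintegrable D G ->
  cintegral D (fun x => F x + G x) = cintegral D F + cintegral D G.
Proof.
move=> mD [F1 F2] [G1 G2]; apply: complex_ext => /=.
  rewrite -RintegralD//; apply: eq_Rintegral => x _.
  by case: (F x) (G x) => ? ? [].
rewrite -RintegralD//; apply: eq_Rintegral => x _.
by case: (F x) (G x) => ? ? [].
Qed.

Lemma cintegralZ D F (c : R[i]) : measurable D -> cintegrable D F ->
  cintegral D (fun x => c * F x) = c * cintegral D F.
Proof.
move=> mD [F1 F2].
have iZ r (f : T -> R) : mu.-integrable D (EFin \o f) ->
    mu.-integrable D (EFin \o (fun x => r * f x)).
  by move=> /(integrableZl mD r).
apply: complex_ext; case: c => a b /=.
  rewrite -RintegralZl// -RintegralZl// -RintegralB//; try exact: iZ.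
  by apply: eq_Rintegral => x _; case: (F x).
rewrite -RintegralZl// -RintegralZl// -RintegralD//; try exact: iZ.
by apply: eq_Rintegral => x _; case: (F x).
Qed.

Lemma cintegralN D F : measurable D -> cintegrable D F ->
  cintegral D (fun x => - F x) = - cintegral D F.
Proof.
move=> mD iF; rewrite -mulN1r -cintegralZ//; apply: eq_cintegral => x _.
by rewrite mulN1r.
Qed.

Lemma cintegralB D F G : measurable D -> cintegrable D F -> cintegrable D G ->
  cintegral D (fun x => F x - G x) = cintegral D F - cintegral D G.
Proof.
move=> mD iF iG; rewrite cintegralD// ?cintegralN//.
have := cintegrableZ (-1) mD iG.
by congr cintegrable; apply/funext => x; rewrite mulN1r.
Qed.

Lemma cintegral_sum D I (r : seq I) (F : I -> T -> R[i]) : measurable D ->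
  (forall i, cintegrable D (F i)) ->
  cintegrable D (fun x => \sum_(i <- r) F i x) /\
  cintegral D (fun x => \sum_(i <- r) F i x) = \sum_(i <- r) cintegral D (F i).
Proof.
move=> mD iF; elim: r => [|i r [IH1 IH2]].
  rewrite (_ : (fun _ => _) = (fun=> 0)); last first.
    by apply/funext => x; rewrite big_nil.
  rewrite big_nil; split.
    by split => /=; exact: integrable0.
  by apply: complex_ext; rewrite /= /Rintegral integral0.
rewrite (_ : (fun _ => _) = (fun x => F i x + \sum_(i <- r) F i x)); last first.
  by apply/funext => x; rewrite big_cons.
by rewrite big_cons -IH2 -cintegralD//; split => //; exact: cintegrableD.
Qed.

Lemma cintegral_cst D c : measurable D ->
  cintegral D (fun=> c) = c * (fine (mu D))%:C%C.
Proof.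
move=> mD; rewrite /cintegral !Rintegral_cst//.
by case: c => a b; apply: complex_ext => /=; ring.
Qed.

(** The modulus is at most the sum of the moduli of the real and imaginary parts,
    and each of these has an integral at most that of h: hence the factor 2. *)
Lemma cmod_cintegral_dom D F (h : T -> R) : measurable D -> cintegrable D F ->
  mu.-integrable D (EFin \o h) -> (forall x, D x -> cmod (F x) <= h x) ->
  cmod (cintegral D F) <= 2 * Rintegral mu D h.
Proof.
move=> mD [F1 F2] ih Fh; rewrite (le_trans (cmod_le _))//= mulr2n mulrDl mul1r.
apply: lerD.
  apply: (le_trans (le_normr_Rintegral mD F1)); apply: le_Rintegral => //.
    exact: integrable_norm.
  by move=> x Dx; rewrite (le_trans (Re_le_cmod _))// Fh.
apply: (le_trans (le_normr_Rintegral mD F2)); apply: le_Rintegral => //.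
  exact: integrable_norm.
by move=> x Dx; rewrite (le_trans (Im_le_cmod _))// Fh.
Qed.

Lemma cmod_cintegral D F : measurable D -> cintegrable D F ->
  cmod (cintegral D F) <= 2 * Rintegral mu D (fun x => cmod (F x)).
Proof.
by move=> mD iF; apply: cmod_cintegral_dom => //; exact: cintegrable_cmod.
Qed.

Lemma cmod_cintegral_bounded D F (M : R) : measurable D -> (mu D < +oo)%E ->
  cintegrable D F -> (forall x, D x -> cmod (F x) <= M) ->
  cmod (cintegral D F) <= 2 * (M * fine (mu D)).
Proof.
move=> mD Doo iF FM; rewrite -(Rintegral_cst mu mD).
by apply: cmod_cintegral_dom => //; exact: integrable_fin_cst.
Qed.

End complex_integral.

(** * Integrals over segments *)

Section line_integral.
Context {R : realType}.
Notation lam := (@lebesgue_measure R).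
Implicit Types (F G : R -> R[i]) (a b c t : R).

Definition lint a b F : R[i] := cintegral lam `[a, b]%classic F.

(** The points s range over a full neighbourhood of t, also outside [a, b]; this
    makes concatenation and restriction of intervals immediate, and the
    integrands below are continuous across the end points anyway. *)
Definition lcont a b F := forall t, a <= t <= b -> forall e, 0 < e ->
  exists2 d : R, 0 < d & forall s, `|s - t| < d -> cmod (F s - F t) < e.

Lemma lcontW a b c d F : a <= c -> d <= b -> lcont a b F -> lcont c d F.
Proof.
move=> ac db cF t /andP[ct td]; apply: cF.
by rewrite (le_trans ac ct) (le_trans td db).
Qed.

Lemma itv_fin a b : (lam `[a, b]%classic < +oo)%E.
Proof. by rewrite lebesgue_measure_itv /=; case: ifP => _; rewrite ?ltry. Qed.

Lemma itv_len a b : a <= b -> fine (lam `[a, b]%classic) = b - a.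
Proof.
rewrite le_eqVlt => /predU1P[->|ab].
  by rewrite lebesgue_measure_itv /= ltxx subrr.
by rewrite lebesgue_measure_itv /= lte_fin ab.
Qed.

Lemma lcont_integrable a b F : lcont a b F -> cintegrable lam `[a, b]%classic F.
Proof.
move=> cF.
split; apply: continuous_compact_integrable; try exact: segment_compact.
  apply: continuous_in_subspaceT => t /set_mem /=; rewrite in_itv /= => tab.
  apply/cvgrPdist_lt => e e0; have [d d0 Fd] := cF _ tab _ e0.
  exists d => //= s; rewrite /= distrC => st; rewrite distrC.
  apply: le_lt_trans (Fd _ st).
  by have := Re_le_cmod (F s - F t); case: (F s) (F t) => ? ? [].
apply: continuous_in_subspaceT => t /set_mem /=; rewrite in_itv /= => tab.
apply/cvgrPdist_lt => e e0; have [d d0 Fd] := cF _ tab _ e0.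
exists d => //= s; rewrite /= distrC => st; rewrite distrC.
apply: le_lt_trans (Fd _ st).
by have := Im_le_cmod (F s - F t); case: (F s) (F t) => ? ? [].
Qed.

Lemma lint_split a b c F : a <= c -> c <= b -> lcont a b F ->
  lint a b F = lint a c F + lint c b F.
Proof.
move=> ac cb cF.
have [F1 F2] := lcont_integrable cF.
have [G1 G2] := lcont_integrable (lcontW ac (lexx b) cF).
have h (f : R -> R) : lam.-integrable `[a, b]%classic (EFin \o f) ->
    lam.-integrable `[c, b]%classic (EFin \o f) ->
    Rintegral lam `[a, b]%classic f =
    Rintegral lam `[a, c]%classic f + Rintegral lam `[c, b]%classic f.
  move=> f1 f2; apply/eqP; rewrite addrC -subr_eq; apply/eqP.
  rewrite Rintegral_itvB//= Rintegral_itv_obnd_cbnd//.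
  by apply: integrableS f2 => //; apply: subset_itvr; rewrite bnd_simp.
by apply: complex_ext; rewrite /= h.
Qed.

Lemma cmod_lint a b F (M : R) : a <= b -> lcont a b F ->
  (forall t, a <= t <= b -> cmod (F t) <= M) ->
  cmod (lint a b F) <= 2 * (M * (b - a)).
Proof.
move=> ab cF FM; rewrite -itv_len//; apply: cmod_cintegral_bounded => //.
  exact: itv_fin.
exact: lcont_integrable.
Qed.

Lemma lint_cst a b (c : R[i]) : a <= b -> lint a b (fun=> c) = c * (b - a)%:C%C.
Proof. by move=> ab; rewrite /lint cintegral_cst// itv_len. Qed.

Lemma eq_lint a b F G : (forall t, a <= t <= b -> F t = G t) ->
  lint a b F = lint a b G.
Proof. by move=> FG; apply: eq_cintegral => t /=; rewrite in_itv; exact: FG. Qed.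

Lemma lintD a b F G : lcont a b F -> lcont a b G ->
  lint a b (fun t => F t + G t) = lint a b F + lint a b G.
Proof. by move=> cF cG; apply: cintegralD => //; exact: lcont_integrable. Qed.

Lemma lintB a b F G : lcont a b F -> lcont a b G ->
  lint a b (fun t => F t - G t) = lint a b F - lint a b G.
Proof. by move=> cF cG; apply: cintegralB => //; exact: lcont_integrable. Qed.

Lemma lintZ a b F (c : R[i]) : lcont a b F -> lint a b (fun t => c * F t) = c * lint a b F.
Proof. by move=> cF; apply: cintegralZ => //; exact: lcont_integrable. Qed.

Lemma lcont_cst a b (c : R[i]) : lcont a b (fun=> c).
Proof. by move=> t _ e e0; exists 1 => // s _; rewrite subrr cmod0. Qed.

Lemma lcont_comp a b (p : R -> R[i]) (f : R[i] -> R[i]) : lcont a b p ->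
  (forall t, a <= t <= b -> ccont f (p t)) -> lcont a b (fun t => f (p t)).
Proof.
move=> cp cf t tab e e0; have [d d0 {}cf] := cf _ tab _ e0.
by have [d' d'0 {}cp] := cp _ tab _ d0; exists d' => // s /cp /cf.
Qed.

Lemma lcontD a b F G : lcont a b F -> lcont a b G -> lcont a b (fun t => F t + G t).
Proof.
move=> cF cG t tab e e0; have e20 : 0 < e / 2 by rewrite divr_gt0.
have [d d0 {}cF] := cF _ tab _ e20; have [d' d'0 {}cG] := cG _ tab _ e20.
exists (Num.min d d'); first by rewrite lt_min d0.
move=> s; rewrite lt_min => /andP[/cF Fs /cG Gs].
rewrite (_ : _ - _ = (F s - F t) + (G s - G t)); last by ring.
by rewrite (le_lt_trans (cmodD _ _))// (splitr e) ltrD.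
Qed.

Lemma lcontM a b F G : lcont a b F -> lcont a b G -> lcont a b (fun t => F t * G t).
Proof.
move=> cF cG t tab e e0.
pose K := cmod (F t) + cmod (G t) + 1.
have K0 : 0 < K by rewrite ltr_wpDl// addr_ge0 ?cmod_ge0.
pose e' := Num.min 1 (e / 2 / K).
have e'0 : 0 < e' by rewrite lt_min ltr01 !divr_gt0.
have [d d0 {}cF] := cF _ tab _ e'0; have [d' d'0 {}cG] := cG _ tab _ e'0.
exists (Num.min d d'); first by rewrite lt_min d0.
move=> s; rewrite lt_min => /andP[/cF Fs /cG Gs].
rewrite (_ : _ - _ = F t * (G s - G t) + G t * (F s - F t)
  + (F s - F t) * (G s - G t)); last by ring.
have e'1 : e' <= 1 by rewrite /e' ge_min lexx.
have e'K : e' * K <= e / 2 by rewrite -ler_pdivlMr// /e' ge_min lexx orbT.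
apply: (@le_lt_trans _ _ (e' * K)); last by lra.
rewrite (le_trans (cmodD _ _))// /K 2!(mulrDr e').
apply: lerD.
  apply: (le_trans (cmodD _ _)); rewrite !cmodM !(mulrC e') lerD//.
    by rewrite ler_wpM2l ?cmod_ge0// ltW.
  by rewrite ler_wpM2l ?cmod_ge0// ltW.
by rewrite cmodM ler_pM ?cmod_ge0// ?(ltW Fs)// ltW// (lt_le_trans Gs).
Qed.

End line_integral.

(** * Goursat on rectangles *)

Section geometric_decay.
Context {R : realType}.

Lemma geom_small (q M e : R) : 0 <= q -> q < 1 -> 0 < e ->
  exists N, forall n, (N <= n)%N -> M * q ^+ n < e.
Proof.
move=> q0 q1 e0.
have /cvgrPdist_lt /(_ (e / (`|M| + 1))) : (GRing.exp q : R^nat) @ \oo --> (0 : R).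
  by apply: cvg_expr; rewrite ger0_norm.
rewrite divr_gt0 ?ltr_wpDl// => /(_ isT) [N _ H]; exists N => n Nn.
have := H n Nn; rewrite /= sub0r normrN ger0_norm ?exprn_ge0//.
rewrite ltr_pdivlMr ?ltr_wpDl// => qn.
apply: le_lt_trans qn; rewrite [leRHS]mulrC ler_wpM2r ?exprn_ge0//.
by rewrite (le_trans (ler_norm _))// lerDl.
Qed.

End geometric_decay.

Section rectangles.
Context {R : realType}.
Implicit Types (H : R[i] -> R[i]) (a b c d x y : R).

Definition rect_cont H a b c d :=
  forall x y, a <= x <= b -> c <= y <= d -> ccont H (Complex x y).

(** The integral of H over the boundary of the rectangle, counterclockwise, with
    opposite sides grouped into one integral each. *)
Definition rect_int H a b c d : R[i] :=
  lint a b (fun x => H (Complex x c) - H (Complex x d)) +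
  'i%C * lint c d (fun y => H (Complex b y) - H (Complex a y)).

Lemma lcont_horiz a b y : lcont a b (fun x => Complex x y).
Proof.
move=> x _ e e0; exists e => // s; apply: le_lt_trans.
by rewrite (le_trans (cmod_le _))//= subrr normr0 addr0.
Qed.

Lemma lcont_vert c d x : lcont c d (fun y => Complex x y).
Proof.
move=> y _ e e0; exists e => // s; apply: le_lt_trans.
by rewrite (le_trans (cmod_le _))//= subrr normr0 add0r.
Qed.

Lemma rect_contW H a b c d a' b' c' d' : a <= a' -> b' <= b -> c <= c' -> d' <= d ->
  rect_cont H a b c d -> rect_cont H a' b' c' d'.
Proof.
move=> aa bb cc dd cH x y /andP[ax xb] /andP[cy yd]; apply: cH.
  by rewrite (le_trans aa)//= (le_trans xb).
by rewrite (le_trans cc)//= (le_trans yd).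
Qed.

Lemma rect_lcontx H a b c d y : rect_cont H a b c d -> c <= y <= d ->
  lcont a b (fun x => H (Complex x y)).
Proof.
by move=> cH cyd; apply: lcont_comp (@lcont_horiz a b y) _ => t tab; exact: cH.
Qed.

Lemma rect_lconty H a b c d x : rect_cont H a b c d -> a <= x <= b ->
  lcont c d (fun y => H (Complex x y)).
Proof.
by move=> cH axb; apply: lcont_comp (@lcont_vert c d x) _ => t tab; exact: cH.
Qed.

Lemma lcontN a b (F : R -> R[i]) : lcont a b F -> lcont a b (fun t => - F t).
Proof.
move=> cF t tab e /(cF _ tab) [d d0 {}cF]; exists d => // s /cF.
by rewrite -opprD cmodN.
Qed.

Lemma lcontB a b (F G : R -> R[i]) : lcont a b F -> lcont a b G ->
  lcont a b (fun t => F t - G t).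
Proof. by move=> cF cG; apply: lcontD => //; exact: lcontN. Qed.

Lemma rect_splitx H a b c d m : a <= m -> m <= b -> c <= d ->
  rect_cont H a b c d ->
  rect_int H a b c d = rect_int H a m c d + rect_int H m b c d.
Proof.
move=> am mb cd cH; have ab := le_trans am mb.
have Lx y : c <= y <= d -> lcont a b (fun x => H (Complex x y)).
  exact: rect_lcontx cH.
have Ly x : a <= x <= b -> lcont c d (fun y => H (Complex x y)).
  exact: rect_lconty cH.
have LL := Ly a _; have LR := Ly b _; have LM := Ly m _.
rewrite /rect_int (lint_split am mb); last first.
  by apply: lcontB; apply: Lx; rewrite lexx cd.
rewrite [lint c d _](_ : _ = lint c d (fun y => H (Complex m y) - H (Complex a y)) +
    lint c d (fun y => H (Complex b y) - H (Complex m y))); first by ring.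
rewrite -lintD; last 2 first.
- by apply: lcontB; [apply: LM; rewrite am|apply: LL; rewrite lexx].
- by apply: lcontB; [apply: LR; rewrite ab lexx|apply: LM; rewrite am].
by apply: eq_lint => t _; ring.
Qed.

Lemma rect_splity H a b c d m : c <= m -> m <= d -> a <= b ->
  rect_cont H a b c d ->
  rect_int H a b c d = rect_int H a b c m + rect_int H a b m d.
Proof.
move=> cm md ab cH; have cd := le_trans cm md.
have Lx y : c <= y <= d -> lcont a b (fun x => H (Complex x y)).
  exact: rect_lcontx cH.
have Ly x : a <= x <= b -> lcont c d (fun y => H (Complex x y)).
  exact: rect_lconty cH.
have LL := Lx c _; have LR := Lx d _; have LM := Lx m _.
rewrite /rect_int (lint_split cm md); last first.
  by apply: lcontB; apply: Ly; rewrite lexx ab.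
rewrite [lint a b _](_ : _ = lint a b (fun x => H (Complex x c) - H (Complex x m)) +
    lint a b (fun x => H (Complex x m) - H (Complex x d))); first by ring.
rewrite -lintD; last 2 first.
- by apply: lcontB; [apply: LL; rewrite lexx|apply: LM; rewrite cm].
- by apply: lcontB; [apply: LM; rewrite cm|apply: LR; rewrite cd lexx].
by apply: eq_lint => t _; ring.
Qed.

Lemma cmodi : cmod ('i%C : R[i]) = 1.
Proof. by rewrite cmodE /= expr0n expr1n add0r sqrtr1. Qed.

Lemma rect_int_bound H a b c d (M : R) : a <= b -> c <= d ->
  rect_cont H a b c d ->
  (forall x y, a <= x <= b -> c <= y <= d -> cmod (H (Complex x y)) <= M) ->
  cmod (rect_int H a b c d) <= 4 * M * ((b - a) + (d - c)).
Proof.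
move=> ab cd cH HM.
have cH1 : lcont a b (fun x => H (Complex x c) - H (Complex x d)).
  by apply: lcontB; apply: rect_lcontx cH _; rewrite lexx cd.
have cH2 : lcont c d (fun y => H (Complex b y) - H (Complex a y)).
  by apply: lcontB; apply: rect_lconty cH _; rewrite lexx ab.
have B1 := @cmod_lint R _ _ _ (2 * M) ab cH1.
have B2 := @cmod_lint R _ _ _ (2 * M) cd cH2.
rewrite (le_trans (cmodD _ _))// cmodM cmodi mul1r mulrDr.
rewrite (_ : 4 * M * (b - a) = 2 * (2 * M * (b - a))); last by ring.
rewrite (_ : 4 * M * (d - c) = 2 * (2 * M * (d - c))); last by ring.
apply: lerD; [apply: B1|apply: B2] => t tab.
  apply: le_trans (cmodBD _ _) _; rewrite mulrDl mul1r.
  by apply: lerD; apply: HM; rewrite ?lexx ?cd.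
apply: le_trans (cmodBD _ _) _; rewrite mulrDl mul1r.
by apply: lerD; apply: HM; rewrite ?lexx ?ab.
Qed.

(** Affine functions have zero boundary integral, so H may be replaced by its
    deviation from its first order expansion at z, which is at most e times the
    half perimeter. *)
Lemma rect_int_slope H (q : R[i] -> R[i]) (z : R[i]) a b c d (e : R) :
  a <= b -> c <= d -> rect_cont H a b c d ->
  (forall w, H w = H z + q w * (w - z)) ->
  a <= complex.Re z <= b -> c <= complex.Im z <= d ->
  (forall x y, a <= x <= b -> c <= y <= d -> cmod (q (Complex x y) - q z) <= e) ->
  cmod (rect_int H a b c d) <= 4 * e * ((b - a) + (d - c)) ^+ 2.
Proof.
move=> ab cd cH Hq za zc qe.
pose G w := H w - (H z + q z * (w - z)).
have cG : rect_cont G a b c d.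
  move=> x y xab ycd; apply: ccontD; first exact: cH.
  apply: ccontN; apply: ccontD; first exact: ccont_cst.
  apply: ccontM; first exact: ccont_cst.
  by apply: ccontD; [exact: ccont_id|exact: ccont_cst].
have GE : rect_int H a b c d = rect_int G a b c d.
  have cH1 : lcont a b (fun x => H (Complex x c) - H (Complex x d)).
    by apply: lcontB; apply: rect_lcontx cH _; rewrite lexx cd.
  have cH2 : lcont c d (fun y => H (Complex b y) - H (Complex a y)).
    by apply: lcontB; apply: rect_lconty cH _; rewrite lexx ab.
  rewrite /rect_int.
  rewrite (@eq_lint R a b (fun x => G _ - G _) (fun x => (H (Complex x c) - H (Complex x d))
     - q z * (Complex 0 (c - d)))); last first.
    move=> t _; rewrite /G.
    rewrite (_ : Complex 0 (c - d) = Complex t c - Complex t d); first by ring.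
    by apply: complex_ext => /=; ring.
  rewrite (@eq_lint R c d (fun y => G _ - G _) (fun y => (H (Complex b y) - H (Complex a y))
     - q z * (Complex (b - a) 0))); last first.
    move=> t _; rewrite /G.
    rewrite (_ : Complex (b - a) 0 = Complex b t - Complex a t); first by ring.
    by apply: complex_ext => /=; ring.
  rewrite (lintB cH1 (@lcont_cst _ _ _ _)) (lintB cH2 (@lcont_cst _ _ _ _)).
  rewrite !lint_cst//.
  set u := lint _ _ _; set v := lint _ _ _.
  have -> : Complex 0 (c - d) = - ('i%C * (d - c)%:C%C) :> R[i].
    by apply: complex_ext => /=; ring.
  rewrite -[Complex (b - a) 0]/((b - a)%:C%C).
  by ring.
rewrite GE expr2 mulrA -(mulrA 4).
apply: rect_int_bound => // x y xab ycd.
rewrite /G Hq (_ : _ - _ = (q (Complex x y) - q z) * (Complex x y - z)); last by ring.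
rewrite cmodM ler_pM ?cmod_ge0// ?qe//.
rewrite (le_trans (cmod_le _))// lerD//.
  case: z za {zc Hq qe G cG GE} => zx zy /= za; rewrite ler_norml; lra.
case: z zc {za Hq qe G cG GE} => zx zy /= za; rewrite ler_norml; lra.
Qed.

(** Bisection: if the integral were not 0, a quarter of the rectangle would carry
    at least its share, in proportion to area, of the integral, then a quarter of
    that quarter, and so on. At the common point of these rectangles
    differentiability makes the integral small compared to the area. *)
Lemma goursat H a b c d : a < b -> c < d ->
  (forall x y, a <= x <= b -> c <= y <= d -> cdiff H (Complex x y)) ->
  rect_int H a b c d = 0.
Proof.
move=> ab cd dH.
have cH : rect_cont H a b c d by move=> x y xab ycd; exact/cdiff_cont/dH.
apply/eqP; rewrite -cmod_eq0; apply/negPn/negP => E0.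
have {E0} : 0 < cmod (rect_int H a b c d) by rewrite lt_def E0 cmod_ge0.
set E := cmod _ => E0.
pose L n := (b - a) * 2^-1 ^+ n; pose M n := (d - c) * 2^-1 ^+ n.
have L0 n : 0 < L n by rewrite mulr_gt0 ?subr_gt0// exprn_gt0.
have M0 n : 0 < M n by rewrite mulr_gt0 ?subr_gt0// exprn_gt0.
have LS n : L n = L n.+1 + L n.+1 by rewrite /L exprS; field.
have MS n : M n = M n.+1 + M n.+1 by rewrite /M exprS; field.
(* Half the density of the integral per unit of area: the half makes the
   initial rectangle exceed it strictly. *)
pose K := E / 2 / ((b - a) * (d - c)).
have K0 : 0 < K by rewrite !divr_gt0// mulr_gt0 ?subr_gt0.
(* A point s stands for the rectangle of the n-th generation with lower left
   corner s. *)
pose I n (s : R * R) := [/\ a <= s.1, s.1 + L n <= b, c <= s.2 & s.2 + M n <= d].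
pose bad n (s : R * R) := K * (L n * M n) <
  cmod (rect_int H s.1 (s.1 + L n) s.2 (s.2 + M n)).
pose nested n (s s' : R * R) := [/\ s.1 <= s'.1, s'.1 + L n.+1 <= s.1 + L n,
  s.2 <= s'.2 & s'.2 + M n.+1 <= s.2 + M n].
have half (ns : nat * (R * R)) : exists s', I ns.1 ns.2 -> bad ns.1 ns.2 ->
    bad ns.1.+1 s' /\ nested ns.1 ns.2 s'.
  case: ns => n [x y] /=.
  have [Is|] := pselect (I n (x, y)); last by exists 0.
  case: (Is) => /= ax xb cy yd.
  have := LS n; have := MS n; have := L0 n.+1; have := M0 n.+1.
  set L' := L n.+1; set M' := M n.+1 => M'0 L'0 ME LE.
  have cH' : rect_cont H x (x + L n) y (y + M n) by exact: rect_contW cH.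
  have E1 : rect_int H x (x + L n) y (y + M n) =
      rect_int H x (x + L') y (y + M n) + rect_int H (x + L') (x + L n) y (y + M n).
    by apply: rect_splitx => //; lra.
  have E2 : rect_int H x (x + L') y (y + M n) =
      rect_int H x (x + L') y (y + M') + rect_int H x (x + L') (y + M') (y + M n).
    by apply: rect_splity; [move: LE ME L'0 M'0; clear; lra..|apply: rect_contW cH'; move: LE ME L'0 M'0; clear; lra].
  have E3 : rect_int H (x + L') (x + L n) y (y + M n) =
      rect_int H (x + L') (x + L n) y (y + M') + rect_int H (x + L') (x + L n) (y + M') (y + M n).
    by apply: rect_splity; [move: LE ME L'0 M'0; clear; lra..|apply: rect_contW cH'; move: LE ME L'0 M'0; clear; lra].
  have LE' : x + L n = x + L' + L' by rewrite LE addrA.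
  have ME' : y + M n = y + M' + M' by rewrite ME addrA.
  have [h1|h1] := ltP (K * (L' * M')) (cmod (rect_int H x (x + L') y (y + M'))).
    by exists (x, y) => _ _; split => //; split; rewrite /= -/L' -/M'; move: LE ME L'0 M'0; clear; lra.
  have [h2|h2] := ltP (K * (L' * M')) (cmod (rect_int H x (x + L') (y + M') (y + M n))).
    exists (x, y + M') => _ _; split; first by rewrite /bad /= -ME'.
    by split; rewrite /= -/L' -/M'; move: LE ME L'0 M'0; clear; lra.
  have [h3|h3] := ltP (K * (L' * M')) (cmod (rect_int H (x + L') (x + L n) y (y + M'))).
    exists (x + L', y) => _ _; split; first by rewrite /bad /= -LE'.
    by split; rewrite /= -/L' -/M'; move: LE ME L'0 M'0; clear; lra.
  have [h4|h4] := ltP (K * (L' * M')) (cmod (rect_int H (x + L') (x + L n) (y + M') (y + M n))).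
    exists (x + L', y + M') => _ _; split; first by rewrite /bad /= -LE' -ME'.
    by split; rewrite /= -/L' -/M'; move: LE ME L'0 M'0; clear; lra.
  exists 0 => _ h; exfalso; move: h; apply/negP; rewrite /bad -leNgt [X in cmod X]E1 E2 E3.
  rewrite (_ : K * (L n * M n) = (K * (L' * M') + K * (L' * M')) +
    (K * (L' * M') + K * (L' * M'))); last by rewrite LE ME; ring.
  by do 2 (apply: le_trans (cmodD _ _) _; apply: lerD => //);
    apply: le_trans (cmodD _ _) _; apply: lerD.
have [step stepP] := choice half.
pose s := fix s n := if n is n'.+1 then step (n', s n') else (a, c).
have sP n : I n (s n) /\ bad n (s n).
  elim: n => [|n [IHI IHb]].
    rewrite /I /bad /L /M /= !expr0 !mulr1 [a + _]addrC subrK [c + _]addrC subrK.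
    rewrite !lexx; split => //.
    rewrite -/E /K divfK ?gt_eqF ?mulr_gt0 ?subr_gt0//.
    by rewrite ltr_pdivrMr// mulrDr mulr1 ltrDl.
  have [bS [n1 n2 n3 n4]] := stepP (n, s n) IHI IHb.
  by case: IHI => i1 i2 i3 i4; split => //; split; rewrite /=; lra.
have sn n : nested n (s n) (s n.+1).
  by have [i1 i2] := sP n; have [] := stepP (n, s n) i1 i2.
have nest n k : [/\ (s n).1 <= (s (n + k)%N).1, (s (n + k)%N).1 + L (n + k)%N <= (s n).1 + L n,
    (s n).2 <= (s (n + k)%N).2 & (s (n + k)%N).2 + M (n + k)%N <= (s n).2 + M n].
  elim: k => [|k [h1 h2 h3 h4]]; first by rewrite addn0.
  by rewrite addnS; have [g1 g2 g3 g4] := sn (n + k)%N; split; lra.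
have cross n k : (s k).1 <= (s n).1 + L n /\ (s k).2 <= (s n).2 + M n.
  have [nk|kn] := leqP n k.
    rewrite -(subnKC nk); have [h1 h2 h3 h4] := nest n (k - n)%N.
    by have := L0 (n + (k - n))%N; have := M0 (n + (k - n))%N; lra.
  have := nest k (n - k)%N; rewrite subnKC 1?ltnW// => -[h1 h2 h3 h4].
  by have := L0 n; have := M0 n; lra.
pose A := [set (s n).1 | n in [set: nat]]; pose C := [set (s n).2 | n in [set: nat]].
have A0 : A !=set0 by exists a; exists 0%N.
have C0 : C !=set0 by exists c; exists 0%N.
have supA n : (s n).1 <= sup A <= (s n).1 + L n.
  have ubA : ubound A ((s n).1 + L n) by move=> _ [k _ <-]; have [] := cross n k.
  apply/andP; split; last exact: ge_sup.
  by apply: ub_le_sup; [exists ((s n).1 + L n)|exists n].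
have supC n : (s n).2 <= sup C <= (s n).2 + M n.
  have ubC : ubound C ((s n).2 + M n) by move=> _ [k _ <-]; have [] := cross n k.
  apply/andP; split; last exact: ge_sup.
  by apply: ub_le_sup; [exists ((s n).2 + M n)|exists n].
pose z := Complex (sup A) (sup C).
have [q cq Hq] : cdiff H z.
  apply: dH; have [[/= i1 i2 i3 i4] _] := sP 0%N.
    by have /= := supA 0%N; move: i2; clear; lra.
  by have /= := supC 0%N; move: i4; clear; lra.
pose S := (b - a) + (d - c); have S0 : 0 < S by rewrite addr_gt0 ?subr_gt0.
(* The accuracy at which the bound of rect_int_slope equals K times the area. *)
pose e := K * ((b - a) * (d - c)) / (4 * S ^+ 2).
have e0 : 0 < e by rewrite divr_gt0//; [rewrite mulr_gt0// mulr_gt0 ?subr_gt0|rewrite mulr_gt0// exprn_gt0].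
have [del del0 {}cq] := cq _ e0.
have h1 : 0 <= 2^-1 :> R by rewrite invr_ge0.
have h2 : 2^-1 < 1 :> R by rewrite invf_lt1// ltr1n.
have [N NP] := @geom_small R 2^-1 S del h1 h2 del0.
have hN : S * 2^-1 ^+ N < del by exact: NP.
have [[i1 i2 i3 i4] bN] := sP N.
have := supA N; have := supC N => sC sA.
move: bN; rewrite /bad; apply/negP; rewrite -leNgt.
apply: (le_trans (@rect_int_slope H q z _ _ _ _ e _ _ _ Hq sA sC _)).
- by rewrite lerDl ltW.
- by rewrite lerDl ltW.
- exact: rect_contW cH.
- move=> x y xb yb; apply/ltW/cq; apply: le_lt_trans hN.
  apply: le_trans (cmod_le _) _; rewrite /= /S mulrDl -/(L N) -/(M N).
  by apply: lerD; rewrite ler_norml; lra.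
- rewrite (_ : _ + _ = S * 2^-1 ^+ N); last by rewrite /S /L /M; ring.
  rewrite /e /L /M le_eqVlt; apply/orP; left; apply/eqP.
  by field; rewrite gt_eqF.
Qed.

End rectangles.

Section goursat_exceptional.
Context {R : realType}.
Implicit Types (H : R[i] -> R[i]) (a b c d x y : R).

Lemma lint_point a (F : R -> R[i]) : lint a a F = 0.
Proof.
by rewrite /lint set_itv1; apply: complex_ext; rewrite /= Rintegral_set1.
Qed.

Lemma rect_int_degx H a c d : c <= d -> rect_int H a a c d = 0.
Proof.
move=> cd; rewrite /rect_int lint_point (@eq_lint _ _ _ _ (fun=> 0)); last first.
  by move=> t _; rewrite subrr.
by rewrite lint_cst// mul0r mulr0 addr0.
Qed.

Lemma rect_int_degy H a b c : a <= b -> rect_int H a b c c = 0.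
Proof.
move=> ab; rewrite /rect_int lint_point (@eq_lint _ _ _ _ (fun=> 0)); last first.
  by move=> t _; rewrite subrr.
by rewrite lint_cst// mul0r mulr0 addr0.
Qed.

Lemma goursat_le H a b c d : a <= b -> c <= d ->
  (forall x y, a <= x <= b -> c <= y <= d -> cdiff H (Complex x y)) ->
  rect_int H a b c d = 0.
Proof.
rewrite le_eqVlt => /predU1P[<-|ab] cd dH; first exact: rect_int_degx.
move: cd; rewrite le_eqVlt => /predU1P[cdE|cd]; last exact: goursat.
by rewrite -cdE rect_int_degy// ltW.
Qed.

(** The rectangle is cut so that the exceptional point sits in a small piece of
    side of order del. The other pieces contribute 0, and the small one at most a
    multiple of del, because H is bounded near p. *)
Lemma goursat_except H a b c d (p : R[i]) : a <= b -> c <= d ->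
  rect_cont H a b c d ->
  (forall x y, a <= x <= b -> c <= y <= d -> Complex x y != p ->
    cdiff H (Complex x y)) ->
  rect_int H a b c d = 0.
Proof.
move=> ab cd cH dH.
have [/andP[pa pc]|pout] :=
    boolP ((a <= complex.Re p <= b) && (c <= complex.Im p <= d)); last first.
  apply: goursat_le => // x y xab ycd; apply: dH => //.
  by apply: contra pout => /eqP <- /=; rewrite xab ycd.
case: p => px py /= in pa pc dH *.
have [d0 d00 Hd0] := cH _ _ pa pc _ ltr01.
pose B := cmod (H (Complex px py)) + 1.
have B0 : 0 < B by rewrite ltr_wpDl// cmod_ge0.
have HB w : cmod (w - Complex px py) < d0 -> cmod (H w) <= B.
  by move=> /Hd0 h; have := cmodB_le (H w) (H (Complex px py)); rewrite /B; lra.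
apply/eqP; rewrite -cmod_eq0; apply/negPn/negP => E0.
have {E0} : 0 < cmod (rect_int H a b c d) by rewrite lt_def E0 cmod_ge0.
set E := cmod _ => E0.
pose del := Num.min (d0 / 3) (E / (17 * B)).
have del0 : 0 < del by rewrite lt_min !divr_gt0// mulr_gt0.
have del1 : del <= d0 / 3 by rewrite ge_min lexx.
have del2 : 16 * B * del < E.
  apply: (@lt_le_trans _ _ (17 * B * del)).
    by rewrite ltr_pM2r// ltr_pM2r// ltr_nat.
  by rewrite mulrC -ler_pdivlMr ?mulr_gt0// ge_min lexx orbT.
(* Truncation at the sides of the rectangle: when p is on a side, the piece
   beyond it is degenerate instead of free of p. *)
pose a1 := Num.max a (px - del); pose b1 := Num.min b (px + del).
pose c1 := Num.max c (py - del); pose d1 := Num.min d (py + del).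
have [a1P [a1a a1p]] : (a1 = a \/ a1 < px) /\ a <= a1 /\ px - del <= a1 <= px.
  rewrite /a1; case: (leP a (px - del)) => h.
    by split; [right|split => //]; move: pa h del0; clear; lra.
  by split; [left|split => //]; move: pa h del0; clear; lra.
have [b1P [b1b b1p]] : (b1 = b \/ px < b1) /\ b1 <= b /\ px <= b1 <= px + del.
  rewrite /b1; case: (leP b (px + del)) => h.
    by split; [left|split => //]; move: pa h del0; clear; lra.
  by split; [right|split => //]; move: pa h del0; clear; lra.
have [c1P [c1c c1p]] : (c1 = c \/ c1 < py) /\ c <= c1 /\ py - del <= c1 <= py.
  rewrite /c1; case: (leP c (py - del)) => h.
    by split; [right|split => //]; move: pc h del0; clear; lra.
  by split; [left|split => //]; move: pc h del0; clear; lra.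
have [d1P [d1d d1p]] : (d1 = d \/ py < d1) /\ d1 <= d /\ py <= d1 <= py + del.
  rewrite /d1; case: (leP d (py + del)) => h.
    by split; [left|split => //]; move: pc h del0; clear; lra.
  by split; [right|split => //]; move: pc h del0; clear; lra.
have a1b1 : a1 <= b1 by move: a1p b1p; clear; lra.
have c1d1 : c1 <= d1 by move: c1p d1p; clear; lra.
have a1b : a1 <= b by apply: le_trans b1b.
have c1d : c1 <= d by apply: le_trans d1d.
have ab1 : a <= b1 by apply: le_trans a1b1.
have cHm : rect_cont H a1 b1 c d by apply: rect_contW cH.
have cHr : rect_cont H a1 b c d by apply: rect_contW cH.
have cHmu : rect_cont H a1 b1 c1 d by apply: rect_contW cHm.
have EE : rect_int H a b c d = rect_int H a1 b1 c1 d1.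
  rewrite (rect_splitx a1a a1b cd cH) (rect_splitx a1b1 b1b cd cHr).
  rewrite (rect_splity c1c c1d a1b1 cHm) (rect_splity c1d1 d1d a1b1 cHmu).
  have -> : rect_int H a a1 c d = 0.
    case: a1P => [->|a1lt]; first exact: rect_int_degx.
    apply: goursat_le => // x y /andP[? xa1] ycd; apply: dH => //.
      by apply/andP; split => //; apply: le_trans a1b.
    by apply/eqP => -[xp _]; move: xa1; rewrite xp leNgt a1lt.
  have -> : rect_int H b1 b c d = 0.
    case: b1P => [->|b1lt]; first exact: rect_int_degx.
    apply: goursat_le => // x y /andP[xb1 ?] ycd; apply: dH => //.
      by apply/andP; split => //; apply: le_trans xb1.
    by apply/eqP => -[xp _]; move: xb1; rewrite xp leNgt b1lt.
  have xab x : a1 <= x <= b1 -> a <= x <= b.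
    by move=> /andP[h1 h2]; rewrite (le_trans a1a h1) (le_trans h2).
  have -> : rect_int H a1 b1 c c1 = 0.
    case: c1P => [->|c1lt]; first exact: rect_int_degy.
    apply: goursat_le => // x y /xab xb /andP[? yc1]; apply: dH => //.
      by apply/andP; split => //; apply: le_trans c1d.
    by apply/eqP => -[_ yp]; move: yc1; rewrite yp leNgt c1lt.
  have -> : rect_int H a1 b1 d1 d = 0.
    case: d1P => [->|d1lt]; first exact: rect_int_degy.
    apply: goursat_le => // x y /xab xb /andP[yd1 ?]; apply: dH => //.
      by apply/andP; split => //; apply: le_trans yd1; apply: le_trans c1d1.
    by apply/eqP => -[_ yp]; move: yd1; rewrite yp leNgt d1lt.
  by rewrite addr0 !add0r addr0.
have EB : E <= 4 * B * ((b1 - a1) + (d1 - c1)).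
  rewrite /E EE; apply: rect_int_bound => //; first exact: rect_contW cHmu.
  move=> x y xab ycd; apply: HB; apply: le_lt_trans (cmod_le _) _ => /=.
  apply: (@le_lt_trans _ _ (del + del)); last by move: del1 d00; clear; lra.
  by apply: lerD; rewrite ler_norml;
    move: a1p b1p c1p d1p xab ycd; clear; lra.
suff : E <= 16 * B * del by rewrite leNgt del2.
apply: (le_trans EB); rewrite (_ : 16 * B * del = 4 * B * (4 * del)); last by ring.
by rewrite ler_pM2l ?mulr_gt0//; move: a1p b1p c1p d1p; clear; lra.
Qed.

End goursat_exceptional.

(** * The complex exponential *)

Section trigonometric_estimates.
Context {R : realType}.
Implicit Types x y : R.

Lemma sin_mvt y : exists2 c, `|c| <= `|y| & sin y = cos c * y.
Proof.
wlog y0 : y / 0 <= y => [hw|].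
  have [/hw//|/ltW y0] := leP 0 y.
  have [|c cy sE] := hw (- y); first by rewrite oppr_ge0.
  exists c; first by rewrite -[`|y|]normrN.
  by apply: oppr_inj; rewrite -sinN sE mulrN.
have sD x : x \in `]0, y[%R -> is_derive x 1 sin (cos x).
  by move=> _; exact: is_derive_sin.
have sC : {within `[0, y], continuous (@sin R)}.
  by apply: continuous_subspaceT; exact: continuous_sin.
have [c cI E] := MVT_segment y0 sD sC.
exists c; last by move: E; rewrite sin0 !subr0.
by move: cI; rewrite in_itv /= => /andP[c0 cy]; rewrite !ger0_norm.
Qed.

Lemma norm_sin_le y : `|sin y| <= `|y|.
Proof.
have [c _ ->] := sin_mvt y; rewrite normrM ler_piMl//.
by rewrite ler_norml cos_geN1 cos_le1.
Qed.

Lemma cos_half y : 1 - cos y = 2 * sin (y / 2) ^+ 2.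
Proof.
have h := cos2Dsin2 (y / 2).
have -> : cos y = cos (y / 2 + y / 2) by rewrite -splitr.
by rewrite cosD -!expr2; lra.
Qed.

Lemma sqr_le_norm x y : `|x| <= `|y| -> x ^+ 2 <= y ^+ 2.
Proof.
move=> xy; rewrite -(real_normK (num_real x)) -(real_normK (num_real y)).
by rewrite ler_sqr ?nnegrE.
Qed.

Lemma norm_cosB1_le y : `|cos y - 1| <= y ^+ 2 / 2.
Proof.
rewrite distrC cos_half ger0_norm; last by rewrite mulr_ge0 ?sqr_ge0.
have := sqr_le_norm (norm_sin_le (y / 2)).
rewrite exprMn => h; have := sqr_ge0 y; lra.
Qed.

Lemma norm_sinB_le y : `|sin y - y| <= `|y| ^+ 3 / 2.
Proof.
have [c cy ->] := sin_mvt y.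
rewrite (_ : cos c * y - y = (cos c - 1) * y); last by ring.
rewrite normrM exprSr -(mulrA _ `|y|) (mulrC `|y|) mulrA ler_wpM2r// (le_trans (norm_cosB1_le c))//.
by rewrite ler_pM2r// sqr_le_norm// normr_id.
Qed.

Lemma expR_second_order x : `|x| <= 2^-1 -> 0 <= expR x - 1 - x <= 2 * x ^+ 2.
Proof.
move=> x2; have := expR_ge1Dx x => h1; apply/andP; split; first by lra.
have xb : - 2^-1 <= x <= 2^-1 by rewrite -ler_norml.
have h2 : 1 - x <= expR (- x) := expR_ge1Dx (- x).
have h3 : expR x * (1 - x) <= 1.
  have : expR x * (1 - x) <= expR x * expR (- x) by rewrite ler_pM2l ?expR_gt0.
  by rewrite expRxMexpNx_1.
have x1 : 0 < 1 - x by lra.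
rewrite -(ler_pM2r x1); have xx := sqr_ge0 x.
have : 0 <= x ^+ 2 * (1 - 2 * x) by rewrite mulr_ge0//; lra.
nra.
Qed.

End trigonometric_estimates.

Section complex_exponential.
Context {R : realType}.
Implicit Types (z w : R[i]).

Definition cexp z : R[i] := (expR (complex.Re z))%:C%C * cexpi (complex.Im z).

Lemma cexpD z w : cexp (z + w) = cexp z * cexp w.
Proof.
rewrite /cexp.
have -> : complex.Re (z + w) = complex.Re z + complex.Re w by case: z w => ? ? [].
have -> : complex.Im (z + w) = complex.Im z + complex.Im w by case: z w => ? ? [].
by rewrite expRD cexpiD rmorphM; ring.
Qed.

Lemma cmod_cexp z : cmod (cexp z) = expR (complex.Re z).
Proof. by rewrite cmodM cmod_cexpi mulr1 cmodC ger0_norm// expR_ge0. Qed.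

(** Obtained from the second order expansions of the real exponential, the cosine
    and the sine, so that no complex power series is involved. *)
Lemma cexp_second_order z : cmod z <= 2^-1 ->
  cmod (cexp z - 1 - z) <= 10 * cmod z ^+ 2.
Proof.
move=> z2; have := Re_le_cmod z; have := Im_le_cmod z.
have RE : complex.Re (cexp z - 1 - z) =
    expR (complex.Re z) * cos (complex.Im z) - 1 - complex.Re z.
  by case: z {z2} => a b /=; ring.
have IE : complex.Im (cexp z - 1 - z) =
    expR (complex.Re z) * sin (complex.Im z) - complex.Im z.
  by case: z {z2 RE} => a b /=; ring.
have := cmod_le (cexp z - 1 - z); rewrite RE IE {RE IE}.
move: z2; set m := cmod z; set x := complex.Re z; set y := complex.Im z.
move=> z2 zle yz xz; apply: (le_trans zle) => {zle}.
have x2 := le_trans xz z2; have y2 := le_trans yz z2.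
have xm : x ^+ 2 <= m ^+ 2.
  by rewrite sqr_le_norm// (le_trans xz)// ler_norm.
have ym : y ^+ 2 <= m ^+ 2.
  by rewrite sqr_le_norm// (le_trans yz)// ler_norm.
have E := expR_second_order x2.
have e2 : `|expR x - 1 - x| <= 2 * m ^+ 2 by rewrite ger0_norm; lra.
have c1 := norm_cosB1_le y; have s1 := norm_sinB_le y.
have m0 : 0 <= m by rewrite (le_trans _ xz).
have s2 : `|sin y - y| <= m ^+ 2.
  apply: (le_trans s1); rewrite exprS real_normK ?num_real//.
  apply: (@le_trans _ _ (2^-1 * y ^+ 2 / 2)).
    by rewrite ler_pM2r// ler_wpM2r// sqr_ge0.
  by have := sqr_ge0 y; lra.
have c2 : `|cos y| <= 1 by rewrite ler_norml cos_geN1 cos_le1.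
have s3 : `|sin y| <= m := le_trans (norm_sin_le y) yz.
have e3 : `|expR x - 1| <= 3 * m.
  rewrite (_ : _ - 1 = (expR x - 1 - x) + x); last by ring.
  apply: le_trans (ler_normD _ _) _.
  apply: (@le_trans _ _ (2 * m ^+ 2 + m)); first exact: lerD.
  have : m * m <= 2^-1 * m by rewrite ler_wpM2r.
  by rewrite expr2; lra.
rewrite (_ : expR x * cos y - 1 - x =
   (expR x - 1 - x) * cos y + (cos y - 1) + x * (cos y - 1)); last by ring.
rewrite (_ : expR x * sin y - y =
   (expR x - 1) * sin y + (sin y - y)); last by ring.
have A1 : `|(expR x - 1 - x) * cos y| <= 2 * m ^+ 2.
  by rewrite normrM -[leRHS]mulr1 ler_pM.
have A2 : `|x * (cos y - 1)| <= m ^+ 2.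
  rewrite normrM -[leRHS]mul1r ler_pM//; first by lra.
  by apply: (le_trans c1); lra.
have A3 : `|(expR x - 1) * sin y| <= 3 * m ^+ 2.
  by rewrite normrM expr2 mulrA ler_pM.
apply: (@le_trans _ _ ((2 * m ^+ 2 + m ^+ 2 + m ^+ 2) + (3 * m ^+ 2 + m ^+ 2))).
  apply: lerD; (apply: le_trans (ler_normD _ _) _; apply: lerD => //).
  apply: le_trans (ler_normD _ _) _; apply: lerD => //.
  by apply: (le_trans c1); lra.
by have := sqr_ge0 m; lra.
Qed.

Lemma cexp0 : cexp 0 = 1.
Proof. by rewrite /cexp /= expR0 cexpi0 mulr1. Qed.

Lemma cdiff_cexp z : cdiff cexp z.
Proof.
have d0 : cdiff cexp 0.
  exists (fun w => if w == 0 then 1 else (cexp w - 1) / w); last first.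
    move=> w; rewrite cexp0 subr0; case: eqP => [->|/eqP w0].
      by rewrite cexp0 mulr0 addr0.
    by rewrite divfK// addrC subrK.
  move=> e e0; exists (Num.min 2^-1 (e / 10)).
    by rewrite lt_min invr_gt0 divr_gt0 ?ltr0n.
  move=> w; rewrite subr0 lt_min => /andP[w2 we]; rewrite /= eqxx.
  case: eqP => [_|/eqP w0]; first by rewrite subrr cmod0.
  have -> : (cexp w - 1) / w - 1 = (cexp w - 1 - w) / w by rewrite [RHS]mulrBl mulfV.
  rewrite cmodM cmodV ltr_pdivrMr ?cmod_gt0//.
  apply: le_lt_trans (cexp_second_order (ltW w2)) _.
  by rewrite expr2 mulrA ltr_pM2r ?cmod_gt0// mulrC -ltr_pdivlMr.
have -> : cexp = (fun w => cexp z * cexp (w + - z)).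
  by apply/funext => w; rewrite -cexpD addrC subrK.
apply: cdiffM; first exact: cdiff_cst.
apply: cdiff_comp; first by apply: cdiffD; [exact: cdiff_id|exact: cdiff_cst].
by rewrite subrr.
Qed.

(** A real exponential determines the real part, and two points of the unit circle
    with arguments at distance at most pi coincide only if the arguments do. *)
Lemma cexp_inj_strip z w : cexp z = cexp w -> `|complex.Im z - complex.Im w| <= pi ->
  z = w.
Proof.
move=> E h.
have ER : complex.Re z = complex.Re w.
  by have := congr1 (@cmod R) E; rewrite !cmod_cexp => /expR_inj.
have EI : cexpi (complex.Im z) = cexpi (complex.Im w).
  move: E; rewrite /cexp ER => /mulfI; apply.
  by rewrite -cmod_gt0 cmodC normr_gt0 gt_eqF// expR_gt0.
apply: complex_ext => //; apply/eqP; rewrite -subr_eq0 -normr_eq0; apply/eqP.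
apply: cos_inj; rewrite ?in_itv /= ?normr_ge0 ?lexx ?pi_ge0//.
rewrite cos0; have : cexpi (complex.Im z - complex.Im w) = 1.
  by rewrite cexpiD cexpiN EI mulfV// cexpi_neq0.
move=> /(congr1 (@complex.Re R)) /= <-.
by case: (ger0P (complex.Im z - complex.Im w)) => // _; rewrite cosN.
Qed.

End complex_exponential.

(** * The Cauchy formula on circles *)

Section circles.
Context {R : realType}.
Implicit Types (f K q : R[i] -> R[i]) (z w : R[i]) (r s t : R).

Definition circle r t : R[i] := r%:C%C * cexpi t.

Lemma cmod_circle r t : 0 <= r -> cmod (circle r t) = r.
Proof. by move=> r0; rewrite cmodM cmod_cexpi mulr1 cmodC ger0_norm. Qed.

Lemma cexp_circle x t : cexp (Complex x t) = circle (expR x) t.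
Proof. by []. Qed.

Lemma circle_neq0 r t : 0 < r -> circle r t != 0.
Proof. by move=> r0; rewrite -cmod_gt0 cmod_circle// ltW. Qed.

Lemma lcont_circle r a b : lcont a b (circle r).
Proof.
have H : lcont a b (fun t => r%:C%C * cexp (Complex 0 t)).
  apply: lcontM; first exact: lcont_cst.
  apply: (lcont_comp (@lcont_vert R a b 0)) => t _.
  exact/cdiff_cont/cdiff_cexp.
move=> t tab e /(H _ tab) [d d0 {}H]; exists d => // u /H.
by rewrite !cexp_circle expR0 /circle !mul1r.
Qed.

Lemma pi2_ge0 : 0 <= 2 * pi :> R. Proof. by rewrite mulr_ge0// pi_ge0. Qed.

Lemma cexpi_2pi : cexpi (2 * pi) = 1 :> R[i].
Proof. by rewrite /cexpi mulr_natl cos2pi sin2pi. Qed.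

(** The substitution w = exp z turns both integrals into integrals of the same
    function over the vertical sides of the rectangle above [ln r1, ln r2]; the
    horizontal sides cancel by periodicity. The exceptional point z0 is what
    allows K to be a difference quotient. *)
Lemma circle_invariance K z0 r1 r2 : 0 < r1 -> r1 <= r2 ->
  (forall w, r1 <= cmod w <= r2 -> ccont K w) ->
  (forall w, r1 <= cmod w <= r2 -> w != z0 -> cdiff K w) ->
  lint 0 (2 * pi) (fun t => K (circle r1 t) * circle r1 t) =
  lint 0 (2 * pi) (fun t => K (circle r2 t) * circle r2 t).
Proof.
move=> r10 r12 cK dK; have r20 : 0 < r2 := lt_le_trans r10 r12.
pose H z := K (cexp z) * cexp z.
pose A := ln r1; pose B := ln r2.
have AB : A <= B by rewrite ler_ln ?posrE.
have rH x y : A <= x <= B -> r1 <= cmod (cexp (Complex x y)) <= r2.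
  move=> /andP[Ax xB]; rewrite cmod_cexp /=.
  by rewrite -(lnK r10) -(lnK r20) !ler_expR Ax xB.
have cH y1 y2 : rect_cont H A B y1 y2.
  move=> x y Ax _; apply: ccontM; last exact/cdiff_cont/cdiff_cexp.
  by apply: ccont_comp; [exact/cdiff_cont/cdiff_cexp|exact/cK/rH].
(* In a strip of height at most pi the point z0 has at most one preimage by exp,
   so one exceptional point is enough; two such strips make a full turn. *)
have strip y1 y2 : y1 <= y2 -> y2 - y1 <= pi -> rect_int H A B y1 y2 = 0.
  move=> y12 ypi.
  have [p pP] : exists p, forall x y, A <= x <= B -> y1 <= y <= y2 ->
      Complex x y != p -> cexp (Complex x y) != z0.
    have [[x0 [y0 [h0 E0]]]|] := pselect (exists x y, y1 <= y <= y2 /\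
      cexp (Complex x y) = z0).
      exists (Complex x0 y0) => x y _ yy; apply: contra => /eqP E.
      apply/eqP; apply: cexp_inj_strip; first by rewrite E E0.
      by rewrite /= ler_norml; move: yy h0 ypi; clear; lra.
    move=> N; exists 0 => x y xA yy _; apply/negP => /eqP E; apply: N.
    by exists x, y.
  apply: (goursat_except (p := p)) => // x y xA yy /(pP _ _ xA yy) E.
  apply: cdiffM; last exact: cdiff_cexp.
  apply: cdiff_comp; first exact: cdiff_cexp.
  by apply: dK => //; exact: rH.
have pi0 : 0 <= pi :> R := pi_ge0 R.
have tot : rect_int H A B 0 (2 * pi) = 0.
  rewrite (rect_splity pi0 _ AB (cH _ _)); last by lra.
  by rewrite !strip ?addr0//; lra.
have per x : H (Complex x 0) = H (Complex x (2 * pi)).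
  have E : cexp (Complex x 0) = cexp (Complex x (2 * pi)).
    by rewrite !cexp_circle /circle cexpi_2pi cexpi0.
  by rewrite /H E.
move: tot; rewrite /rect_int (@eq_lint _ _ _ _ (fun=> 0)); last first.
  by move=> t _; rewrite per subrr.
rewrite lint_cst// mul0r add0r => /eqP; rewrite mulf_eq0 -cmod_eq0 cmodi oner_eq0 /=.
rewrite lintB; last 2 first.
- by apply: (rect_lconty (cH _ _)); rewrite AB lexx.
- by apply: (rect_lconty (cH _ _)); rewrite AB lexx.
rewrite subr_eq0 => /eqP h; apply/esym; move: h.
rewrite (@eq_lint _ _ _ _ (fun t => K (circle r2 t) * circle r2 t)); last first.
  by move=> t _; rewrite /H !cexp_circle /B lnK ?posrE.
move=> ->; apply: eq_lint => t _.
by rewrite /H !cexp_circle /A lnK ?posrE.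
Qed.

(** This is c / (c - z) for the point c of the circle; the present form is the sum
    of a geometric series in z / c, and it is 1 when z = 0. *)
Definition cauchy_kernel s z t : R[i] := (1 - z / circle s t)^-1.

Lemma cauchy_kernelE s z t : 0 < s ->
  cauchy_kernel s z t = circle s t / (circle s t - z).
Proof.
move=> s0; have c0 := circle_neq0 t s0.
have [->|zc] := eqVneq z (circle s t).
  by rewrite /cauchy_kernel mulfV// !subrr invr0 mulr0.
rewrite /cauchy_kernel -[1](mulfV c0) -mulrBl invfM invrK mulrC//.
Qed.

Lemma lcont_circle_comp K s a b : 0 <= s -> (forall w, cmod w = s -> ccont K w) ->
  lcont a b (fun t => K (circle s t)).
Proof.
move=> s0 cK; apply: (lcont_comp (@lcont_circle s a b)) => t _.
by apply: cK; rewrite cmod_circle.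
Qed.

Lemma ccont_sub z w : ccont (fun u => u - z) w.
Proof. by apply: ccontD; [exact: ccont_id|exact: ccont_cst]. Qed.

Lemma lcont_cauchy_kernel s z a b : cmod z < s -> lcont a b (cauchy_kernel s z).
Proof.
move=> zs; have s0 : 0 < s := le_lt_trans (cmod_ge0 _) zs.
pose K w := w / (w - z).
have H : lcont a b (fun t => K (circle s t)).
  apply: lcont_circle_comp; first exact: ltW.
  move=> w ws; apply: ccontM; first exact: ccont_id.
  apply: ccontV; last exact: ccont_sub.
  by rewrite subr_eq0; apply/eqP => wz; move: zs; rewrite -wz ws ltxx.
move=> t tab e /(H _ tab) [d d0 {}H]; exists d => // u /H.
by rewrite !cauchy_kernelE.
Qed.

Lemma lint_uniform_limit (F : R -> R[i]) (v : R[i]) a b : a <= b ->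
  (forall e, 0 < e -> exists2 G : R -> R[i], lcont a b G /\ lint a b G = v &
     lcont a b F /\ forall t, a <= t <= b -> cmod (G t - F t) <= e) ->
  lint a b F = v.
Proof.
move=> ab H; apply/esym/eqP; rewrite -subr_eq0 -cmod_eq0.
apply/negPn/negP => E0.
have {E0} : 0 < cmod (v - lint a b F) by rewrite lt_def E0 cmod_ge0.
set E := cmod _ => E0.
have [|G [cG Gv] [cF GF]] := H (E / (4 * (b - a + 1))).
  by rewrite divr_gt0// mulr_gt0// ltr_wpDl// subr_ge0.
have := cmod_lint ab (lcontB cG cF) GF.
rewrite lintB// Gv -/E; apply/negP; rewrite -ltNge.
have ba : 0 < b - a + 1 by rewrite ltr_wpDl// subr_ge0.
rewrite (_ : 2 * _ = (E / 2) * ((b - a) / (b - a + 1))); last first.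
  by field; rewrite gt_eqF.
apply: (@le_lt_trans _ _ (E / 2 * 1)); last by lra.
rewrite ler_pM2l ?divr_gt0// ler_pdivrMr// mul1r; lra.
Qed.

(** By invariance the radius may be made arbitrarily large, and then the kernel is
    uniformly close to 1. *)
Lemma lint_cauchy_kernel s z : cmod z < s ->
  lint 0 (2 * pi) (cauchy_kernel s z) = (2 * pi)%:C%C.
Proof.
move=> zs; have s0 : 0 < s := le_lt_trans (cmod_ge0 _) zs.
have inv r : s <= r -> lint 0 (2 * pi) (cauchy_kernel s z) =
    lint 0 (2 * pi) (cauchy_kernel r z).
  move=> sr; have r0 := lt_le_trans s0 sr.
  pose K w := (w - z)^-1.
  have KE r' : 0 < r' -> lint 0 (2 * pi) (cauchy_kernel r' z) =
      lint 0 (2 * pi) (fun t => K (circle r' t) * circle r' t).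
    by move=> r'0; apply: eq_lint => t _; rewrite cauchy_kernelE// mulrC.
  rewrite !KE//.
  have dK w : s <= cmod w <= r -> cdiff K w.
    move=> /andP[sw _]; apply: cdiffV.
      by rewrite subr_eq0; apply/eqP => wz; move: zs; rewrite -wz ltNge sw.
    by apply: cdiffD; [exact: cdiff_id|exact: cdiff_cst].
  apply: (@circle_invariance K 0) => // w /dK //; exact: cdiff_cont.
suff : lint 0 (2 * pi) (fun=> 1) = lint 0 (2 * pi) (cauchy_kernel s z).
  by rewrite lint_cst ?pi2_ge0// mul1r subr0 => <-.
apply: lint_uniform_limit; first exact: pi2_ge0.
move=> e e0; pose r := s + cmod z + cmod z / e.
have z0 := cmod_ge0 z.
have ze0 : 0 <= cmod z / e by rewrite divr_ge0// ltW.
have sr : s <= r by rewrite /r -addrA lerDl addr_ge0.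
have r0 : 0 < r := lt_le_trans s0 sr.
exists (cauchy_kernel r z).
  split; last by rewrite -inv.
  by apply: lcont_cauchy_kernel; exact: lt_le_trans zs sr.
split; first exact: lcont_cst.
move=> t _; rewrite cauchy_kernelE//.
have rz : s + cmod z / e <= cmod (circle r t - z).
  apply: le_trans (cmodB_le _ _); rewrite cmod_circle ?(ltW r0)// /r; lra.
have rz0 : 0 < cmod (circle r t - z).
  by apply: lt_le_trans rz; rewrite ltr_wpDr.
have -> : circle r t / (circle r t - z) - 1 = z / (circle r t - z).
  rewrite -[X in _ - X](@mulfV _ (circle r t - z)) -?cmod_gt0//.
  by rewrite -mulrBl opprB addrC subrK.
rewrite cmodM cmodV ler_pdivrMr// mulrC -ler_pdivrMr//.
by apply: le_trans rz; rewrite lerDr ltW.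
Qed.

(** With q the slope of f at z, which is differentiable except perhaps at z, the
    integral of q c over the circle does not depend on the radius and tends to 0
    with it; it remains to integrate f (z) against the kernel. *)
Lemma cauchy_formula f s z : 0 < s -> s < 1 -> cmod z < s ->
  (forall w, cmod w < 1 -> cdiff f w) ->
  lint 0 (2 * pi) (fun t => f (circle s t) * cauchy_kernel s z t) =
  (2 * pi)%:C%C * f z.
Proof.
move=> s0 s1 zs df.
have [q cq fE] := df z (lt_trans zs s1).
have dq w : cmod w < 1 -> w != z -> cdiff q w.
  move=> w1 wz.
  have wz0 : 0 < cmod (w - z) by rewrite cmod_gt0 subr_eq0.
  apply: (@cdiff_near _ (fun u => (f u - f z) * (u - z)^-1) q w _ wz0).
    move=> u uw; have uz : u - z != 0.
      rewrite subr_eq0; apply/eqP => uz; move: uw.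
      by rewrite uz cmodB ltxx.
    by rewrite fE addrC addKr mulfK.
  apply: cdiffM; first by apply: cdiffD; [exact: df|exact: cdiff_cst].
  apply: cdiffV; first by rewrite subr_eq0.
  by apply: cdiffD; [exact: cdiff_id|exact: cdiff_cst].
have cqq w : cmod w < 1 -> ccont q w.
  by move=> w1; have [->//|wz] := eqVneq w z; exact/cdiff_cont/dq.
have inv r : 0 < r -> r <= s -> lint 0 (2 * pi) (fun t => q (circle r t) * circle r t)
    = lint 0 (2 * pi) (fun t => q (circle s t) * circle s t).
  move=> r0 rs; apply: (@circle_invariance q z) => // w /andP[_ ws].
    by apply: cqq; exact: le_lt_trans s1.
  by apply: dq; exact: le_lt_trans s1.
have lc r : 0 < r -> r <= s -> lcont 0 (2 * pi) (fun t => q (circle r t) * circle r t).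
  move=> r0 rs; apply: lcontM; last exact: lcont_circle.
  apply: lcont_circle_comp; first exact: ltW.
  by move=> w wr; apply: cqq; rewrite wr (le_lt_trans rs).
have q0 : lint 0 (2 * pi) (fun t => q (circle s t) * circle s t) = 0.
  apply/esym; rewrite -[LHS](mul0r ((2 * pi - 0)%:C%C)) -(lint_cst _ pi2_ge0).
  apply: lint_uniform_limit; first exact: pi2_ge0.
  move=> e e0; have c01 : cmod (0 : R[i]) < 1 by rewrite cmod0.
  have [d d0 {}Hd] := cqq 0 c01 _ ltr01.
  pose Q := cmod (q 0) + 1.
  have Q0 : 0 < Q by rewrite ltr_wpDl// cmod_ge0.
  pose r := Num.min s (Num.min (d / 2) (e / Q)).
  have r0 : 0 < r by rewrite !lt_min s0 !divr_gt0.
  have rs : r <= s by rewrite ge_min lexx.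
  have rd : r < d.
    apply: (@le_lt_trans _ _ (d / 2)); last by lra.
    by rewrite !ge_min lexx orbT.
  have rQ : r * Q <= e by rewrite -ler_pdivlMr// !ge_min lexx !orbT.
  exists (fun t => q (circle r t) * circle r t).
    by split; [exact: lc|exact: inv].
  split; first exact: lcont_cst.
  move=> t _; rewrite subr0 cmodM cmod_circle ?(ltW r0)// mulrC.
  apply: le_trans rQ; rewrite ler_pM2l//.
  have := Hd (circle r t); rewrite subr0 cmod_circle ?(ltW r0)// => /(_ rd) h.
  by have := cmodB_le (q (circle r t)) (q 0); rewrite /Q; lra.
have cz t : circle s t - z != 0.
  rewrite subr_eq0; apply/eqP => E; move: zs; rewrite -E cmod_circle ?ltW//.
  by rewrite ltxx.
have cf : lcont 0 (2 * pi) (fun t => f (circle s t)).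
  apply: lcont_circle_comp; first exact: ltW.
  by move=> w ws; apply/cdiff_cont/df; rewrite ws.
rewrite (@eq_lint _ _ _ _ (fun t => q (circle s t) * circle s t +
    f z * cauchy_kernel s z t)); last first.
  move=> t _; rewrite cauchy_kernelE// {1}fE mulrDl addrC; congr (_ + _).
  by rewrite -mulrA [(_ - _) * _]mulrC divfK.
rewrite lintD; last 2 first.
- exact: lc.
- apply: lcontM; first exact: lcont_cst.
  exact: lcont_cauchy_kernel.
rewrite q0 add0r lintZ; last exact: lcont_cauchy_kernel.
by rewrite lint_cauchy_kernel// mulrC.
Qed.

End circles.

(** * Cauchy estimates and Taylor polynomials *)

Section analytic_consequences.
Context {R : realType}.
Implicit Types (f : R[i] -> R[i]) (z w h : R[i]) (s t rho : R).

Lemma lcont_bounded (F : R -> R[i]) a b : a <= b -> lcont a b F ->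
  exists2 M : R, 0 <= M & forall t, a <= t <= b -> cmod (F t) <= M.
Proof.
move=> ab cF.
have cc : {within `[a, b], continuous (fun t => cmod (F t))}.
  apply: continuous_in_subspaceT => t /set_mem /=; rewrite in_itv /= => tab.
  apply/cvgrPdist_lt => e e0; have [d d0 Fd] := cF _ tab _ e0.
  exists d => //= u; rewrite /= distrC => ut.
  apply: le_lt_trans (Fd _ ut); rewrite ler_norml.
  have := cmodB_le (F u) (F t); have := cmodB_le (F t) (F u).
  by rewrite (cmodB (F t)); lra.
have [c cab cM] := EVT_max ab cc.
exists (cmod (F c)); first exact: cmod_ge0.
by move=> t tab; apply: cM; rewrite in_itv.
Qed.

Lemma cmod_cauchy_kernel s z t : cmod z < s ->
  cmod (cauchy_kernel s z t) <= s / (s - cmod z).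
Proof.
move=> zs; have s0 : 0 < s := le_lt_trans (cmod_ge0 _) zs.
have sz : 0 < s - cmod z by rewrite subr_gt0.
rewrite cauchy_kernelE// cmodM cmodV cmod_circle ?(ltW s0)// ler_pM2l//.
have : s - cmod z <= cmod (circle s t - z).
  by apply: le_trans (cmodB_le _ _); rewrite cmod_circle ?(ltW s0).
by move=> h; rewrite lef_pV2 ?posrE//; exact: lt_le_trans h.
Qed.

Lemma two_pi_neq0 : (2 * pi)%:C%C != 0 :> R[i].
Proof. by rewrite -cmod_gt0 cmodC normr_gt0 mulf_neq0// gt_eqF// pi_gt0. Qed.

Lemma circle_integral_bound (v : R[i]) (F : R -> R[i]) (M : R) :
  lcont 0 (2 * pi) F -> (forall t, 0 <= t <= 2 * pi -> cmod (F t) <= M) ->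
  (2 * pi)%:C%C * v = lint 0 (2 * pi) F -> cmod v <= 2 * M.
Proof.
move=> cF FM E; have := cmod_lint pi2_ge0 cF FM; rewrite -E cmodM cmodC.
have p0 : 0 < 2 * pi :> R by rewrite mulr_gt0// pi_gt0.
by rewrite ger0_norm ?(ltW p0)// subr0 (mulrC (2 * pi)) mulrA ler_pM2r.
Qed.

Section taylor_polynomials.
Context (f : R[i] -> R[i]).
Context (df : forall w, cmod w < 1 -> cdiff f w).

Lemma lcont_f_circle s a b : 0 <= s -> s < 1 -> lcont a b (fun t => f (circle s t)).
Proof.
move=> s0 s1; apply: lcont_circle_comp => // w ws.
by apply/cdiff_cont/df; rewrite ws.
Qed.

Lemma cauchy_sup_bound s z (B : R) : 0 < s -> s < 1 -> cmod z < s ->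
  (forall w, cmod w = s -> cmod (f w) <= B) ->
  cmod (f z) <= 2 * (B * (s / (s - cmod z))).
Proof.
move=> s0 s1 zs fB.
apply: (@circle_integral_bound (f z)
  (fun t => f (circle s t) * cauchy_kernel s z t)) => //.
- apply: lcontM; last exact: lcont_cauchy_kernel.
  by apply: lcont_f_circle => //; exact: ltW.
- move=> t _; rewrite cmodM ler_pM ?cmod_ge0//.
    by apply: fB; rewrite cmod_circle ?ltW.
  exact: cmod_cauchy_kernel.
- by rewrite cauchy_formula.
Qed.

Lemma circle_bound s : 0 <= s -> s < 1 ->
  exists2 B : R, 0 <= B & forall t, 0 <= t <= 2 * pi -> cmod (f (circle s t)) <= B.
Proof.
move=> s0 s1; apply: lcont_bounded; first exact: pi2_ge0.
exact: lcont_f_circle.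
Qed.

Lemma geometric_sum (F : fieldType) (x : F) n : 1 - x != 0 ->
  (1 - x)^-1 = \sum_(k < n) x ^+ k + x ^+ n * (1 - x)^-1.
Proof.
move=> x1; apply: (mulIf x1); rewrite mulrDl mulfVK// mulVf//.
have := subrX1 x n; rewrite -opprB -[x - 1]opprB mulNr => /oppr_inj.
by rewrite mulrC => <-; rewrite subrK.
Qed.

(** Truncate the geometric series of the kernel in the Cauchy formula. *)
Lemma taylor_bound s z n (B : R) : 0 < s -> s < 1 -> cmod z < s ->
  (forall t, 0 <= t <= 2 * pi -> cmod (f (circle s t)) <= B) ->
  cmod (f z - \sum_(k < n) (((2 * pi)%:C%C)^-1 *
    lint 0 (2 * pi) (fun t => f (circle s t) * (circle s t)^-1 ^+ k)) * z ^+ k) <=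
  2 * (B * (s / (s - cmod z))) * (cmod z / s) ^+ n.
Proof.
move=> s0 s1 zs fB.
have cf : lcont 0 (2 * pi) (fun t => f (circle s t)).
  by apply: lcont_f_circle => //; exact: ltW.
have cP : lcont 0 (2 * pi) (cauchy_kernel s z) by exact: lcont_cauchy_kernel.
have cc0 t := circle_neq0 t s0.
have cX k : lcont 0 (2 * pi) (fun t => (circle s t)^-1 ^+ k).
  apply: (@lcont_circle_comp _ (fun w => w^-1 ^+ k)); first exact: ltW.
  move=> w ws; have w0 : w != 0 by rewrite -cmod_gt0 ws.
  elim: k => [|k IH].
    by rewrite (_ : (fun _ => _) = (fun=> 1))//; exact: ccont_cst.
  rewrite (_ : (fun _ => _) = (fun w => w^-1 * w^-1 ^+ k)); last first.
    by apply/funext => u; rewrite exprS.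
  by apply: ccontM => //; apply: ccontV => //; exact: ccont_id.
pose G k t := f (circle s t) * (circle s t)^-1 ^+ k.
have cG k : lcont 0 (2 * pi) (G k) by apply: lcontM.
pose rem t := f (circle s t) * ((z / circle s t) ^+ n * cauchy_kernel s z t).
have crem : lcont 0 (2 * pi) rem.
  rewrite (_ : rem = (fun t => z ^+ n * (G n t * cauchy_kernel s z t))).
    by apply: lcontM; [exact: lcont_cst|exact: lcontM].
  by apply/funext => t; rewrite /rem /G exprMn; ring.
have iG k : cintegrable lebesgue_measure `[0, 2 * pi]%classic (fun t => z ^+ k * G k t).
  by apply: cintegrableZ => //; exact: lcont_integrable.
have mI : measurable (`[0, 2 * pi]%classic : set (measurableTypeR R)).
  exact: measurable_itv.
have [iS ES] := cintegral_sum (index_enum 'I_n) mI (fun k : 'I_n => iG k).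
have E : lint 0 (2 * pi) (fun t => f (circle s t) * cauchy_kernel s z t) =
   \sum_(k < n) z ^+ k * lint 0 (2 * pi) (G k) + lint 0 (2 * pi) rem.
  rewrite (@eq_lint _ _ _ _ (fun t => \sum_(k < n) z ^+ k * G k t + rem t)); last first.
    move=> t _; rewrite /cauchy_kernel (@geometric_sum _ _ n).
      rewrite mulrDr mulr_sumr; congr (_ + _); apply: eq_bigr => k _.
      by rewrite /G exprMn; ring.
    rewrite -cmod_gt0.
    have := cmodB_le 1 (z / circle s t); apply: lt_le_trans.
    rewrite cmod1 cmodM cmodV cmod_circle ?(ltW s0)// subr_gt0.
    by rewrite ltr_pdivrMr// mul1r.
  rewrite /lint cintegralD//; last exact: lcont_integrable.
  rewrite ES; congr (_ + _); apply: eq_bigr => k _.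
  by rewrite cintegralZ//; exact: lcont_integrable.
set S := \sum_(k < n) _.
rewrite (_ : 2 * (B * _) * _ = 2 * (B * ((cmod z / s) ^+ n * (s / (s - cmod z))))); last by ring.
apply: (@circle_integral_bound (f z - S) rem) => //.
  move=> t tab; rewrite cmodM ler_pM ?cmod_ge0// ?fB//.
  rewrite cmodM cmodX cmodM cmodV cmod_circle ?(ltW s0)//.
  by rewrite ler_wpM2l ?exprn_ge0 ?divr_ge0 ?cmod_ge0 ?(ltW s0)// cmod_cauchy_kernel.
rewrite mulrBr -(cauchy_formula s0 s1 zs df) E -[RHS](addKr (\sum_(k < n) z ^+ k * lint 0 (2 * pi) (G k))).
rewrite addrC; congr (- _ + _).
rewrite mulr_sumr; apply: eq_bigr => k _.
by rewrite mulrC -mulrA [_ * (2 * pi)%:C%C]mulrC !mulrA mulfV ?two_pi_neq0// mul1r mulrC.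
Qed.

End taylor_polynomials.
End analytic_consequences.

(** The second order remainder of z |-> c / (c - z), which is the Cauchy kernel as
    a function of z; its first derivative is the square of the kernel over c. *)
Lemma slope_identity (F : fieldType) (c z h : F) : c != 0 ->
  c - (z + h) != 0 -> c - z != 0 ->
  c / (c - (z + h)) - c / (c - z) - h * (c / (c - z) * (c / (c - z)) * c^-1) =
  c / (c - z) * (c / (c - z)) * (c / (c - (z + h))) * (c^-1 * c^-1) * (h * h).
Proof. by move=> c0 ch cz; field; rewrite cz c0 ch. Qed.

(** * Measurability and second order expansions of analytic functions *)

Section approximation.
Context {R : realType}.
Implicit Types (z w h : R[i]) (s t rho : R).
Context (f : R[i] -> R[i]).
Context (df : forall w, cmod w < 1 -> cdiff f w).

Lemma polynomial_approx rho (e : R) : 0 <= rho -> rho < 1 -> 0 < e ->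
  exists N (a : nat -> R[i]), forall z, cmod z <= rho ->
    cmod (f z - \sum_(k < N) a k * z ^+ k) <= e.
Proof.
move=> rho0 rho1 e0; pose s := (1 + rho) / 2.
have s0 : 0 < s by rewrite /s; lra.
have s1 : s < 1 by rewrite /s; lra.
have rs : rho < s by rewrite /s; lra.
have sr : 0 < s - rho by rewrite subr_gt0.
have [B B0 fB] := circle_bound df (ltW s0) s1.
have q0 : 0 <= rho / s by rewrite divr_ge0// ltW.
have q1 : rho / s < 1 by rewrite ltr_pdivrMr// mul1r.
have [N NP] := @geom_small R (rho / s) (2 * (B * (s / (s - rho)))) e q0 q1 e0.
exists N, (fun k => ((2 * pi)%:C%C)^-1 *
  lint 0 (2 * pi) (fun t => f (circle s t) * (circle s t)^-1 ^+ k)) => z zr; have zs := le_lt_trans zr rs.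
apply: le_trans (taylor_bound df N s0 s1 zs fB) _.
apply: le_trans (ltW (NP N (leqnn _))).
have z0 := cmod_ge0 z.
have sz : 0 < s - cmod z by rewrite subr_gt0.
apply: ler_pM.
- by rewrite mulr_ge0// mulr_ge0// divr_ge0// ltW.
- by rewrite exprn_ge0// divr_ge0// ltW.
- rewrite ler_pM2l// ler_wpM2l// ler_pM2l// lef_pV2 ?posrE//.
  by rewrite lerB.
- have q2 : 0 <= cmod z / s by apply: divr_ge0 => //; exact: ltW.
  by apply: lerXn2r; rewrite ?nnegrE// ler_pM2r ?invr_gt0.
Qed.

(** A function analytic on the disk is the pointwise limit of polynomials: the
    n-th one approximates it within 1 / (n + 1) on the disk of radius
    1 - 1 / (n + 1). *)
Lemma cmeasurable_analytic d (T : measurableType d) (D : set T) (phi : T -> R[i]) :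
  cmeasurable D phi -> (forall x, D x -> cmod (phi x) < 1) ->
  cmeasurable D (fun x => f (phi x)).
Proof.
move=> mphi phi1.
have H (n : nat) : exists Na : nat * (nat -> R[i]), forall z,
    cmod z <= 1 - n.+1%:R^-1 ->
    cmod (f z - \sum_(k < Na.1) Na.2 k * z ^+ k) <= n.+1%:R^-1.
  have [||| N [a Ha]] := @polynomial_approx (1 - n.+1%:R^-1) n.+1%:R^-1.
  - by rewrite subr_ge0 invf_le1// ler1n.
  - by rewrite ltrBlDr ltrDl invr_gt0.
  - by rewrite invr_gt0.
  by exists (N, a).
have [Na NaP] := choice H.
apply: (@cmeasurable_lim _ _ _ D (fun n x => \sum_(k < (Na n).1) (Na n).2 k * phi x ^+ k)).
  move=> n; apply: cmeasurable_sum => k; apply: cmeasurableM.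
    exact: cmeasurable_cst.
  exact: cmeasurableX.
move=> x Dx e e0; have px := phi1 _ Dx.
pose m := Num.min e (1 - cmod (phi x)).
have m0 : 0 < m by rewrite lt_min e0 subr_gt0.
exists (Num.truncn m^-1) => n Nn.
have nm : n.+1%:R^-1 < m.
  rewrite invf_plt ?posrE//; apply: lt_le_trans (truncnS_gt _) _.
  by rewrite ler_nat ltnS.
rewrite cmodB; apply: (@le_lt_trans _ _ n.+1%:R^-1).
  apply: NaP; rewrite lerBrDr -lerBrDl ltW// (lt_le_trans nm)//.
  by rewrite /m ge_min lexx orbT.
by apply: lt_le_trans nm _; rewrite /m ge_min lexx.
Qed.

(** The derivative D is given by differentiating the kernel in the Cauchy formula
    on a circle of radius s > rho, and the remainder by integrating the remainder
    of the kernel. Uniformity of L over the whole disk of radius rho is what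
    differentiation under the integral requires. *)
Lemma second_order rho : 0 <= rho -> rho < 1 ->
  exists (L : R) (D : R[i] -> R[i]), 0 <= L /\
    (forall z, cmod z <= rho -> cmod (D z) <= L) /\
    (forall z h, cmod z <= rho -> cmod (z + h) <= rho ->
      cmod (f (z + h) - f z - D z * h) <= L * cmod h ^+ 2).
Proof.
move=> rho0 rho1; pose s := (1 + rho) / 2.
have s0 : 0 < s by rewrite /s; lra.
have s1 : s < 1 by rewrite /s; lra.
have rs : rho < s by rewrite /s; lra.
have sr : 0 < s - rho by rewrite subr_gt0.
have [B B0 fB] := circle_bound df (ltW s0) s1.
have cf : lcont 0 (2 * pi) (fun t => f (circle s t)).
  by apply: lcont_f_circle => //; exact: ltW.
have cP z : cmod z <= rho -> lcont 0 (2 * pi) (cauchy_kernel s z).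
  by move=> zr; apply: lcont_cauchy_kernel; exact: le_lt_trans rs.
have cI : lcont 0 (2 * pi) (fun t => (circle s t)^-1).
  apply: (@lcont_circle_comp _ (fun w => w^-1)); first exact: ltW.
  by move=> w ws; apply: ccontV; [rewrite -cmod_gt0 ws|exact: ccont_id].
pose K := s / (s - rho); have K0 : 0 <= K by rewrite divr_ge0 ?ltW.
have PK z t : cmod z <= rho -> cmod (cauchy_kernel s z t) <= K.
  move=> zr; apply: le_trans (cmod_cauchy_kernel _ (le_lt_trans zr rs)) _.
  rewrite ler_pM2l// lef_pV2 ?posrE// ?lerB// subr_gt0.
  exact: le_lt_trans rs.
pose Dk z t := f (circle s t) * (cauchy_kernel s z t * cauchy_kernel s z t *
   (circle s t)^-1).
pose D z := ((2 * pi)%:C%C)^-1 * lint 0 (2 * pi) (Dk z).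
have DE z : (2 * pi)%:C%C * D z = lint 0 (2 * pi) (Dk z).
  by rewrite /D mulrA mulfV ?mul1r// two_pi_neq0.
have cD z : cmod z <= rho -> lcont 0 (2 * pi) (Dk z).
  by move=> zr; apply: lcontM => //; apply: lcontM => //; apply: lcontM; exact: cP.
pose L := Num.max (2 * (B * (K * K / s))) (2 * (B * (K * K * K / s ^+ 2))).
have L0 : 0 <= 2 * (B * (K * K / s)).
  apply: mulr_ge0 => //; apply: mulr_ge0 => //.
  by apply: divr_ge0; [exact: mulr_ge0|exact: ltW].
exists L, D; split; first by rewrite le_max L0.
split=> [z zr|z h zr zhr].
  rewrite le_max; apply/orP; left.
  apply: (circle_integral_bound (cD z zr)) => [t tab|]; last exact: DE.
  rewrite cmodM ler_pM ?cmod_ge0// ?fB// cmodM cmodM cmodV cmod_circle ?(ltW s0)//.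
  by rewrite ler_pM2r ?invr_gt0// ler_pM ?cmod_ge0// PK.
apply: (@le_trans _ _ (2 * (B * (K * K * K / s ^+ 2 * cmod h ^+ 2)))); last first.
  rewrite (_ : 2 * _ = 2 * (B * (K * K * K / s ^+ 2)) * cmod h ^+ 2); last by ring.
  by rewrite ler_wpM2r ?sqr_ge0// le_max lexx orbT.
have cP2 := cP _ zhr; have cP1 := cP _ zr.
pose rem t := f (circle s t) * (cauchy_kernel s z t * cauchy_kernel s z t *
   cauchy_kernel s (z + h) t * ((circle s t)^-1 * (circle s t)^-1) * (h * h)).
have crem : lcont 0 (2 * pi) rem.
  apply: lcontM => //; apply: lcontM; last exact: lcont_cst.
  by apply: lcontM; [apply: lcontM => //; exact: lcontM|exact: lcontM].
apply: (@circle_integral_bound R (f (z + h) - f z - D z * h) rem) => //.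
  move=> t tab; rewrite cmodM ler_pM ?cmod_ge0// ?fB//.
  rewrite !cmodM !(cmodV (circle s t)) cmod_circle ?(ltW s0)//.
  rewrite [leRHS](_ : _ = K * K * K * (s^-1 * s^-1) * (cmod h * cmod h)); last first.
    by rewrite !expr2 invfM.
  rewrite ler_wpM2r ?mulr_ge0 ?cmod_ge0//.
  rewrite ler_pM2r ?mulr_gt0 ?invr_gt0//.
  apply: ler_pM; [by apply: mulr_ge0; exact: cmod_ge0|exact: cmod_ge0| |exact: PK].
  by apply: ler_pM; [exact: cmod_ge0|exact: cmod_ge0|exact: PK|exact: PK].
rewrite !mulrBr mulrA DE -!(cauchy_formula s0 s1 _ df) ?(le_lt_trans zr)// ?(le_lt_trans zhr)//.
rewrite [_ * h]mulrC -lintZ; last exact: cD.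
rewrite -lintB; [|exact: lcontM..].
rewrite -lintB; [|by apply: lcontB; exact: lcontM|by apply: lcontM; [exact: lcont_cst|exact: cD]].
apply: eq_lint => t _; rewrite /Dk /rem.
rewrite mulrCA -!mulrBr; congr (_ * _).
have cz v : cmod v <= rho -> circle s t - v != 0.
  move=> vr; rewrite -cmod_gt0; have := cmodB_le (circle s t) v.
  by rewrite cmod_circle ?(ltW s0)//; lra.
have := cz _ zr; have := cz _ zhr; rewrite !cauchy_kernelE//.
have := circle_neq0 t s0; move: (circle s t) => c.
exact: slope_identity.
Qed.

End approximation.

(** * Affine changes of variables in the plane *)

Section affine_substitution.
Context {R : realType}.
Local Open Scope ereal_scope.
Notation lam := (@lebesgue_measure R).
Notation mR := (measurableTypeR R).

Lemma measurable_affine (a b : R) : measurable_fun setT ((fun x => a * x + b)%R : mR -> mR).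
Proof. by apply: measurable_funD => //; apply: measurable_funM. Qed.

(** The right-hand side is a measure in A that gives intervals their length. *)
Lemma lebesgue_affine (a b : R) (A : set mR) : a != 0%R -> measurable A ->
  lam A = `|a|%:E * lam ((fun x => a * x + b)%R @^-1` A).
Proof.
move=> a0 mA.
have mf := measurable_affine a b.
pose mu :=
  (mscale (NngNum (normr_ge0 a)) (pushforward lam ((fun x => a * x + b)%R : mR -> mR)) : {measure set mR -> \bar R}).
rewrite (@lebesgue_measure_unique R (mu mf))// => _ [[u v]] _ <-.
rewrite /mu /= /mscale /= /pushforward.
have [uv|vu] := leP v u.
  rewrite set_itv_ge ?bnd_simp -?leNgt//.
  by rewrite preimage_set0 !measure0 mule0.
rewrite lebesgue_measure_itv /= lte_fin vu.
move: a0; rewrite neq_lt => /orP[a0|a0].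
  rewrite (_ : _ @^-1` _ = `[((v - b) / a)%R, ((u - b) / a)%R[%classic); last first.
    apply/seteqP; split => x /=; rewrite !in_itv /= => /andP[h1 h2]; apply/andP; split.
    - by rewrite ler_ndivrMr// lerBrDr mulrC.
    - by rewrite ltr_ndivlMr// ltrBlDr mulrC.
    - by move: h2; rewrite ltr_ndivlMr// ltrBlDr mulrC.
    - by move: h1; rewrite ler_ndivrMr// lerBrDr mulrC.
  rewrite lebesgue_measure_itv /= lte_fin ltr_nM2r ?invr_lt0//.
  rewrite ltrD2r vu -EFinD -EFinM ltr0_norm//; congr EFin.
  by field; rewrite lt_eqF.
rewrite (_ : _ @^-1` _ = `]((u - b) / a)%R, ((v - b) / a)%R]%classic); last first.
  apply/seteqP; split => x /=; rewrite !in_itv /= => /andP[h1 h2]; apply/andP; split.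
  - by rewrite ltr_pdivrMr// ltrBlDr mulrC.
  - by rewrite ler_pdivlMr// lerBrDr mulrC.
  - by move: h1; rewrite ltr_pdivrMr// ltrBlDr mulrC.
  - by move: h2; rewrite ler_pdivlMr// lerBrDr mulrC.
rewrite lebesgue_measure_itv /= lte_fin ltr_pM2r ?invr_gt0//.
rewrite ltrD2r vu -EFinD -EFinM gtr0_norm//; congr EFin.
by field; rewrite gt_eqF.
Qed.

Lemma ge0_integral_affine (a b : R) (F : mR -> \bar R) : a != 0%R ->
  measurable_fun setT F -> (forall x, 0 <= F x) ->
  \int[lam]_x F (a * x + b)%R = (`|a|^-1)%:E * \int[lam]_x F x.
Proof.
move=> a0 mF F0; have mf := measurable_affine a b.
pose mu :=
  (mscale (NngNum (normr_ge0 a)) (pushforward lam ((fun x => a * x + b)%R : mR -> mR)) : {measure set mR -> \bar R}).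
have -> : \int[lam]_x F x = \int[mu mf]_x F x.
  apply: eq_measure_integral => A mA _.
  exact: lebesgue_affine.
rewrite ge0_integral_mscale//= ge0_integral_pushforward//= muleA -EFinM.
by rewrite mulVf ?mul1e// normr_eq0.
Qed.

End affine_substitution.

Section plane_substitution.
Context {R : realType}.
Local Open Scope ereal_scope.
Notation lam := (@lebesgue_measure R).
Notation mR := (measurableTypeR R).
Notation lam2 := (lam \x lam).

Definition unplane (z : R[i]) : mR * mR := (complex.Re z, complex.Im z).

Lemma unplaneK (z : R[i]) : plane (unplane z) = z.
Proof. by case: z. Qed.

Lemma cmeasurable_plane (D : set (mR * mR)) : cmeasurable D (@plane R).
Proof.
split; first by apply: measurable_funTS; exact: measurable_fst.
by apply: measurable_funTS; exact: measurable_snd.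
Qed.

Lemma cmeasurable_unplane d (T : measurableType d) (phi : T -> R[i]) :
  cmeasurable setT phi -> measurable_fun setT (fun x => unplane (phi x)).
Proof. by move=> [h1 h2]; apply/measurable_fun_pairP. Qed.

(** When Re c is not 0, the map z |-> c z + e is a product of two shears with
    scaling, one in x with factor a = Re c and one in y with factor
    |c| ^ 2 / a; each is a change of variable on the line inside an iterated
    integral. *)
Lemma plane_substitution_re (F : mR * mR -> \bar R) (c e : R[i]) :
  measurable_fun setT F -> (forall q, 0 <= F q) -> complex.Re c != 0%R ->
  \int[lam2]_q F (unplane (c * plane q + e)%R) =
  ((cmod c ^+ 2)^-1)%:E * \int[lam2]_q F q.
Proof.
move=> mF F0 a0.
have mG : measurable_fun setT (fun q : mR * mR => F (unplane (c * plane q + e)%R)).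
  apply: (measurableT_comp mF); apply: cmeasurable_unplane.
  apply: cmeasurableD; last exact: cmeasurable_cst.
  by apply: cmeasurableM; [exact: cmeasurable_cst|exact: cmeasurable_plane].
rewrite cmod_sqr; case: c e a0 mG => a b [e1 e2] /= a0 mG.
rewrite [LHS]fubini_tonelli2//=.
(* F in the coordinates (new x, old y). *)
pose Phi (q : mR * mR) := F (q.1, b / a * (q.1 + b * q.2 - e1) + a * q.2 + e2)%R.
have mPhi : measurable_fun setT Phi.
  apply: (measurableT_comp mF); apply: measurable_fun_pair => //=.
  apply: measurable_funD => //; apply: measurable_funD; last by apply: measurable_funM.
  by apply: measurable_funM => //; apply: measurable_funB => //;
    apply: measurable_funD => //; apply: measurable_funM.
have Phi0 q : 0 <= Phi q by exact: F0.
transitivity (\int[lam]_y ((`|a|^-1)%:E * \int[lam]_x Phi (x, y))).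
  apply: eq_integral => y _.
  rewrite -(@ge0_integral_affine R a (- b * y + e1) (fun x => Phi (x, y)))//; last first.
    exact: measurableT_comp.
  apply: eq_integral => x _; rewrite /Phi /unplane /=; congr (F (_, _)).
    by ring.
  by field.
rewrite ge0_integralZl//; last 2 first.
- exact: (measurable_fun_fubini_tonelli_G (m1 := lam) Phi mPhi Phi0).
- by move=> y _; apply: integral_ge0 => x _; exact: Phi0.
rewrite -(fubini_tonelli (m1 := lam) (m2 := lam) Phi)//.
pose k := (b ^+ 2 / a + a)%R.
have kE : (k = (a ^+ 2 + b ^+ 2) / a)%R by rewrite /k; field.
have n0 : (0 < a ^+ 2 + b ^+ 2)%R.
  by rewrite ltr_wpDr ?sqr_ge0// lt_def sqr_ge0 sqrf_eq0 a0.
have k0 : k != 0%R by rewrite kE mulf_neq0 ?invr_eq0// gt_eqF.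
transitivity ((`|a|^-1)%:E * \int[lam]_x ((`|k|^-1)%:E * \int[lam]_y F (x, y))).
  congr (_ * _); apply: eq_integral => x _.
  rewrite -(@ge0_integral_affine R k (b / a * (x - e1) + e2) (fun y => F (x, y)))//; last first.
    exact: measurableT_comp.
  by apply: eq_integral => y _; rewrite /Phi /=; congr (F (_, _)); rewrite /k; field.
rewrite ge0_integralZl//; last 2 first.
- exact: (measurable_fun_fubini_tonelli_F (m2 := lam) F mF F0).
- by move=> y _; apply: integral_ge0 => x _; exact: F0.
rewrite muleA -EFinM fubini_tonelli1//; congr (_%:E * _).
rewrite kE normrM normfV (gtr0_norm n0) invfM invrK mulrCA mulVf ?mulr1//.
by rewrite normr_eq0.
Qed.

(** If Re c = 0 the two coordinates are scaled separately and exchanged. *)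
Lemma ge0_plane_substitution (F : mR * mR -> \bar R) (c e : R[i]) :
  measurable_fun setT F -> (forall q, 0 <= F q) -> c != 0%R ->
  \int[lam2]_q F (unplane (c * plane q + e)%R) =
  ((cmod c ^+ 2)^-1)%:E * \int[lam2]_q F q.
Proof.
move=> mF F0 c0.
have [a0|a0] := eqVneq (complex.Re c) 0%R; last exact: plane_substitution_re.
have mG : measurable_fun setT (fun q : mR * mR => F (unplane (c * plane q + e)%R)).
  apply: (measurableT_comp mF); apply: cmeasurable_unplane.
  apply: cmeasurableD; last exact: cmeasurable_cst.
  by apply: cmeasurableM; [exact: cmeasurable_cst|exact: cmeasurable_plane].
rewrite cmod_sqr a0 expr0n/= add0r.
have b0 : complex.Im c != 0%R.
  by apply: contra c0 => /eqP b0; apply/eqP/complex_ext; rewrite ?a0 ?b0.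
rewrite [LHS]fubini_tonelli1//=.
case: c e a0 b0 mG {c0} => a b [e1 e2] /= a0 b0 mG; rewrite a0 in mG *.
have nb0 : (- b != 0)%R by rewrite oppr_eq0.
transitivity (\int[lam]_x ((`|b|^-1)%:E * \int[lam]_y F (y, (b * x + e2)%R))).
  apply: eq_integral => x _; rewrite -[`|b|%R]normrN.
  rewrite -(@ge0_integral_affine R (- b)%R e1 (fun y => F (y, (b * x + e2)%R)))//; last first.
    exact: measurableT_comp.
  by apply: eq_integral => y _; rewrite /unplane /=; congr (F (_, _)); ring.
pose Psi (q : mR * mR) := F (q.2, (b * q.1 + e2)%R).
have mPsi : measurable_fun setT Psi.
  apply: (measurableT_comp mF); apply: measurable_fun_pair => //=.
  by apply: measurable_funD => //; apply: measurable_funM.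
have Psi0 q : 0 <= Psi q by exact: F0.
rewrite ge0_integralZl//; last 2 first.
- exact: (measurable_fun_fubini_tonelli_F (m2 := lam) Psi mPsi Psi0).
- by move=> y _; apply: integral_ge0 => x _; exact: F0.
rewrite (fubini_tonelli (m1 := lam) (m2 := lam) Psi)//.
transitivity ((`|b|^-1)%:E * \int[lam]_y ((`|b|^-1)%:E * \int[lam]_x F (y, x))).
  congr (_ * _); apply: eq_integral => y _.
  rewrite -(@ge0_integral_affine R b e2 (fun x => F (y, x)))//.
  exact: measurableT_comp.
rewrite ge0_integralZl//; last 2 first.
- exact: (measurable_fun_fubini_tonelli_F (m2 := lam) F mF F0).
- by move=> y _; apply: integral_ge0 => x _; exact: F0.
rewrite muleA -EFinM fubini_tonelli1//; congr (_%:E * _).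
by rewrite -invfM -expr2 real_normK ?num_real.
Qed.

End plane_substitution.

(** * Integration on products and power means *)

Section tonelli_on_sets.
Local Open Scope ereal_scope.
Context d1 d2 (T1 : measurableType d1) (T2 : measurableType d2) (R : realType).
Context (m1 : {sigma_finite_measure set T1 -> \bar R}).
Context (m2 : {sigma_finite_measure set T2 -> \bar R}).

Lemma tonelli_on (D1 : set T1) (D2 : set T2) (F : T1 * T2 -> \bar R) :
  measurable D1 -> measurable D2 -> measurable_fun (D1 `*` D2) F ->
  (forall q, (D1 `*` D2) q -> 0 <= F q) ->
  [/\ measurable_fun D1 (fun x => \int[m2]_(y in D2) F (x, y)),
      measurable_fun D2 (fun y => \int[m1]_(x in D1) F (x, y)) &
  \int[m1]_(x in D1) \int[m2]_(y in D2) F (x, y) =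
  \int[m2]_(y in D2) \int[m1]_(x in D1) F (x, y)].
Proof.
move=> mD1 mD2 mF F0.
have mD : measurable (D1 `*` D2) by exact: measurableX.
pose G := F \_ (D1 `*` D2).
have mG : measurable_fun setT G := (measurable_restrictT F mD).1 mF.
have G0 q : 0 <= G q by apply: erestrict_ge0.
have GE1 x : x \in D1 -> \int[m2]_y G (x, y) = \int[m2]_(y in D2) F (x, y).
  move=> xD; rewrite [RHS]integral_mkcond; apply: eq_integral => y _.
  by rewrite /G !patchE in_setX xD /=.
have GE2 y : y \in D2 -> \int[m1]_x G (x, y) = \int[m1]_(x in D1) F (x, y).
  move=> yD; rewrite [RHS]integral_mkcond; apply: eq_integral => x _.
  by rewrite /G !patchE in_setX yD andbT.
have mG1 := measurable_fun_fubini_tonelli_F (m2 := m2) G mG G0.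
have mG2 := measurable_fun_fubini_tonelli_G (m1 := m1) G mG G0.
split.
- apply: (eq_measurable_fun (fubini_F m2 G)); last exact: measurable_funTS.
  by move=> x xD; rewrite -GE1.
- apply: (eq_measurable_fun (fubini_G m1 G)); last exact: measurable_funTS.
  by move=> x xD; rewrite -GE2.
transitivity (\int[m1]_x \int[m2]_y G (x, y)).
  rewrite [LHS]integral_mkcond; apply: eq_integral => x _; rewrite patchE.
  case: ifPn => xD; first by rewrite GE1.
  apply/esym; apply: integral0_eq => y _.
  by rewrite /G patchE in_setX (negbTE xD).
rewrite (fubini_tonelli (m1 := m1) (m2 := m2) G)//.
rewrite [RHS]integral_mkcond; apply: eq_integral => y _; rewrite patchE.
case: ifPn => yD; first by rewrite GE2.
apply: integral0_eq => x _.
by rewrite /G patchE in_setX (negbTE yD) andbF.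
Qed.

End tonelli_on_sets.

Section weighted_power_mean.
Local Open Scope ereal_scope.
Context d (T : measurableType d) (R : realType) (mu : {measure set T -> \bar R}).

(** Either x <= t, or (x / t) ^ (p - 1) >= 1. *)
Lemma le_add_powR (x t p : R) : (0 <= x -> 0 < t -> 1 <= p ->
  x <= t + (t `^ (p - 1))^-1 * x `^ p)%R.
Proof.
move=> x0 t0 p1; have tp : (0 < t `^ (p - 1))%R by exact: powR_gt0.
have [xt|tx] := leP x t.
  apply: (le_trans xt); rewrite lerDl; apply: mulr_ge0; rewrite ?invr_ge0; exact: powR_ge0.
have x00 : (0 < x)%R by exact: lt_trans tx.
apply: (@le_trans _ _ ((t `^ (p - 1))^-1 * x `^ p)%R); last by rewrite lerDr ltW.
have p0 : (0 < p)%R := lt_le_trans ltr01 p1.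
rewrite mulrC ler_pdivlMr// -(@mulr_powRB1 _ x p)//.
rewrite ler_pM2l// ge0_ler_powR// ?subr_ge0// ?nnegrE ?ltW//.
Qed.

(** Integrate phi <= t + phi ^ p / t ^ (p - 1) against g, with t chosen so that the
    first term contributes A / 2 and can be absorbed on the left. This avoids
    conjugate exponents and treats p = 1 in the same way. *)
Lemma weighted_power_mean (D : set T) (g phi : T -> R) (A K G p : R) :
  measurable D -> measurable_fun D g -> measurable_fun D phi ->
  (forall x, D x -> 0 <= g x)%R -> (forall x, D x -> 0 <= phi x)%R ->
  (1 <= p)%R -> (0 <= A)%R -> (0 < K)%R -> (0 < G)%R ->
  \int[mu]_(x in D) (g x)%:E <= G%:E ->
  A%:E <= K%:E * \int[mu]_(x in D) (g x * phi x)%:E ->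
  (A `^ p)%:E <= (2 * K * (2 * K * G) `^ (p - 1))%:E *
    \int[mu]_(x in D) (g x * phi x `^ p)%:E.
Proof.
move=> mD mg mphi g0 phi0 p1 A0 K0 G0 gG AK.
have p0 : (0 < p)%R by exact: lt_le_trans p1.
set B := \int[mu]_(x in D) (g x * phi x `^ p)%:E.
have B0 : 0 <= B.
  by apply: integral_ge0 => x Dx; rewrite lee_fin mulr_ge0 ?powR_ge0// g0.
have KG0 : (0 < 2 * K * G)%R by rewrite !mulr_gt0.
have cst0 : (0 < 2 * K * (2 * K * G) `^ (p - 1))%R.
  by rewrite mulr_gt0 ?powR_gt0// mulr_gt0.
move: A0; rewrite le_eqVlt => /predU1P[<-|A0].
  by rewrite powR0 ?gt_eqF// mule_ge0// lee_fin ltW.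
have [Boo|] := eqVneq B +oo.
  by rewrite Boo gt0_muley ?lte_fin// leey.
move=> Bfin; have {}Bfin : B \is a fin_num by rewrite ge0_fin_numE// ltey.
pose t := (A / (2 * K * G))%R; have t0 : (0 < t)%R by rewrite divr_gt0.
pose s := (t `^ (p - 1))^-1%R.
have s0 : (0 < s)%R by rewrite invr_gt0 powR_gt0.
have mp : measurable_fun D (fun x => phi x `^ p)%R.
  by apply: (measurableT_comp (measurable_powR p)).
have bnd : \int[mu]_(x in D) (g x * phi x)%:E <= t%:E * G%:E + s%:E * B.
  apply: (@le_trans _ _ (\int[mu]_(x in D) (t%:E * (g x)%:E + s%:E * (g x * phi x `^ p)%:E))).
    apply: ge0_le_integral => //.
    - by move=> x Dx; rewrite lee_fin mulr_ge0 ?g0 ?phi0.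
    - by apply/measurable_EFinP; exact: measurable_funM.
    - apply: emeasurable_funD; apply: measurable_funeM; apply/measurable_EFinP => //.
      exact: measurable_funM.
    - move=> x Dx; rewrite -!EFinM -EFinD lee_fin.
      rewrite (_ : t * g x + _ = g x * (t + s * phi x `^ p))%R; last by ring.
      by rewrite ler_wpM2l ?g0// le_add_powR// phi0.
  rewrite ge0_integralD//; last 4 first.
  - by move=> x Dx; rewrite -EFinM lee_fin mulr_ge0 ?g0// ltW.
  - by apply: measurable_funeM; apply/measurable_EFinP.
  - by move=> x Dx; rewrite -EFinM lee_fin mulr_ge0 ?mulr_ge0 ?g0 ?powR_ge0// ltW.
  - by apply: measurable_funeM; apply/measurable_EFinP; exact: measurable_funM.
  rewrite ge0_integralZl//; last 2 first.
  - exact/measurable_EFinP.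
  - by rewrite lee_fin ltW.
  rewrite ge0_integralZl//; last 3 first.
  - by apply/measurable_EFinP; exact: measurable_funM.
  - by move=> x Dx; rewrite lee_fin mulr_ge0 ?g0 ?powR_ge0.
  - by rewrite lee_fin ltW.
  by apply: leeD => //; apply: lee_wpmul2l => //; rewrite lee_fin ltW.
have : A%:E <= K%:E * (t%:E * G%:E + s%:E * B).
  by apply: (le_trans AK); apply: lee_wpmul2l => //; rewrite lee_fin ltW.
rewrite -(fineK Bfin); set b := fine B.
rewrite -!EFinM !lee_fin => Ab.
have KtG : (K * (t * G) = A / 2)%R.
  by rewrite /t; field; rewrite !gt_eqF.
have {}Ab : (A * t `^ (p - 1) <= 2 * K * b)%R.
  have : (A <= 2 * K * (s * b))%R by move: Ab; rewrite mulrDr KtG; lra.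
  rewrite -(ler_pM2r (powR_gt0 (p - 1) t0)) => /le_trans; apply.
  rewrite (_ : 2 * K * (s * b) * _ = 2 * K * b * (s * t `^ (p - 1)))%R; last by ring.
  by rewrite /s mulVf ?mulr1// gt_eqF// powR_gt0.
have AE : (A `^ p = A * t `^ (p - 1) * (2 * K * G) `^ (p - 1))%R.
  rewrite -mulrA -powRM ?ltW// /t divfK ?gt_eqF//.
  by rewrite mulr_powRB1// ltW.
rewrite AE (_ : 2 * K * _ * b = 2 * K * b * (2 * K * G) `^ (p - 1))%R; last by ring.
by rewrite ler_wpM2r ?powR_ge0.
Qed.

End weighted_power_mean.

(* Points are kept in the form plane q, and moduli and conjugates folded, under
   simplification. *)
Local Arguments plane : simpl never.
Local Arguments ComplexField.Normc.normc : simpl never.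

(** * Area means of analytic functions *)

Section area_measure.
Context {R : realType}.
Local Open Scope ereal_scope.
Notation lam := (@lebesgue_measure R).
Notation mR := (measurableTypeR R).
Notation lam2 := (lam \x lam).

Lemma dA_rect (a b c d : R) : (a <= b)%R -> (c <= d)%R ->
  dA R (`[a, b]%classic `*` `[c, d]%classic) = ((b - a) * (d - c) / pi)%:E.
Proof.
move=> ab cd; rewrite /dA /= /mscale /= product_measure1E; last 2 first.
- exact: measurable_itv.
- exact: measurable_itv.
have E x y : (x <= y)%R -> lam `[x, y]%classic = (y - x)%:E.
  rewrite le_eqVlt => /predU1P[->|xy].
    by rewrite lebesgue_measure_itv /= ltxx subrr.
  by rewrite lebesgue_measure_itv /= lte_fin xy.
transitivity ((1 / pi)%:E * (lam `[a, b]%classic * lam `[c, d]%classic)) => //.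
by rewrite !E// -!EFinM; congr EFin; rewrite div1r mulrC.
Qed.

Lemma dA_sigma_finite : sigma_finite setT (dA R : set (mR * mR)%type -> \bar R).
Proof.
exists (fun n : nat => `[(- n%:R)%R, n%:R%R]%classic `*` `[(- n%:R)%R, n%:R%R]%classic).
  apply/seteqP; split => // -[x y] _.
  have [n nP] : exists n : nat, (`|x| + `|y| <= n%:R)%R.
    by exists (Num.truncn (`|x| + `|y|)).+1; rewrite ltW// truncnS_gt.
  exists n => //; split; rewrite /= in_itv /= -ler_norml.
    by apply: le_trans nP; rewrite lerDl.
  by apply: le_trans nP; rewrite lerDr.
move=> n; split; first by apply: measurableX; exact: measurable_itv.
by rewrite dA_rect ?ltry//; rewrite (@le_trans _ _ 0%R)// oppr_le0.
Qed.

(** The area measure with its sigma-finiteness, as the exchange of integrals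
    requires it. *)
Definition dA_sf : {sigma_finite_measure set (mR * mR)%type -> \bar R} :=
  HB.pack_for {sigma_finite_measure set (mR * mR)%type -> \bar R}
   (dA R : set (mR * mR)%type -> \bar R) (Measure.class (dA R))
   (Measure_isSigmaFinite.Build _ _ _ (dA R) dA_sigma_finite).

Lemma ge0_integral_dA (D : set (mR * mR)%type) (F : mR * mR -> \bar R) :
  measurable D -> measurable_fun D F -> (forall q, D q -> 0 <= F q) ->
  \int[dA R]_(q in D) F q = (pi^-1)%:E * \int[lam2]_(q in D) F q.
Proof. by move=> mD mF F0; rewrite ge0_integral_mscale//= div1r. Qed.

Definition affine (c e : R[i]) (q : mR * mR) : mR * mR :=
  unplane (c * plane q + e)%R.
Arguments affine (c e)%_ring_scope q.

Lemma plane_affine (c e : R[i]) q : plane (affine c e q) = (c * plane q + e)%R.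
Proof. exact: unplaneK. Qed.

Lemma measurable_affine_plane (c e : R[i]) : measurable_fun setT (affine c e).
Proof.
apply: cmeasurable_unplane; apply: cmeasurableD; last exact: cmeasurable_cst.
by apply: cmeasurableM; [exact: cmeasurable_cst|exact: cmeasurable_plane].
Qed.

Lemma ge0_area_substitution (E : set (mR * mR)%type) (F : mR * mR -> \bar R)
    (c e : R[i]) : measurable E -> measurable_fun E F ->
  (forall q, E q -> 0 <= F q) -> c != 0%R ->
  \int[dA R]_(q in affine c e @^-1` E) F (affine c e q) =
  ((cmod c ^+ 2)^-1)%:E * \int[dA R]_(q in E) F q.
Proof.
move=> mE mF F0 c0.
have mA := measurable_affine_plane c e.
have mE' : measurable (affine c e @^-1` E).
  by rewrite -[X in measurable X]setTI; exact: mA.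
have mF' : measurable_fun (affine c e @^-1` E) (fun q => F (affine c e q)).
  apply: (measurable_comp mE _ mF); last exact: measurable_funTS.
  by move=> _ [q Eq <-].
rewrite !ge0_integral_dA//; last by move=> q; exact: F0.
rewrite muleCA; congr (_ * _).
rewrite [in LHS]integral_mkcond [in RHS]integral_mkcond.
rewrite -(@ge0_plane_substitution R (F \_ E) c e)//.
- exact: (measurable_restrictT F mE).1.
- by move=> q; exact: erestrict_ge0.
Qed.

Definition disk (z : R[i]) (r : R) : set (mR * mR)%type :=
  [set q | cmod (plane q - z) < r]%R.
Arguments disk (z r)%_ring_scope.
Arguments circle {R} (r t)%_ring_scope.

Lemma measurable_lt_set (f : mR * mR -> R) (r : R) : measurable_fun setT f ->
  measurable [set q | f q < r]%R.
Proof.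
move=> mf; rewrite (_ : [set q | _] = f @^-1` `]-oo, r[%classic); last first.
  by apply/seteqP; split => q /=; rewrite in_itv.
by rewrite -[X in measurable X]setTI; apply: mf => //; exact: measurable_itv.
Qed.

Lemma measurable_ge_set (f : mR * mR -> R) (r : R) : measurable_fun setT f ->
  measurable [set q | r <= f q]%R.
Proof.
move=> mf; rewrite (_ : [set q | _] = f @^-1` `[r, +oo[%classic); last first.
  by apply/seteqP; split => q /=; rewrite in_itv /= andbT.
by rewrite -[X in measurable X]setTI; apply: mf => //; exact: measurable_itv.
Qed.

Lemma measurable_disk z r : measurable (disk z r).
Proof.
apply: measurable_lt_set; apply: cmeasurable_cmod; apply: cmeasurableD.
  exact: cmeasurable_plane.
exact: cmeasurable_cst.
Qed.

Lemma unit_diskE : @plane R @^-1` unit_disk R = disk 0 1.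
Proof. by apply/seteqP; split => q; rewrite /unit_disk /disk /= subr0. Qed.

Lemma cmeasurable_disk (f : R[i] -> R[i]) (E : set (mR * mR)%type) :
  (forall w, cmod w < 1 -> cdiff f w)%R -> E `<=` disk 0 1 ->
  cmeasurable E (fun q => f (plane q)).
Proof.
move=> df E1; apply: (cmeasurable_analytic df); first exact: cmeasurable_plane.
by move=> q /E1; rewrite /disk /= subr0.
Qed.

(** The disk is compared with the square around it. *)
Lemma disk_area_le z r : (0 <= r)%R -> dA R (disk z r) <= (4 * r ^+ 2 / pi)%:E.
Proof.
move=> r0.
have -> : ((4 * r ^+ 2 / pi)%:E = dA R (`[(complex.Re z - r)%R, (complex.Re z + r)%R]%classic `*`
    `[(complex.Im z - r)%R, (complex.Im z + r)%R]%classic)).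
  by rewrite dA_rect; [congr EFin; ring|lra|lra].
apply: le_measure; rewrite ?inE.
- exact: measurable_disk.
- by apply: measurableX; exact: measurable_itv.
- move=> q; rewrite /disk /= => qz; split; rewrite /= in_itv /= -ler_distlC.
    apply: le_trans (ltW qz); apply: le_trans (Re_le_cmod _).
    by rewrite distrC; case: z {qz} => ? ?.
  apply: le_trans (ltW qz); apply: le_trans (Im_le_cmod _).
  by rewrite distrC; case: z {qz} => ? ?.
Qed.

Lemma disk_area_ge : ((4 * pi)^-1)%:E <= dA R (disk 0 1).
Proof.
have -> : (((4 * pi)^-1)%:E = dA R (`[0%R, 2^-1%R]%classic `*` `[0%R, 2^-1%R]%classic)).
  rewrite dA_rect; [congr EFin|lra|lra]; rewrite subr0.
  by rewrite invfM; congr (_ * _)%R; field.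
apply: le_measure; rewrite ?inE.
- by apply: measurableX; exact: measurable_itv.
- exact: measurable_disk.
- move=> -[x y] [/=]; rewrite !in_itv /= => /andP[x0 x1] /andP[y0 y1].
  rewrite /disk /= subr0.
  rewrite -(@ltr_pXn2r _ 2) ?nnegrE ?cmod_ge0// cmod_sqr /= expr1n.
  have : (x ^+ 2 <= 2^-1 ^+ 2)%R by rewrite lerXn2r ?nnegrE.
  have : (y ^+ 2 <= 2^-1 ^+ 2)%R by rewrite lerXn2r ?nnegrE.
  lra.
Qed.

(** The Cauchy formula at 0, with pi in place of 2 pi because of the factor lost
    on the modulus of an integral. *)
Lemma circle_mean_le (f : R[i] -> R[i]) (s : R) : (0 < s)%R -> (s < 1)%R ->
  (forall w, cmod w < 1 -> cdiff f w)%R ->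
  (pi * cmod (f 0))%:E <=
  \int[lam]_(t in `[0%R, (2 * pi)%R]%classic) (cmod (f (circle s t)))%:E.
Proof.
move=> s0 s1 df.
have cf : lcont 0 (2 * pi) (fun t => f (circle s t)).
  by apply: lcont_f_circle => //; exact: ltW.
have iF := lcont_integrable cf.
have mI : measurable (`[0%R, (2 * pi)%R]%classic : set (measurableTypeR R)).
  exact: measurable_itv.
have iN := cintegrable_cmod mI iF.
have := cauchy_formula s0 s1 _ df (z := 0%R); rewrite cmod0 => /(_ s0) E.
have := cmod_cintegral mI iF.
have -> : cintegral lam `[0%R, (2 * pi)%R]%classic (fun t => f (circle s t)) =
    ((2 * pi)%:C%C * f 0)%R.
  rewrite -E; apply: eq_lint => t _.
  by rewrite /cauchy_kernel mul0r subr0 invr1 mulr1.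
rewrite cmodM cmodC ger0_norm ?pi2_ge0// -mulrA ler_pM2l// -lee_fin => /le_trans; apply.
by rewrite /Rintegral fineK//; exact: integrable_fin_num.
Qed.

(** The mean over circles is applied to u |-> f (u q) on the circle of radius 1 / 2
    and averaged over the points q of the disk. After exchanging the integrals,
    the inner one is over a rotated and dilated disk, where the change of
    variable bounds it by 4 times the integral of |f|. In this way no polar
    coordinates are used. *)
Lemma area_mean_le (f : R[i] -> R[i]) :
  (forall w, cmod w < 1 -> cdiff f w)%R ->
  (cmod (f 0))%:E <= (32 * pi)%:E *
    \int[dA R]_(q in disk 0 1) (cmod (f (plane q)))%:E.
Proof.
move=> df; set I := \int[_]_(_ in _) _.
pose TI : set mR := `[0%R, (2 * pi)%R]%classic.
have mTI : measurable TI by exact: measurable_itv.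
have mD := measurable_disk 0%R 1%R.
pose F (q : mR * (mR * mR)) : \bar R := (cmod (f (circle 2^-1 q.1 * plane q.2)))%:E.
have half1 (t : R) (q : mR * mR) : disk 0 1 q -> (cmod (circle 2^-1 t * plane q) < 1)%R.
  rewrite /disk /= subr0 => qD; rewrite cmodM cmod_circle ?invr_ge0//.
  have := cmod_ge0 (plane q); lra.
have mF : measurable_fun (TI `*` disk 0 1) F.
  apply/measurable_EFinP; apply: cmeasurable_cmod; apply: cmeasurable_analytic => //.
    apply: cmeasurableM.
      apply: cmeasurableM; first exact: cmeasurable_cst.
      split; apply: measurable_funTS.
        apply: (measurableT_comp _ measurable_fst).
        by apply: continuous_measurable_fun; exact: continuous_cos.
      apply: (measurableT_comp _ measurable_fst).
      by apply: continuous_measurable_fun; exact: continuous_sin.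
    split; apply: measurable_funTS.
      exact: (measurableT_comp measurable_fst measurable_snd).
    exact: (measurableT_comp measurable_snd measurable_snd).
  by move=> -[t q] [_ /= qD]; exact: half1.
have F0 q : (TI `*` disk 0 1) q -> 0 <= F q by rewrite lee_fin cmod_ge0.
have [_ mG E] := tonelli_on lam dA_sf mTI mD mF F0.
have LE : \int[dA_sf]_(q in disk 0 1) (pi * cmod (f 0))%:E <=
    \int[dA_sf]_(q in disk 0 1) \int[lam]_(t in TI) F (t, q).
  apply: ge0_le_integral => //.
  - by move=> q _; rewrite lee_fin mulr_ge0 ?cmod_ge0// pi_ge0.
  - move=> q qD; rewrite /F /=.
    have h0 : (0 < 2^-1 :> R)%R by rewrite invr_gt0.
    have h1 : (2^-1 < 1 :> R)%R by rewrite invf_lt1// ltr1n.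
    have := @circle_mean_le (fun u => f (u * plane q)%R) _ h0 h1.
    rewrite mul0r; apply => w w1.
    apply: cdiff_comp; first by apply: cdiffM; [exact: cdiff_id|exact: cdiff_cst].
    apply: df; rewrite cmodM; apply: le_lt_trans w1.
    by rewrite ler_piMr ?cmod_ge0//; move: qD; rewrite /disk /= subr0 => /ltW.
have UE : \int[lam]_(t in TI) \int[dA_sf]_(q in disk 0 1) F (t, q) <=
    \int[lam]_(t in TI) (4%:E * I).
  have mft (t : R) : measurable_fun (disk 0 1) (fun q => F (t, q)).
    rewrite /F /=; apply/measurable_EFinP; apply: cmeasurable_cmod.
    apply: cmeasurable_analytic => //.
      by apply: cmeasurableM; [exact: cmeasurable_cst|exact: cmeasurable_plane].
    by move=> q; exact: half1.
  have mfp : measurable_fun (disk 0 1) (fun q => (cmod (f (plane q)))%:E).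
    by apply/measurable_EFinP; apply: cmeasurable_cmod; exact: cmeasurable_disk.
  apply: ge0_le_integral => //.
  - by move=> t _; apply: integral_ge0 => q _; rewrite lee_fin cmod_ge0.
  - by have [] := tonelli_on lam dA_sf mTI mD mF F0.
  - move=> t _.
    have c0 : circle 2^-1 t != 0%R by rewrite circle_neq0// invr_gt0.
    have := @ge0_area_substitution (disk 0 1) (fun q => (cmod (f (plane q)))%:E)
      (circle 2^-1 t) 0%R mD mfp
      (fun q _ => cmod_ge0 _) c0.
    rewrite cmod_circle ?invr_ge0// (_ : (2^-1 ^+ 2)^-1 = 4 :> R)%R; last by field.
    move=> <-; rewrite (eq_integral (fun q => (cmod (f (plane (affine (circle 2^-1 t) 0 q))))%:E)); last first.
      by move=> q _; rewrite /F /= plane_affine addr0.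
    apply: ge0_subset_integral => //.
    + by rewrite -[X in measurable X]setTI; apply: measurable_affine_plane.
    + apply: (measurable_comp mD _ mfp); first by move=> _ [q Eq <-].
      by apply: measurable_funTS; exact: measurable_affine_plane.
    + by move=> q _; rewrite lee_fin cmod_ge0.
    + by move=> q qD; rewrite /disk /= plane_affine addr0 subr0; exact: half1.
have := le_trans LE (le_trans _ UE); rewrite -E => /(_ (lexx _)).
rewrite !integral_cst// => H.
have I0 : 0 <= I by apply: integral_ge0 => q _; rewrite lee_fin cmod_ge0.
have lamTI : lam TI = (2 * pi)%:E.
  by rewrite /TI lebesgue_measure_itv /= lte_fin mulr_gt0 ?pi_gt0// sube0.
have {}H : (pi * cmod (f 0))%:E * dA R (disk 0 1) <= 4%:E * I * lam TI := H.
rewrite lamTI in H.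
have H2 : (pi * cmod (f 0))%:E * ((4 * pi)^-1)%:E <= 4%:E * I * (2 * pi)%:E.
  apply: le_trans H; apply: lee_wpmul2l; last exact: disk_area_ge.
  by rewrite lee_fin mulr_ge0 ?cmod_ge0// pi_ge0.
have p0 : (0 < pi :> R)%R := pi_gt0 R.
rewrite -[leLHS](_ : 4%:E * ((pi * cmod (f 0))%:E * ((4 * pi)^-1)%:E) = _); last first.
  have aux (P x : R) : (0 < P -> 4 * (P * x / (4 * P)) = x)%R.
    by move=> P0; field; rewrite gt_eqF.
  by rewrite -!EFinM aux.
apply: (le_trans (lee_wpmul2l _ H2)) => //.
by rewrite muleAC -!EFinM muleA -EFinM le_eqVlt; apply/orP; left; apply/eqP; congr (_%:E * _); ring.
Qed.

(** From p = 1 by the power mean with weight 1, instead of subharmonicity. *)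
Lemma area_power_mean (p : R) : (1 <= p)%R -> exists2 K : R, (0 < K)%R &
  forall (f : R[i] -> R[i]), (forall w, cmod w < 1 -> cdiff f w)%R ->
  (cmod (f 0) `^ p)%:E <= K%:E * \int[dA R]_(q in disk 0 1) (cmod (f (plane q)) `^ p)%:E.
Proof.
move=> p1; have p0 : (0 < pi :> R)%R := pi_gt0 R.
have K0 : (0 < 32 * pi :> R)%R by rewrite mulr_gt0.
have G0 : (0 < 4 * 1 ^+ 2 / pi :> R)%R by rewrite divr_gt0// mulr_gt0// exprn_gt0.
exists (2 * (32 * pi) * (2 * (32 * pi) * (4 * 1 ^+ 2 / pi)) `^ (p - 1))%R.
  by rewrite mulr_gt0 ?powR_gt0// mulr_gt0// mulr_gt0.
move=> f df; have mD := measurable_disk 0%R 1%R.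
have := @weighted_power_mean _ _ R (dA R) (disk 0 1) (fun=> 1%R)
  (fun q => cmod (f (plane q))) (cmod (f 0%R)) (32 * pi)%R (4 * 1 ^+ 2 / pi)%R p mD.
have E (h : mR * mR -> R) : \int[dA R]_(q in disk 0 1) (1 * h q)%:E =
    \int[dA R]_(q in disk 0 1) (h q)%:E.
  by apply: eq_integral => q _; rewrite mul1r.
rewrite !E; apply => //.
- by apply: cmeasurable_cmod; exact: cmeasurable_disk.
- by move=> q _; exact: cmod_ge0.
- exact: cmod_ge0.
- by rewrite integral_cst// mul1e disk_area_le.
- exact: area_mean_le.
Qed.

Lemma area_power_mean_disk (p : R) : (1 <= p)%R -> exists2 K : R, (0 < K)%R &
  forall (f : R[i] -> R[i]) z r, (forall w, cmod w < 1 -> cdiff f w)%R ->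
  (0 < r)%R -> (cmod z + r <= 1)%R ->
  (cmod (f z) `^ p)%:E <= (K / r ^+ 2)%:E *
    \int[dA R]_(q in disk z r) (cmod (f (plane q)) `^ p)%:E.
Proof.
move=> p1; have [K K0 HK] := area_power_mean p1; exists K => // f z r df r0 zr.
have rC : r%:C%C != 0%R :> R[i] by rewrite -cmod_gt0 cmodC gtr0_norm.
have in1 w : (cmod w < 1)%R -> (cmod (r%:C%C * w + z) < 1)%R.
  move=> w1; apply: le_lt_trans (cmodD _ _) _; rewrite cmodM cmodC gtr0_norm//.
  apply: lt_le_trans zr; rewrite addrC ltrD2l -[ltRHS]mulr1 ltr_pM2l//.
have := HK (fun w => f (r%:C%C * w + z)%R); rewrite mulr0 add0r => H.
apply: (le_trans (H _)).
  move=> w w1; apply: cdiff_comp; last exact/df/in1.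
  by apply: cdiffD; [apply: cdiffM; [exact: cdiff_cst|exact: cdiff_id]|exact: cdiff_cst].
have mf : measurable_fun (disk z r) (fun q => (cmod (f (plane q)) `^ p)%:E).
  apply/measurable_EFinP; apply: (measurableT_comp (measurable_powR p)).
  apply: cmeasurable_cmod; apply: cmeasurable_disk => // q.
  rewrite /disk /= subr0 => qz; rewrite -(subrK z (plane q)).
  apply: le_lt_trans (cmodD _ _) _; apply: lt_le_trans zr.
  by rewrite addrC ltrD2l.
have := @ge0_area_substitution (disk z r) _ r%:C%C z (measurable_disk z r) mf.
have -> : affine r%:C%C z @^-1` disk z r = disk 0 1.
  apply/seteqP; split => q; rewrite /disk /= plane_affine addrK subr0 cmodM cmodC gtr0_norm//.
    by rewrite -[ltRHS]mulr1 ltr_pM2l.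
  by move=> h; rewrite -[ltRHS]mulr1 ltr_pM2l.
rewrite cmodC (gtr0_norm r0) => /(_ _ rC) S.
rewrite EFinM -muleA -S; last by move=> q _; rewrite lee_fin powR_ge0.
rewrite le_eqVlt; apply/orP; left; apply/eqP; congr (_ * _).
by apply: eq_integral => q _; rewrite plane_affine.
Qed.

End area_measure.

(** * Carleson boxes and the tent norm *)

Section polar.
Context {R : realType}.
Implicit Types (u v z : R[i]).

Lemma polar_unit v : cmod v = 1 -> exists2 s : R, `|s| <= pi & v = cexpi s.
Proof.
case: v => x y v1; have xy : x ^+ 2 + y ^+ 2 = 1.
  by have := cmod_sqr (Complex x y); rewrite v1 expr1n.
have x1 : -1 <= x <= 1.
  rewrite -ler_norml; have := Re_le_cmod (Complex x y); by rewrite v1.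
have s1 : `|acos x| <= pi by rewrite ger0_norm ?acos_ge0// acos_lepi.
have sy : sin (acos x) = `|y|.
  rewrite sin_acos// (_ : 1 - x ^+ 2 = y ^+ 2); last by lra.
  by rewrite sqrtr_sqr.
have [y0|y0] := leP 0 y.
  by exists (acos x) => //; rewrite /cexpi acosK ?in_itv// sy ger0_norm.
exists (- acos x); first by rewrite normrN.
by rewrite /cexpi cosN sinN acosK ?in_itv// sy ltr0_norm// opprK.
Qed.

Lemma polar u : exists2 s : R, `|s| <= pi & u = (cmod u)%:C%C * cexpi s.
Proof.
have [->|u0] := eqVneq u 0.
  by exists 0; rewrite ?normr0 ?pi_ge0// cmod0 mul0r.
have c0 : (cmod u)%:C%C != 0 :> R[i] by rewrite -cmod_eq0 cmodC normr_eq0 cmod_eq0.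
have [|s s1 E] := @polar_unit (u / (cmod u)%:C%C).
  by rewrite cmodM cmodV cmodC ger0_norm ?cmod_ge0// mulfV// cmod_eq0.
by exists s => //; rewrite -E mulrC divfK.
Qed.

Lemma Re_mul_cexpi (r : R) (t : R) : complex.Re (r%:C%C * cexpi t) = r * cos t.
Proof. by rewrite /= mul0r subr0. Qed.

Lemma conjcM z u : conjc (z * u) = conjc z * conjc u.
Proof. by case: z u => a b [c d]; apply: complex_ext => /=; ring. Qed.

Lemma Re_mul_conj (l r t s : R) :
  complex.Re (l%:C%C * cexpi t * conjc (r%:C%C * cexpi s)) = l * r * cos (t - s).
Proof.
rewrite conjcM conj_cexpi (_ : conjc r%:C%C = r%:C%C); last first.
  by apply: complex_ext => //=; rewrite oppr0.
rewrite (_ : _ * _ * _ = (l * r)%:C%C * cexpi (t - s)) ?Re_mul_cexpi//.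
by rewrite cexpiD rmorphM; ring.
Qed.

Lemma cos_norm (t : R) : cos `|t| = cos t.
Proof. by case: (ger0P t) => // _; rewrite cosN. Qed.

Lemma ler_cos_norm (a t : R) : 0 <= a -> a <= pi -> `|t| <= pi ->
  (cos a <= cos t) = (`|t| <= a).
Proof.
move=> a0 api tpi; rewrite -(cos_norm t) leNgt [RHS]leNgt; congr negb.
by apply: ltr_cos; rewrite in_itv /= ?a0 ?normr_ge0.
Qed.

Lemma half_le_pi (r : R) : 0 <= r -> (1 - r) / 2 <= pi.
Proof. by move=> r0; have := pi_ge2 R; lra. Qed.

(** An angular distance at most a <= pi is a lower bound on a cosine, that is on
    the real part of z conj u. This removes the choice of arguments and makes the
    box visibly measurable. *)
Lemma carleson_boxP u z : u != 0 -> cmod u < 1 ->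
  carleson_box u z <-> [/\ cmod z < 1, cmod u <= cmod z &
    cmod z * cmod u * cos ((1 - cmod u) / 2) <= complex.Re (z * conjc u)].
Proof.
move=> u0 u1; rewrite /carleson_box (negbTE u0).
have r0 : 0 < cmod u by rewrite cmod_gt0.
have a0 : 0 <= (1 - cmod u) / 2 by lra.
have api := half_le_pi (ltW r0).
split.
  move=> [z1 [th [l [t [uE zE tth lr]]]]].
  have lu : cmod u <= l by lra.
  have l0 : 0 < l by exact: lt_le_trans lu.
  have zl : cmod z = l by rewrite zE cmodM cmod_cexpi mulr1 cmodC gtr0_norm.
  split; [exact: z1|by rewrite zl|].
  have -> : complex.Re (z * conjc u) = l * cmod u * cos (t - th).
    by rewrite zE {1}uE Re_mul_conj.
  rewrite zl ler_pM2l ?mulr_gt0//.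
  by rewrite ler_cos_norm// (le_trans tth).
move=> [z1 uz zu]; split => //.
have z0 : 0 < cmod z by exact: lt_le_trans uz.
have [th _ uE] := polar u.
have [s spi zE] := polar (z * cexpi (- th)).
have {}zE : z = (cmod z)%:C%C * cexpi (s + th).
  rewrite cexpiD mulrA; move: zE; rewrite cmodM cmod_cexpi mulr1 => <-.
  by rewrite -mulrA -cexpiD addNr cexpi0 mulr1.
exists th, (cmod z), (s + th); split => //; last by lra.
rewrite addrK -(ler_cos_norm a0 api spi).
move: zu; have -> : complex.Re (z * conjc u) = cmod z * cmod u * cos s.
  by rewrite {1}zE {1}uE Re_mul_conj addrK.
by rewrite ler_pM2l ?mulr_gt0.
Qed.

End polar.

Section boxes.
Context {R : realType}.
Local Open Scope ereal_scope.
Notation lam := (@lebesgue_measure R).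
Notation mR := (measurableTypeR R).
Implicit Types (u v z : R[i]).

Definition box u : set (mR * mR)%type := @plane R @^-1` carleson_box u.

Lemma boxE u : u != 0%R -> (cmod u < 1)%R ->
  box u = disk 0%R 1%R `&` [set q | cmod u <= cmod (plane q)]%R `&`
    [set q | 0 <= complex.Re (plane q * conjc u) -
       cmod (plane q) * (cmod u * cos ((1 - cmod u) / 2))]%R.
Proof.
move=> u0 u1; apply/seteqP; split => q.
  by move=> /(carleson_boxP _ u0 u1) [h1 h2 h3]; split; first (split => //);
    rewrite /disk /= ?subr0// subr_ge0 mulrA.
move=> [[h1 h2]]; rewrite /= subr_ge0 mulrA => h3.
by apply/(carleson_boxP _ u0 u1); split => //; move: h1; rewrite /disk /= subr0.
Qed.

Lemma box0 : box 0%R = disk 0%R 1%R.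
Proof. by rewrite /box /carleson_box eqxx unit_diskE. Qed.

Lemma measurable_box u : (cmod u < 1)%R -> measurable (box u).
Proof.
move=> u1; have [->|u0] := eqVneq u 0%R.
  by rewrite box0; exact: measurable_disk.
have mc : measurable_fun setT (fun q : mR * mR => cmod (plane q)).
  by apply: cmeasurable_cmod; exact: cmeasurable_plane.
rewrite boxE//; apply: measurableI; first apply: measurableI.
- exact: measurable_disk.
- exact: measurable_ge_set.
- apply: measurable_ge_set; apply: measurable_funB.
    have [] // : cmeasurable setT (fun q : mR * mR => plane q * conjc u)%R.
    by apply: cmeasurableM; [exact: cmeasurable_plane|exact: cmeasurable_cst].
  by apply: measurable_funM => //; exact: measurable_cst.
Qed.

Lemma box_subset_disk u : box u `<=` disk 0%R 1%R.
Proof.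
move=> q; rewrite /box /carleson_box /disk /= subr0.
by case: ifP => _ //= -[].
Qed.

Definition tent_density (p alpha : R) (f : R[i] -> R[i]) (q : mR * mR) : R :=
  (cmod (f (plane q)) `^ p * (1 - cmod (plane q) ^+ 2) `^ (alpha + 1))%R.

Lemma tent_density_ge0 p alpha f q : (0 <= tent_density p alpha f q)%R.
Proof. by rewrite mulr_ge0// powR_ge0. Qed.

Definition box_mean (p alpha : R) (f : R[i] -> R[i]) u : \bar R :=
  ((1 - cmod u ^+ 2)^-1)%:E * \int[dA R]_(q in box u) (tent_density p alpha f q)%:E.

Lemma sqr_modulus_gt0 u : (cmod u < 1 -> 0 < 1 - cmod u ^+ 2)%R.
Proof. by move=> u1; rewrite subr_gt0 expr_lt1// cmod_ge0. Qed.

Lemma box_mean_ge0 p alpha f u : (cmod u < 1)%R -> 0 <= box_mean p alpha f u.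
Proof.
move=> u1; apply: mule_ge0; first by rewrite lee_fin invr_ge0 ltW// sqr_modulus_gt0.
by apply: integral_ge0 => q _; rewrite lee_fin tent_density_ge0.
Qed.

Definition arc_measure : {measure set mR -> \bar R} :=
  mrestr lam (measurable_itv `[0%R, (2 * pi)%R[).

(** The p-th power of the tent norm. *)
Definition tent_sup zeta p alpha (f : R[i] -> R[i]) : \bar R :=
  ess_sup arc_measure (fun theta : R => tent_functional zeta p alpha f (cexpi theta)).

Lemma tent_normE zeta p alpha f :
  tent_norm zeta p alpha f = tent_sup zeta p alpha f `^ p^-1.
Proof. by []. Qed.

Lemma tent_sup_le zeta p alpha f (B : \bar R) :
  (forall u, (cmod u < 1)%R -> box_mean p alpha f u <= B) ->
  tent_sup zeta p alpha f <= B.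
Proof.
move=> fB; apply/ess_supP; apply: nearW => theta.
by apply: ge_ereal_sup => _ [u [u1 _] <-]; exact: fB.
Qed.

Lemma cexpiB_le (s t : R) : (`|s - t| <= 1 -> cmod (cexpi s - cexpi t) <= 2 * `|s - t|)%R.
Proof.
move=> st1; have -> : (cexpi s - cexpi t = cexpi t * (cexpi (s - t) - 1))%R.
  by rewrite mulrBr mulr1 -cexpiD [(t + _)%R]addrC subrK.
rewrite cmodM cmod_cexpi mul1r; apply: (le_trans (cmod_le _)).
move: st1; set d := (s - t)%R => d1; rewrite /= subr0.
have := norm_sin_le d; have := norm_cosB1_le d.
have : (d ^+ 2 <= `|d|)%R.
  by rewrite -real_normK ?num_real// expr2 ler_piMl.
have := normr_ge0 d; lra.
Qed.

(** The distance from u to u / |u| is 1 - |u|, which is less than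
    zeta (1 - |u| ^ 2). By continuity u is in the approach regions of a whole arc
    starting at u / |u|, and an arc is not negligible. *)
Lemma box_mean_le_tent_sup zeta p alpha f u : (1 / 2 < zeta)%R ->
  (cmod u < 1)%R -> (1 < zeta * (1 + cmod u))%R ->
  box_mean p alpha f u <= tent_sup zeta p alpha f.
Proof.
move=> z2 u1 zu; set r := cmod u.
have [s spi uE] := polar u.
have p0 : (0 < pi :> R)%R := pi_gt0 R.
have [th /andP[th0 th2] {}uE] : exists2 th : R, (0 <= th < 2 * pi)%R &
    u = (r%:C%C * cexpi th)%R.
  have [s0|s0] := leP 0%R s.
    by exists s => //; rewrite s0 /=; move: spi; rewrite ger0_norm//; lra.
  exists (s + 2 * pi)%R; last by rewrite cexpiD cexpi_2pi mulr1.
  by move: spi; rewrite ltr0_norm// => spi; apply/andP; split; lra.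
pose g := (zeta * (1 - r ^+ 2) - (1 - r))%R.
have g0 : (0 < g)%R.
  rewrite /g (_ : _ - _ = (1 - r) * (zeta * (1 + r) - 1))%R; last by ring.
  by rewrite mulr_gt0// subr_gt0.
(* Length of the arc: 1 for cexpiB_le, g / 2 to stay in the approach region,
   2 pi - th to stay in the parameter interval. *)
pose d := Num.min (Num.min 1%R (g / 2)%R) (2 * pi - th)%R.
have d0 : (0 < d)%R by rewrite !lt_min ltr01 divr_gt0// subr_gt0.
have d1 : (d <= 1)%R by rewrite /d !ge_min lexx.
have dg : (2 * d <= g)%R.
  have : (d <= g / 2)%R by rewrite /d !ge_min lexx orbT.
  lra.
have dt : (th + d <= 2 * pi)%R.
  have : (d <= 2 * pi - th)%R by rewrite /d !ge_min lexx !orbT.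
  lra.
have near_u t : (th < t < th + d)%R -> approach_region zeta (cexpi t) u.
  move=> /andP[t1 t2]; split => //.
  have -> : (u - cexpi t = (u - cexpi th) + (cexpi th - cexpi t))%R.
    by rewrite addrA subrK.
  apply: le_lt_trans (cmodD _ _) _.
  have -> : (cmod (u - cexpi th) = 1 - r)%R.
    rewrite uE (_ : _ - _ = (r - 1)%:C%C * cexpi th)%R.
      by rewrite cmodM cmod_cexpi mulr1 cmodC distrC ger0_norm// subr_ge0 ltW.
    by rewrite rmorphB rmorph1 mulrBl mul1r.
  have h : (`|th - t| < d)%R by rewrite ltr0_norm; lra.
  have := @cexpiB_le th t (ltW (lt_le_trans h d1)).
  by rewrite -/r; move: dg h; rewrite /g; lra.
have [N [mN N0 sN]] := ess_sup_ge arc_measure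
  (fun theta : R => tent_functional zeta p alpha f (cexpi theta)).
have : exists2 t, (th < t < th + d)%R & ~ N t.
  apply: contrapT => H.
  have IN : `]th, (th + d)%R[%classic `<=` N.
    move=> t /=; rewrite in_itv /= => tI; apply: contrapT => Nt.
    by apply: H; exists t.
  have : lam `]th, (th + d)%R[%classic <= arc_measure N.
    rewrite /arc_measure /mrestr /=; apply: le_measure; rewrite ?inE.
    - exact: measurable_itv.
    - by apply: measurableI => //; exact: measurable_itv.
    - move=> t tI; split; first exact: IN.
      move: tI; rewrite /= !in_itv /= => /andP[h1 h2].
      by rewrite (le_trans th0 (ltW h1)) (lt_le_trans h2).
  rewrite N0 lebesgue_measure_itv /= lte_fin ltrDl d0 -EFinD lee_fin.
  by rewrite addrC addKr leNgt d0.
move=> [t tI Nt].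
have Tt : tent_functional zeta p alpha f (cexpi t) <= tent_sup zeta p alpha f.
  by apply: contrapT => H; apply: Nt; exact: sN.
apply: le_trans Tt; apply: ereal_sup_ubound; exists u => //.
exact: near_u.
Qed.

End boxes.

(** * Bounds from the boxes near the boundary *)

Section box_bounds.
Context {R : realType}.
Local Open Scope ereal_scope.
Notation lam := (@lebesgue_measure R).
Notation mR := (measurableTypeR R).
Implicit Types (u v w z : R[i]).

(** All that is used of a finite tent norm: the boxes of the points with
    |u| <= r0 are left out because such points may lie in no approach region. *)
Definition box_bounded (p alpha r0 N : R) (f : R[i] -> R[i]) :=
  [/\ (forall w, cmod w < 1 -> cdiff f w)%R, (0 <= N)%R &
      forall u, (r0 < cmod u)%R -> (cmod u < 1)%R -> box_mean p alpha f u <= N%:E].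

Lemma one_minus_cos_ge (s : R) : (0 <= s -> s <= 1 -> s ^+ 2 / 4 <= 1 - cos s)%R.
Proof.
move=> s0 s1; rewrite cos_half.
have h := norm_sinB_le (s / 2); move: h; rewrite ler_norml => /andP[h _].
have {}h : (- ((s / 2) ^+ 3 / 2) <= sin (s / 2) - s / 2)%R.
  by move: h; rewrite ger0_norm//; lra.
have h3 : ((s / 2) ^+ 3 <= (s / 2) / 4)%R.
  have : (s ^+ 2 <= 1)%R by rewrite expr_le1.
  rewrite (_ : (s / 2) ^+ 3 = s * s ^+ 2 / 8)%R; last by field.
  nra.
have h4 : (3 / 8 * s <= sin (s / 2))%R by lra.
have h5 : ((3 / 8 * s) ^+ 2 <= sin (s / 2) ^+ 2)%R.
  by rewrite lerXn2r ?nnegrE//; lra.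
have := sqr_ge0 s; move: h5; rewrite exprMn; lra.
Qed.

Lemma measurable_weight (a : R) (D : set (mR * mR)%type) :
  measurable_fun D (fun q => (1 - cmod (plane q) ^+ 2) `^ a)%R.
Proof.
apply: (measurableT_comp (measurable_powR _)).
apply: measurable_funB; first exact: measurable_cst.
by apply: measurable_funX; apply: cmeasurable_cmod; exact: cmeasurable_plane.
Qed.

Lemma measurable_tent_density (p alpha : R) f (D : set (mR * mR)%type) :
  (forall w, cmod w < 1 -> cdiff f w)%R -> D `<=` disk 0%R 1%R ->
  measurable_fun D (tent_density p alpha f).
Proof.
move=> df D1; apply: measurable_funM.
  apply: (measurableT_comp (measurable_powR p)).
  by apply: cmeasurable_cmod; exact: cmeasurable_disk.
exact: measurable_weight.
Qed.

Lemma box_integral_le p alpha r0 N f u : box_bounded p alpha r0 N f ->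
  (r0 < cmod u)%R -> (cmod u < 1)%R ->
  \int[dA R]_(q in box u) (tent_density p alpha f q)%:E <=
    ((1 - cmod u ^+ 2) * N)%:E.
Proof.
move=> [df N0 HN] ru u1; have := HN u ru u1; rewrite /box_mean.
have s0 := sqr_modulus_gt0 u1.
by rewrite EFinM lee_pdivrMl// muleC.
Qed.

Lemma Re_mul_conj_polarization w z :
  (complex.Re (w * conjc z) = (cmod w ^+ 2 + cmod z ^+ 2 - cmod (w - z) ^+ 2) / 2)%R.
Proof.
by rewrite !cmod_sqr; case: w z => a b [c d] /=; field.
Qed.

(** The point u has the argument of z and the height 2 (1 - |z|), so z is well
    inside the box at u; the angular condition is the comparison of
    1 - cos s >= s ^ 2 / 4 with |w - z| ^ 2 <= (s / 6) ^ 2. *)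
Lemma disk_subset_box z : (2^-1 < cmod z)%R -> (cmod z < 1)%R ->
  exists2 u, (cmod u = 1 - 2 * (1 - cmod z))%R & disk z ((1 - cmod z) / 6) `<=` box u.
Proof.
move=> z2 z1; pose s := (1 - cmod z)%R.
have s0 : (0 < s)%R by rewrite subr_gt0.
have s2 : (s < 2^-1)%R by rewrite /s; lra.
have zc0 : (0 < cmod z)%R by apply: lt_trans z2; rewrite invr_gt0.
pose k := ((1 - 2 * s) / cmod z)%R.
have k0 : (0 < k)%R by rewrite divr_gt0//; lra.
exists (k%:C%C * z)%R.
  by rewrite cmodM cmodC gtr0_norm// /k divfK// gt_eqF.
have cu : (cmod (k%:C%C * z) = 1 - 2 * s)%R.
  by rewrite cmodM cmodC gtr0_norm// /k divfK// gt_eqF.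
have u0 : (k%:C%C * z != 0)%R by rewrite -cmod_gt0 cu; lra.
have u1 : (cmod (k%:C%C * z) < 1)%R by rewrite cu; lra.
move=> q; rewrite /disk /= -/s => qz; apply/(carleson_boxP _ u0 u1).
set w := plane q in qz *; rewrite cu.
have b1 := cmodB_le w z; have b2 := cmodB_le z w; rewrite cmodB in b2.
have zE : (cmod z = 1 - s)%R by rewrite /s; lra.
have w1 : (1 - s - s / 6 <= cmod w)%R by lra.
split; [lra|lra|].
rewrite (_ : (1 - (1 - 2 * s)) / 2 = s)%R; last by field.
have -> : (complex.Re (w * conjc (k%:C%C * z)) = k * complex.Re (w * conjc z))%R.
  by case: (w) (z) => a b [c d] /=; ring.
rewrite Re_mul_conj_polarization /k; set X := (_ / 2)%R.
rewrite (_ : cmod w * _ * cos s = (1 - 2 * s) * (cmod w * cos s))%R; last by ring.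
rewrite -mulrA (mulrC (cmod z)^-1%R) ler_pM2l; last by lra.
rewrite ler_pdivlMr// /X.
have C := one_minus_cos_ge (ltW s0) (_ : s <= 1)%R.
have {C} C1 : (s ^+ 2 / 4 <= 1 - cos s)%R by apply: C; lra.
have wz : (cmod (w - z) ^+ 2 <= (s / 6) ^+ 2)%R.
  by rewrite lerXn2r ?nnegrE ?cmod_ge0 ?divr_ge0 ?(ltW s0)// ltW.
have sq : (2 * (cmod w * cmod z) <= cmod w ^+ 2 + cmod z ^+ 2)%R.
  have := sqr_ge0 (cmod w - cmod z); rewrite sqrrB; lra.
have wz5 : (5 / 24 <= cmod w * cmod z)%R.
  rewrite (_ : 5 / 24 = 5 / 12 * 2^-1)%R; last by field.
  by rewrite ler_pM//; lra.
have P : (5 / 24 * (s ^+ 2 / 4) <= cmod w * cmod z * (1 - cos s))%R.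
  by rewrite ler_pM// ?divr_ge0 ?sqr_ge0.
have := sqr_ge0 s; move: wz; rewrite exprMn; lra.
Qed.

(** The mean value inequality on the disk of radius s / 6 around z, s = 1 - |z|:
    the weight is at least of order s ^ (alpha + 1) there, and the box containing the
    disk has a mean at most N. The threshold (1 + r0) / 2 makes the vertex of this
    box satisfy r0 < |u|. *)
Lemma near_boundary_bound (p alpha r0 : R) : (1 <= p)%R -> (-1 < alpha)%R ->
  (0 <= r0)%R -> exists2 C : R, (0 < C)%R & forall N f, box_bounded p alpha r0 N f ->
  forall z, ((1 + r0) / 2 < cmod z)%R -> (cmod z < 1)%R ->
  (cmod (f z) `^ p <= C * N / (1 - cmod z) `^ (alpha + 2))%R.
Proof.
move=> p1 a1 r00; have [K K0 HK] := @area_power_mean_disk R p p1.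
pose C := (K * 36 * (4 * 2 `^ (alpha + 1)))%R.
have C0 : (0 < C)%R by rewrite mulr_gt0 ?mulr_gt0// powR_gt0.
exists C => // N f fN z zr z1; have [df N0 _] := fN.
pose s := (1 - cmod z)%R; have s0 : (0 < s)%R by rewrite subr_gt0.
have zE : (cmod z = 1 - s)%R by rewrite /s; lra.
have z2 : (2^-1 < cmod z)%R by lra.
have [u uE sub] := disk_subset_box z2 z1; rewrite -/s in uE sub.
have ru : (r0 < cmod u)%R by rewrite uE; lra.
have u1 : (cmod u < 1)%R by rewrite uE; lra.
have d0 : (0 < s / 6)%R by rewrite divr_gt0.
have dz : (cmod z + s / 6 <= 1)%R by lra.
have H := HK f z (s / 6)%R df d0 dz.
have mD := measurable_disk z (s / 6)%R.
have sub1 := subset_trans sub (@box_subset_disk R u).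
have s20 : (0 < s / 2)%R by rewrite divr_gt0.
have P0 : (0 < (s / 2) `^ (alpha + 1))%R by rewrite powR_gt0.
have mfp : measurable_fun (disk z (s / 6)) (fun q => (cmod (f (plane q)) `^ p)%:E).
  apply/measurable_EFinP; apply: (measurableT_comp (measurable_powR p)).
  by apply: cmeasurable_cmod; exact: cmeasurable_disk.
have I : \int[dA R]_(q in disk z (s / 6)) (cmod (f (plane q)) `^ p)%:E <=
    (((s / 2) `^ (alpha + 1))^-1 * ((1 - cmod u ^+ 2) * N))%:E.
  rewrite EFinM; apply: le_trans (lee_wpmul2l _ (box_integral_le fN ru u1)); last first.
    by rewrite lee_fin invr_ge0 ltW.
  rewrite lee_pdivlMl//.
  rewrite -ge0_integralZl//; last 2 first.
  - by move=> q _; rewrite lee_fin powR_ge0.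
  - by rewrite lee_fin ltW.
  apply: (@le_trans _ _ (\int[dA R]_(q in disk z (s / 6)) (tent_density p alpha f q)%:E)).
    apply: ge0_le_integral => //.
    - by move=> q _; rewrite -EFinM lee_fin mulr_ge0 ?powR_ge0// ltW.
    - exact: measurable_funeM.
    - by apply/measurable_EFinP; exact: measurable_tent_density.
    - move=> q qD; rewrite -EFinM lee_fin /tent_density mulrC ler_wpM2l ?powR_ge0//.
      have qz : (cmod (plane q - z) < s / 6)%R := qD.
      have b1 := cmodB_le (plane q) z.
      have c0 := cmod_ge0 (plane q).
      have h : (s / 2 <= 1 - cmod (plane q))%R by lra.
      have h2 : (cmod (plane q) ^+ 2 <= cmod (plane q))%R by rewrite expr2 ler_piMl//; lra.
      apply: ge0_ler_powR; rewrite ?nnegrE; lra.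
  apply: ge0_subset_integral => //.
  - exact: measurable_box.
  - apply/measurable_EFinP; apply: measurable_tent_density => //.
    exact: box_subset_disk.
  - by move=> q _; rewrite lee_fin tent_density_ge0.
rewrite -lee_fin; apply: (le_trans H); apply: le_trans (lee_wpmul2l _ I) _.
  by rewrite lee_fin divr_ge0// ltW// exprn_gt0.
rewrite -EFinM lee_fin -/s.
have uu : (1 - cmod u ^+ 2 <= 4 * s)%R by rewrite uE; have := sqr_ge0 s; lra.
have sE : ((s / 2) `^ (alpha + 1) = s `^ (alpha + 1) / 2 `^ (alpha + 1))%R.
  have -> : (s `^ (alpha + 1) = (s / 2) `^ (alpha + 1) * 2 `^ (alpha + 1))%R.
    by rewrite -powRM ?(ltW s20)// divfK.
  by rewrite mulfK// gt_eqF// powR_gt0.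
have sE2 : (s `^ (alpha + 2) = s * s `^ (alpha + 1))%R.
  rewrite -(@mulr_powRB1 _ s (alpha + 2)%R) ?(ltW s0)//; last by lra.
  by congr (_ * _ `^ _)%R; lra.
have Q0 : (0 < s `^ (alpha + 1))%R by rewrite powR_gt0.
have T0 : (0 < 2 `^ (alpha + 1) :> R)%R by rewrite powR_gt0.
apply: (@le_trans _ _ (K / (s / 6) ^+ 2 * (((s / 2) `^ (alpha + 1))^-1 * (4 * s * N)))%R).
  rewrite ler_wpM2l ?divr_ge0 ?(ltW K0) ?exprn_ge0 ?(ltW d0)//.
  by rewrite ler_wpM2l ?invr_ge0 ?(ltW P0)// ler_wpM2r.
rewrite sE sE2 /C le_eqVlt; apply/orP; left; apply/eqP.
move: Q0 T0; move: (s `^ _)%R (2 `^ _)%R => a b a0 b0.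
by field; rewrite !gt_eqF.
Qed.

End box_bounds.

Section transfer.
Context {R : realType}.
Local Open Scope ereal_scope.
Notation lam := (@lebesgue_measure R).
Notation mR := (measurableTypeR R).
Implicit Types (u v w z : R[i]).
Context (p alpha r0 : R).
Context (p1 : (1 <= p)%R) (a1 : (-1 < alpha)%R) (r00 : (0 <= r0)%R) (r01 : (r0 < 1)%R).

(** Below the threshold the Cauchy estimate on a circle of radius r3 beyond it gives
    the bound with another constant. *)
Lemma pointwise_bound : exists2 C : R, (0 < C)%R & forall N f,
  box_bounded p alpha r0 N f -> forall z, (cmod z < 1)%R ->
  (cmod (f z) `^ p <= C * N / (1 - cmod z) `^ (alpha + 2))%R.
Proof.
have [C C0 HC] := near_boundary_bound p1 a1 r00.
pose r2 := ((1 + r0) / 2)%R; pose r3 := ((1 + r2) / 2)%R.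
have r21 : (r2 < 1)%R by move: r01; rewrite /r2; lra.
have r20 : (0 < r2)%R by move: r00; rewrite /r2; lra.
have r31 : (r3 < 1)%R by rewrite /r3; lra.
have r23 : (r2 < r3)%R by rewrite /r3; lra.
have r30 : (0 < r3)%R := lt_trans r20 r23.
have p0 : (0 < p)%R := lt_le_trans ltr01 p1.
pose L := (2 * (r3 / (r3 - r2)))%R.
have L0 : (0 < L)%R by rewrite mulr_gt0// divr_gt0// subr_gt0.
pose D := (L `^ p * (C / (1 - r3) `^ (alpha + 2)))%R.
have q0 : (0 < (1 - r3) `^ (alpha + 2))%R by rewrite powR_gt0// subr_gt0.
have D0 : (0 < D)%R by rewrite mulr_gt0 ?powR_gt0 ?divr_gt0.
exists (Num.max C D); first by rewrite lt_max C0.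
move=> N f fN z z1; have [df N0 _] := fN.
have a2 : (0 <= alpha + 2)%R by move: a1; lra.
have zz : (0 < (1 - cmod z) `^ (alpha + 2))%R by rewrite powR_gt0// subr_gt0.
have [zr|zr] := ltP r2 (cmod z).
  apply: (le_trans (HC N f fN z zr z1)).
  by rewrite ler_pM2r ?invr_gt0// ler_wpM2r// le_max lexx.
pose M := (C * N / (1 - r3) `^ (alpha + 2))%R.
have M0 : (0 <= M)%R by rewrite divr_ge0 ?(ltW q0)// mulr_ge0 ?(ltW C0).
have fM w : cmod w = r3 -> (cmod (f w) <= M `^ p^-1)%R.
  move=> wr; have := HC N f fN w; rewrite wr => /(_ r23 r31) H.
  have : ((cmod (f w) `^ p) `^ p^-1 <= M `^ p^-1)%R.
    by rewrite ge0_ler_powR ?nnegrE ?invr_ge0 ?powR_ge0 ?(ltW p0).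
  by rewrite -powRrM mulfV ?gt_eqF// powRr1 ?cmod_ge0.
have zr3 : (cmod z < r3)%R := le_lt_trans zr r23.
have H := cauchy_sup_bound df r30 r31 zr3 fM.
have H2 : (cmod (f z) <= L * M `^ p^-1)%R.
  apply: (le_trans H); rewrite mulrCA mulrC; apply: ler_wpM2r; first exact: powR_ge0.
  rewrite ler_pM2l// ler_pM2l// lef_pV2 ?posrE ?subr_gt0//; lra.
have H3 : (cmod (f z) `^ p <= L `^ p * M)%R.
  have := ge0_ler_powR (ltW p0) _ _ H2; rewrite !nnegrE cmod_ge0 mulr_ge0 ?powR_ge0 ?(ltW L0)//.
  move=> /(_ isT isT); rewrite powRM ?powR_ge0 ?(ltW L0)// -(powRrM M) mulVf ?gt_eqF//.
  by rewrite powRr1.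
apply: (le_trans H3).
have one : ((1 - cmod z) `^ (alpha + 2) <= 1)%R.
  rewrite [leRHS](_ : 1 = 1 `^ (alpha + 2))%R; last by rewrite powR1.
  apply: ge0_ler_powR; rewrite ?nnegrE//.
    by rewrite subr_ge0 ltW.
  by rewrite lerBlDr lerDl cmod_ge0.
rewrite ler_pdivlMr//.
apply: (@le_trans _ _ (L `^ p * M)%R).
  by rewrite ler_piMr// mulr_ge0 ?powR_ge0.
rewrite (_ : L `^ p * M = D * N)%R; last by rewrite /D /M; ring.
by rewrite ler_wpM2r// le_max lexx orbT.
Qed.

Lemma le_integral_setU (A B : set (mR * mR)%type) (F : mR * mR -> \bar R) :
  measurable A -> measurable B -> measurable_fun (A `|` B) F ->
  (forall q, 0 <= F q) ->
  \int[dA R]_(q in A `|` B) F q <= \int[dA R]_(q in A) F q + \int[dA R]_(q in B) F q.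
Proof.
move=> mA mB mF F0.
have mFB : measurable_fun B F.
  by apply: measurable_funS mF; [exact: measurableU|exact: subsetUr].
have mBA : measurable (B `\` A) by exact: measurableD.
have E : A `|` B = A `|` (B `\` A) by rewrite setDE setUIr setUv setIT.
rewrite E in mF *; rewrite ge0_integral_setU//; last first.
  by apply/disj_setPS => q [Aq [_ /(_ Aq)]].
apply: leeD => //; apply: ge0_subset_integral => //.
Qed.

Lemma integral_density_le (D : set (mR * mR)%type) (f : R[i] -> R[i]) (M r : R) :
  (0 <= r)%R -> (0 <= M)%R -> (forall w, cmod w < 1 -> cdiff f w)%R ->
  measurable D -> D `<=` disk 0%R 1%R -> dA R D <= r%:E ->
  (forall q, D q -> tent_density p alpha f q <= M)%R ->
  \int[dA R]_(q in D) (tent_density p alpha f q)%:E <= (M * r)%:E.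
Proof.
move=> rp M0 df mD D1 Dr fM.
apply: (@le_trans _ _ (\int[dA R]_(q in D) M%:E)).
  apply: ge0_le_integral => //.
  - by move=> q _; rewrite lee_fin tent_density_ge0.
  - by apply/measurable_EFinP; exact: measurable_tent_density.
rewrite integral_cst// EFinM; apply: lee_wpmul2l => //.
Qed.

Lemma powR_le1 (x a : R) : (0 <= x)%R -> (x <= 1)%R -> (0 <= a)%R -> (x `^ a <= 1)%R.
Proof.
move=> x0 x1 a0; rewrite [leRHS](_ : 1 = 1 `^ a)%R; last by rewrite powR1.
by apply: ge0_ler_powR; rewrite ?nnegrE.
Qed.

(** Finitely many boxes with vertices equally spaced on the circle of radius r4
    cover the annulus beyond it, and f is bounded on the disk of radius r4. *)
Lemma whole_disk_bound : exists2 C : R, (0 < C)%R & forall N f,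
  box_bounded p alpha r0 N f ->
  \int[dA R]_(q in disk 0%R 1%R) (tent_density p alpha f q)%:E <= (C * N)%:E.
Proof.
have [C C0 HC] := pointwise_bound.
pose r4 := ((1 + r0) / 2)%R.
have r41 : (r4 < 1)%R by move: r01; rewrite /r4; lra.
have r40 : (0 < r4)%R by move: r00; rewrite /r4; lra.
have r04 : (r0 < r4)%R by move: r01; rewrite /r4; lra.
have a2 : (0 <= alpha + 2)%R by move: a1; lra.
have aa : (0 <= alpha + 1)%R by move: a1; lra.
have p0 : (0 < pi :> R)%R := pi_gt0 R.
(* The half angle of a box with vertex at distance r4 from 0. *)
pose a := ((1 - r4) / 2)%R; have a0 : (0 < a)%R by rewrite divr_gt0// subr_gt0.
pose K := (Num.truncn (2 * pi / a)%R).+1.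
pose u (k : nat) : R[i] := (r4%:C%C * cexpi (- pi + k%:R * a))%R.
have uE k : cmod (u k) = r4 by rewrite cmodM cmod_cexpi mulr1 cmodC gtr0_norm.
have u0 k : u k != 0%R by rewrite -cmod_gt0 uE.
pose B n := \big[setU/set0]_(k < n) box (u k).
have mb k : measurable (box (u k)) by apply: measurable_box; rewrite uE.
have mB n : measurable (B n) by apply: bigsetU_measurable.
have BS n : B n.+1 = B n `|` box (u n) by rewrite /B big_ord_recr.
have B1 n : B n `<=` disk 0%R 1%R.
  elim: n => [|n IH]; first by rewrite /B big_ord0.
  by rewrite BS subUset; split => //; exact: box_subset_disk.
pose q4 := ((1 - r4) `^ (alpha + 2))%R.
have q40 : (0 < q4)%R by rewrite powR_gt0// subr_gt0.
exists (C / q4 * (4 * 1 ^+ 2 / pi) + K%:R)%R.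
  by rewrite ltr_wpDr// mulr_gt0// ?divr_gt0// ?mulr_gt0// exprn_gt0.
move=> N f fN; have [df N0 _] := fN.
have mdens D : D `<=` disk 0%R 1%R -> measurable_fun D (fun q => (tent_density p alpha f q)%:E).
  by move=> D1; apply/measurable_EFinP; exact: measurable_tent_density.
have dens0 q : 0 <= (tent_density p alpha f q)%:E by rewrite lee_fin tent_density_ge0.
have BI n : \int[dA R]_(q in B n) (tent_density p alpha f q)%:E <= (n%:R * N)%:E.
  elim: n => [|n IH]; first by rewrite /B big_ord0 integral_set0 mul0r.
  rewrite BS; apply: (le_trans (le_integral_setU (mB n) (mb n) _ dens0)).
    by rewrite -BS; apply: mdens.
  rewrite -natr1 mulrDl mul1r EFinD; apply: leeD => //.
  have uk1 : (cmod (u n) < 1)%R by rewrite uE.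
  have uk0 : (r0 < cmod (u n))%R by rewrite uE.
  apply: (le_trans (box_integral_le fN uk0 uk1)).
  by rewrite lee_fin ler_piMl// uE lerBlDr lerDl sqr_ge0.
have d41 : disk 0%R r4 `<=` disk 0%R 1%R.
  by move=> q; rewrite /disk /= => /lt_trans; apply.
have cover : disk 0%R 1%R `<=` disk 0%R r4 `|` B K.
  move=> q; rewrite /disk /= subr0 => q1.
  have [qr|qr] := ltP (cmod (plane q)) r4; first by left.
  right; have [s spi zE] := polar (plane q).
  have spi2 : (0 <= s + pi <= 2 * pi)%R by move: spi; rewrite ler_norml; lra.
  pose x := ((s + pi) / a)%R.
  have x0 : (0 <= x)%R by rewrite divr_ge0 ?(ltW a0)//; case/andP: spi2.
  have /andP[k1 k2] := truncn_itv x0; set k := Num.truncn x in k1 k2.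
  have kK : (k < K)%N.
    rewrite ltnS; apply: le_truncn; rewrite ler_pM2r ?invr_gt0//.
    by case/andP: spi2.
  rewrite /B -(bigcup_mkord K (fun k => box (u k))); exists k => //.
  rewrite /box /carleson_box (negbTE (u0 k)) uE; split => //.
  exists (- pi + k%:R * a)%R, (cmod (plane q)), s; split => //; last by lra.
  have ka1 : (k%:R * a <= s + pi)%R by rewrite -ler_pdivlMr.
  have ka2 : (s + pi <= k%:R * a + a)%R.
    have : (s + pi <= k.+1%:R * a)%R by rewrite -ler_pdivrMr// ltW.
    by rewrite -natr1 mulrDl mul1r.
  rewrite -/a ler_norml; lra.
apply: (@le_trans _ _ (\int[dA R]_(q in disk 0%R r4 `|` B K) (tent_density p alpha f q)%:E)).
  apply: ge0_subset_integral => //.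
  - exact: measurable_disk.
  - by apply: measurableU => //; exact: measurable_disk.
  - by apply: mdens; rewrite subUset; split.
apply: (le_trans (le_integral_setU (measurable_disk _ _) (mB K) _ dens0)).
  by apply: mdens; rewrite subUset; split.
rewrite mulrDl EFinD; apply: leeD; last exact: BI.
rewrite (_ : C / q4 * _ * N = C * N / q4 * (4 * 1 ^+ 2 / pi))%R; last by ring.
apply: integral_density_le => //.
- by rewrite divr_ge0 ?(ltW p0)// mulr_ge0.
- by rewrite divr_ge0 ?(ltW q40)// mulr_ge0// ltW.
- exact: measurable_disk.
- apply: (@le_trans _ _ (dA R (disk 0%R 1%R))); last exact: disk_area_le.
  by apply: le_measure; rewrite ?inE//; exact: measurable_disk.
- move=> q; rewrite /disk /= subr0 => qr.
  have q1 : (cmod (plane q) < 1)%R := lt_trans qr r41.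
  rewrite /tent_density -[leRHS]mulr1; apply: ler_pM; rewrite ?powR_ge0//.
    apply: (le_trans (HC N f fN _ q1)).
    apply: ler_wpM2l; first by rewrite mulr_ge0// ltW.
    rewrite lef_pV2 ?posrE// ?powR_gt0 ?subr_gt0//.
    by apply: ge0_ler_powR; rewrite ?nnegrE ?subr_ge0 ?(ltW q1) ?(ltW r41)// lerB// ltW.
  apply: powR_le1 => //; first exact/ltW/sqr_modulus_gt0.
  by rewrite lerBlDr lerDl sqr_ge0.
Qed.

End transfer.

(** * Dilated functions *)

Section dilation.
Context {R : realType}.
Local Open Scope ereal_scope.
Notation lam := (@lebesgue_measure R).
Notation mR := (measurableTypeR R).
Implicit Types (u v w z c : R[i]).
Context (p alpha r0 : R).
Context (p1 : (1 <= p)%R) (a1 : (-1 < alpha)%R) (r00 : (0 <= r0)%R) (r01 : (r0 < 1)%R).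

(** The weight is that of z, not of c z. *)
Definition dilated_density (f : R[i] -> R[i]) c (q : mR * mR) : R :=
  (cmod (f (c * plane q)%R) `^ p * (1 - cmod (plane q) ^+ 2) `^ (alpha + 1))%R.

Lemma box_subset_small_disk u : (cmod u < 1)%R ->
  box u `<=` disk u (3 * (1 - cmod u))%R.
Proof.
move=> u1 q; have [->|u0] := eqVneq u 0%R.
  rewrite box0 /disk /= cmod0 => /lt_trans; apply; lra.
rewrite /box /carleson_box /= (negbTE u0) /disk /=.
move=> [z1 [th [l [t [uE zE tth lr]]]]].
have rl : (cmod u <= l)%R by lra.
have r0' := cmod_ge0 u; have l0 : (0 <= l)%R := le_trans r0' rl.
have l1 : (l < 1)%R by move: z1; rewrite /unit_disk /= zE cmodM cmod_cexpi mulr1 cmodC ger0_norm.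
have -> : (plane q - u = (l - cmod u)%:C%C * cexpi t + (cmod u)%:C%C * (cexpi t - cexpi th))%R.
  by rewrite zE {1}uE rmorphB; ring.
apply: le_lt_trans (cmodD _ _) _.
rewrite !cmodM cmod_cexpi mulr1 !cmodC !ger0_norm ?subr_ge0//.
have h := @cexpiB_le R t th (_ : `|t - th| <= 1)%R.
have {}h : (cmod (cexpi t - cexpi th) <= 2 * `|t - th|)%R by apply: h; lra.
have h2 : (cmod u * cmod (cexpi t - cexpi th) <= 1 * (1 - cmod u))%R.
  by apply: ler_pM; rewrite ?cmod_ge0//; lra.
lra.
Qed.

Lemma box_area_le u : (cmod u < 1)%R -> dA R (box u) <= (36 * (1 - cmod u) ^+ 2)%:E.
Proof.
move=> u1; have h0 : (0 <= 3 * (1 - cmod u))%R by lra.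
apply: (@le_trans _ _ (dA R (disk u (3 * (1 - cmod u))%R))).
  apply: le_measure; rewrite ?inE; [exact: measurable_box|exact: measurable_disk|].
  exact: box_subset_small_disk.
apply: (le_trans (disk_area_le u h0)); rewrite lee_fin.
rewrite ler_pdivrMr ?pi_gt0//.
have -> : (4 * (3 * (1 - cmod u)) ^+ 2 = 36 * (1 - cmod u) ^+ 2)%R by ring.
rewrite ler_peMr ?mulr_ge0 ?sqr_ge0//; have := pi_ge2 R; lra.
Qed.

(** Multiplication by c adds the same angle to u and to the points of the box, and
    moves moduli by less than h / 2. A box of height 2 h at the argument of c u
    has room for this. *)
Lemma box_rotate_dilate c u (h : R) : u != 0%R -> (cmod u < 1)%R -> c != 0%R ->
  h = (1 - cmod u)%R -> (1 - cmod c < h / 2)%R -> (cmod c < 1)%R -> (2 * h < 1)%R ->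
  exists2 v, cmod v = (1 - 2 * h)%R & box u `<=` affine c 0%R @^-1` box v.
Proof.
move=> u0 u1 c0 hE ch c1 h1.
have uc0 : (0 < cmod u)%R by rewrite cmod_gt0.
have cc0 : (0 < cmod c)%R by rewrite cmod_gt0.
pose k := ((1 - 2 * h) / (cmod c * cmod u))%R.
have k0 : (0 < k)%R by rewrite divr_gt0 ?mulr_gt0//; lra.
have vE : cmod (k%:C%C * (c * u))%R = (1 - 2 * h)%R.
  rewrite !cmodM cmodC gtr0_norm// /k divfK// gt_eqF// mulr_gt0//.
exists (k%:C%C * (c * u))%R => //.
have v0 : (k%:C%C * (c * u) != 0)%R by rewrite -cmod_gt0 vE; lra.
move=> q; rewrite /box /carleson_box /= (negbTE u0) (negbTE v0) plane_affine addr0 vE.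
move=> [z1 [th [l [t [uE zE tth lr]]]]].
have rl : (cmod u <= l)%R by lra.
have l0 : (0 <= l)%R := le_trans (cmod_ge0 _) rl.
have l1 : (l < 1)%R by move: z1; rewrite /unit_disk /= zE cmodM cmod_cexpi mulr1 cmodC ger0_norm.
split.
  rewrite /unit_disk /= cmodM; apply: le_lt_trans c1.
  by rewrite ler_piMr ?cmod_ge0// ltW.
have [ph _ cE] := polar c.
exists (ph + th)%R, (cmod c * l)%R, (ph + t)%R; split.
- rewrite cexpiD {1}cE {1}uE.
  rewrite (_ : (1 - 2 * h)%:C%C = (k%:C%C * ((cmod c)%:C%C * (cmod u)%:C%C))%R); first by ring.
  by rewrite -!rmorphM /= /k divfK// gt_eqF// mulr_gt0.
- by rewrite zE {1}cE cexpiD rmorphM /=; ring.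
- rewrite (_ : ph + t - (ph + th) = t - th)%R; last by ring.
  by apply: (le_trans tth); lra.
- have : ((1 - h / 2) * (1 - h) <= cmod c * l)%R by apply: ler_pM; lra.
  have := sqr_ge0 h; nra.
Qed.

Lemma measurable_dilated_density f c : (forall w, cmod w < 1 -> cdiff f w)%R ->
  (cmod c < 1)%R -> measurable_fun (disk 0%R 1%R) (dilated_density f c).
Proof.
move=> df c1; apply: measurable_funM.
  apply: (measurableT_comp (measurable_powR p)).
  apply: cmeasurable_cmod; apply: cmeasurable_analytic => //.
    by apply: cmeasurableM; [exact: cmeasurable_cst|exact: cmeasurable_plane].
  move=> q; rewrite /disk /= subr0 cmodM => q1; apply: le_lt_trans c1.
  by rewrite ler_piMr ?cmod_ge0// ltW.
exact: measurable_weight.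
Qed.

Lemma dilated_density_ge0 f c q : (0 <= dilated_density f c q)%R.
Proof. by rewrite mulr_ge0// powR_ge0. Qed.

(** Change of variable z |-> c z, with Jacobian at most 4 since |c| > 1 / 2; the
    weight only grows, as |c z| <= |z|. *)
Lemma integral_dilation_le f c u (E : set (mR * mR)%type) (M : R) :
  (forall w, cmod w < 1 -> cdiff f w)%R -> (cmod u < 1)%R ->
  (2^-1 < cmod c)%R -> (cmod c < 1)%R -> (0 <= M)%R ->
  measurable E -> E `<=` disk 0%R 1%R -> box u `<=` affine c 0%R @^-1` E ->
  \int[dA R]_(q in E) (tent_density p alpha f q)%:E <= M%:E ->
  \int[dA R]_(q in box u) (dilated_density f c q)%:E <= (4 * M)%:E.
Proof.
move=> df u1 c2 c1 M0 mE E1 uE EM.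
have cc0 : (0 < cmod c)%R by apply: lt_trans c2; rewrite invr_gt0.
have c0 : c != 0%R by rewrite -cmod_gt0.
have mdens : measurable_fun E (fun q => (tent_density p alpha f q)%:E).
  by apply/measurable_EFinP; exact: measurable_tent_density.
have mpre : measurable (affine c 0%R @^-1` E).
  by rewrite -[X in measurable X]setTI; apply: measurable_affine_plane.
have mdd : measurable_fun (affine c 0%R @^-1` E)
    (fun q => (tent_density p alpha f (affine c 0%R q))%:E).
  apply: (measurable_comp mE _ mdens); first by move=> _ [q Eq <-].
  by apply: measurable_funTS; exact: measurable_affine_plane.
have aa : (0 <= alpha + 1)%R by move: a1; lra.
apply: (@le_trans _ _ (\int[dA R]_(q in box u) (tent_density p alpha f (affine c 0%R q))%:E)).
  apply: ge0_le_integral => //.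
  - exact: measurable_box.
  - by move=> q _; rewrite lee_fin dilated_density_ge0.
  - apply/measurable_EFinP; apply: measurable_funS (measurable_dilated_density df c1).
      exact: measurable_disk.
    exact: box_subset_disk.
  - by apply: measurable_funS mdd.
  - move=> q /box_subset_disk; rewrite /disk /= subr0 => q1.
    rewrite lee_fin /tent_density plane_affine addr0 ler_wpM2l ?powR_ge0//.
    have cq : (cmod (c * plane q) <= cmod (plane q))%R.
      by rewrite cmodM ler_piMl ?cmod_ge0// ltW.
    have cq1 := le_lt_trans cq q1.
    apply: ge0_ler_powR; rewrite ?nnegrE ?(ltW (sqr_modulus_gt0 _))//.
    by rewrite lerB// lerXn2r ?nnegrE ?cmod_ge0.
apply: (@le_trans _ _ (\int[dA R]_(q in affine c 0%R @^-1` E) (tent_density p alpha f (affine c 0%R q))%:E)).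
  apply: ge0_subset_integral => //.
  - exact: measurable_box.
  - by move=> q _; rewrite lee_fin tent_density_ge0.
have d0 q : E q -> 0 <= (tent_density p alpha f q)%:E.
  by rewrite lee_fin tent_density_ge0.
rewrite (@ge0_area_substitution R E (fun q => (tent_density p alpha f q)%:E) c 0%R
  mE mdens d0 c0).
rewrite EFinM; apply: lee_pmul => //.
- by rewrite lee_fin invr_ge0 sqr_ge0.
- by apply: integral_ge0 => q _; rewrite lee_fin tent_density_ge0.
- rewrite lee_fin (_ : 4 = ((2^-1) ^+ 2)^-1 :> R)%R; last by field.
  rewrite lef_pV2 ?posrE ?exprn_gt0 ?invr_gt0//.
  by rewrite lerXn2r ?nnegrE ?invr_ge0 ?cmod_ge0// ltW.
Qed.

(** Three cases: c far from the unit circle compared to h = 1 - |u|, then c close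
    to it with h small, or with h bounded below. The constant is the sum of those
    of the three cases. *)
Lemma dilated_box_bound : exists2 C : R, (0 < C)%R & forall N f,
  box_bounded p alpha r0 N f -> forall c u, (cmod c < 1)%R -> (cmod u < 1)%R ->
  \int[dA R]_(q in box u) (dilated_density f c q)%:E <=
    (C * N * (1 - cmod u ^+ 2))%:E.
Proof.
have [C C0 HC] := pointwise_bound p1 a1 r00 r01.
have [D D0 HD] := whole_disk_bound p1 a1 r00 r01.
have r10 : (0 < 1 - r0)%R by rewrite subr_gt0.
pose A1 := (C * 72 * 4 `^ (alpha + 1))%R.
have A10 : (0 < A1)%R by rewrite mulr_gt0 ?powR_gt0// mulr_gt0.
pose A3 := (8 * D / (1 - r0))%R.
have A30 : (0 < A3)%R by rewrite divr_gt0// mulr_gt0.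
have aa : (0 <= alpha + 1)%R by move: a1; lra.
have a2 : (0 <= alpha + 2)%R by move: a1; lra.
exists (A1 + 16 + A3)%R; first by rewrite !addr_gt0.
move=> N f fN c u c1 u1; have [df N0 _] := fN.
pose h := (1 - cmod u)%R; have h0 : (0 < h)%R by rewrite subr_gt0.
have h1 : (h <= 1)%R by rewrite /h; have := cmod_ge0 u; lra.
have hu : (h <= 1 - cmod u ^+ 2)%R.
  rewrite /h lerB// expr2 ler_piMl ?cmod_ge0// ltW//.
have fin (A : R) : (0 <= A)%R -> (A <= A1 + 16 + A3)%R ->
    ((A * N * h)%:E <= ((A1 + 16 + A3) * N * (1 - cmod u ^+ 2))%:E).
  move=> A0 AA; rewrite lee_fin.
  apply: (@ler_pM R) => //; [exact: mulr_ge0|exact: ltW|exact: ler_wpM2r].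
have [ch|ch] := leP (h / 2)%R (1 - cmod c)%R.
  have A1le : (A1 <= A1 + 16 + A3)%R by move: A30; lra.
  apply: le_trans (fin A1 (ltW A10) A1le).
  have H20 : (0 < h / 2)%R by rewrite divr_gt0.
  have q0 : (0 < (h / 2) `^ (alpha + 2))%R by rewrite powR_gt0.
  apply: (@le_trans _ _ (\int[dA R]_(q in box u)
     (C * N / (h / 2) `^ (alpha + 2) * (2 * h) `^ (alpha + 1))%:E)).
    apply: ge0_le_integral => //.
    - exact: measurable_box.
    - by move=> q _; rewrite lee_fin dilated_density_ge0.
    - apply/measurable_EFinP; apply: measurable_funS (measurable_dilated_density df c1).
        exact: measurable_disk.
      exact: box_subset_disk.
    - move=> q qu; rewrite lee_fin.
      have := box_subset_disk qu; rewrite /disk /= subr0 => q1.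
      have uq : (cmod u <= cmod (plane q))%R.
        have [->|u0] := eqVneq u 0%R; first by rewrite cmod0 cmod_ge0.
        by have /(carleson_boxP _ u0 u1) [] := qu.
      have cq : (cmod (c * plane q) <= cmod c)%R.
        by rewrite cmodM ler_piMr ?cmod_ge0// ltW.
      have cq1 : (cmod (c * plane q) < 1)%R := le_lt_trans cq c1.
      apply: ler_pM; rewrite ?powR_ge0//.
        apply: (le_trans (HC N f fN _ cq1)).
        apply: ler_wpM2l; first by rewrite mulr_ge0// ltW.
        rewrite lef_pV2 ?posrE// ?powR_gt0 ?subr_gt0//.
        apply: ge0_ler_powR; rewrite ?nnegrE ?subr_ge0 ?(ltW cq1) ?(ltW H20)//; lra.
      apply: ge0_ler_powR; rewrite ?nnegrE ?(ltW (sqr_modulus_gt0 q1))//; first lra.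
      rewrite (_ : 1 - cmod (plane q) ^+ 2 = (1 + cmod (plane q)) * (1 - cmod (plane q)))%R; last by ring.
      have := cmod_ge0 (plane q); rewrite /h => z0; apply: ler_pM; lra.
  rewrite integral_cst//; last exact: measurable_box.
  apply: (@le_trans _ _ ((C * N / (h / 2) `^ (alpha + 2) * (2 * h) `^ (alpha + 1))%:E *
     (36 * h ^+ 2)%:E)).
    apply: lee_wpmul2l; last exact: box_area_le.
    by rewrite lee_fin mulr_ge0 ?powR_ge0// divr_ge0 ?powR_ge0// mulr_ge0// ltW.
  rewrite -EFinM lee_fin.
  have -> : ((2 * h) `^ (alpha + 1) = 4 `^ (alpha + 1) * (h / 2) `^ (alpha + 1))%R.
    by rewrite -powRM ?(ltW H20)//; congr (_ `^ _)%R; field.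
  have -> : ((h / 2) `^ (alpha + 2) = (h / 2) * (h / 2) `^ (alpha + 1))%R.
    rewrite -(@mulr_powRB1 _ (h / 2)%R (alpha + 2)%R) ?(ltW H20)//; last by move: a1; lra.
    by congr (_ * _ `^ _)%R; ring.
  have Q0 : (0 < (h / 2) `^ (alpha + 1))%R by rewrite powR_gt0.
  rewrite /A1 le_eqVlt; apply/orP; left; apply/eqP.
  move: Q0; move: ((h / 2) `^ _)%R (4 `^ _)%R => x y x0.
  by field; rewrite !gt_eqF.
have c2 : (2^-1 < cmod c)%R by move: ch; lra.
have c0 : c != 0%R by rewrite -cmod_gt0 (lt_trans _ c2)// invr_gt0.
have [r0h|r0h] := ltP r0 (1 - 2 * h)%R.
  have Ale : (16 <= A1 + 16 + A3)%R by move: A30 A10; lra.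
  apply: le_trans (fin 16%R _ Ale) => //.
  have h21 : (2 * h < 1)%R by move: r00 r0h; lra.
  have u0 : u != 0%R.
    by rewrite -cmod_gt0; move: h21; rewrite /h; lra.
  have [v vE sub] := box_rotate_dilate u0 u1 c0 (erefl h) ch c1 h21.
  have v1 : (cmod v < 1)%R by rewrite vE; lra.
  have rv : (r0 < cmod v)%R by rewrite vE.
  have V0 : (0 <= (1 - cmod v ^+ 2) * N)%R by rewrite mulr_ge0// ltW// sqr_modulus_gt0.
  apply: le_trans (integral_dilation_le df u1 c2 c1 V0 (measurable_box v1)
    (@box_subset_disk R v) sub (box_integral_le fN rv v1)) _.
  rewrite lee_fin vE.
  rewrite (_ : 4 * ((1 - (1 - 2 * h) ^+ 2) * N) = 16 * N * h - 16 * N * h ^+ 2)%R; last by ring.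
  by rewrite gerBl mulr_ge0 ?sqr_ge0// mulr_ge0.
have A3le : (A3 <= A1 + 16 + A3)%R by move: A10; lra.
apply: le_trans (fin A3 (ltW A30) A3le).
have DN : (0 <= D * N)%R by rewrite mulr_ge0// ltW.
apply: le_trans (integral_dilation_le df u1 c2 c1 DN (measurable_disk _ _)
  (fun _ h => h) _ (HD N f fN)) _.
  move=> q /box_subset_disk; rewrite /disk /= plane_affine addr0 !subr0 cmodM => q1.
  by apply: le_lt_trans c1; rewrite ler_piMr ?cmod_ge0// ltW.
rewrite lee_fin /A3.
have h2 : (1 <= 2 * h / (1 - r0))%R by rewrite ler_pdivlMr// mul1r; lra.
rewrite (_ : 8 * D / (1 - r0) * N * h = 4 * (D * N) * (2 * h / (1 - r0)))%R; last by ring.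
by rewrite ler_peMr// mulr_ge0.
Qed.

End dilation.

Local Arguments conjc : simpl never.

(** * Analyticity of the convolution *)

Section convolution.
Context {R : realType}.
Notation mR := (measurableTypeR R).
Implicit Types (f g : R[i] -> R[i]) (u v w z : R[i]).
Notation D := (disk (0 : R[i]) (1 : R)).

Lemma analytic_cdiff f : analytic_on_disk f -> forall w, cmod w < 1 -> cdiff f w.
Proof. by move=> df w w1; apply/cdiffP; exact: df. Qed.

(** A quadratic remainder forces the slope to tend to E. *)
Lemma cdiff_second_order f z (E : R[i]) (L r : R) : 0 < r ->
  (forall h, cmod h < r -> cmod (f (z + h) - f z - E * h) <= L * cmod h ^+ 2) ->
  cdiff f z.
Proof.
move=> r0 H.
exists (fun w => if w == z then E else (f w - f z) / (w - z)); last first.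
  move=> w; case: eqP => [->|/eqP wNz]; first by rewrite subrr mulr0 addr0.
  by rewrite divfK ?subr_eq0// addrC subrK.
move=> e e0; exists (Num.min r (e / (`|L| + 1))).
  by rewrite lt_min r0 divr_gt0// ltr_wpDl.
move=> w; rewrite lt_min => /andP[wr we]; rewrite /= eqxx.
case: eqP => [_|/eqP wNz]; first by rewrite subrr cmod0.
have wz0 : 0 < cmod (w - z) by rewrite cmod_gt0 subr_eq0.
have wz : w - z != 0 by rewrite subr_eq0.
have := H _ wr; rewrite [z + _]addrC subrK => Hw.
have -> : (f w - f z) / (w - z) - E = (f w - f z - E * (w - z)) / (w - z).
  by rewrite [RHS]mulrBl mulfK.
rewrite cmodM cmodV ltr_pdivrMr//; apply: (le_lt_trans Hw).
rewrite expr2 mulrA ltr_pM2r//.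
apply: (@le_lt_trans _ _ (`|L| * cmod (w - z))).
  by rewrite ler_wpM2r ?cmod_ge0// ler_norm.
move: we; rewrite ltr_pdivlMr ?ltr_wpDl// => we; apply: le_lt_trans we.
by rewrite mulrC ler_wpM2l ?cmod_ge0// lerDl.
Qed.

Section convolution_analytic.
Context (f g : R[i] -> R[i]).
Context (df : forall w, cmod w < 1 -> cdiff f w).
Context (ig : cintegrable (dA R) D (fun q => g (plane q))).

(** The second order expansion at 0 bounds f. *)
Lemma analytic_bounded rho : 0 <= rho -> rho < 1 ->
  exists2 M : R, 0 <= M & forall v, cmod v <= rho -> cmod (f v) <= M.
Proof.
move=> rho0 rho1; have [L [D [L0 [DL H]]]] := second_order df rho0 rho1.
exists (cmod (f 0) + L + L); first by rewrite !addr_ge0 ?cmod_ge0.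
move=> v vr; have v1 : cmod v <= 1 by rewrite (le_trans vr)// ltW.
have c0 : cmod (0 : R[i]) <= rho by rewrite cmod0.
have := H 0 v c0; rewrite add0r => /(_ vr) Hv.
rewrite (_ : f v = (f v - f 0 - D 0 * v) + f 0 + D 0 * v); last by ring.
apply: le_trans (cmodD _ _) _; apply: le_trans (lerD (cmodD _ _) (lexx _)) _.
have h1 : cmod (D 0 * v) <= L.
  by rewrite cmodM -[leRHS]mulr1 ler_pM ?cmod_ge0// DL.
have h2 : L * cmod v ^+ 2 <= L by rewrite ler_piMr// expr_le1// cmod_ge0.
lra.
Qed.

Lemma cmeasurable_dilation z : cmod z < 1 ->
  cmeasurable D (fun q => f (conjc (plane q) * z)).
Proof.
move=> z1; apply: cmeasurable_analytic => //.
  by apply: cmeasurableM; [apply: cmeasurable_conj; exact: cmeasurable_plane|exact: cmeasurable_cst].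
move=> q; rewrite /disk /= subr0 => q1; rewrite cmodM cmod_conj.
by apply: le_lt_trans z1; rewrite ler_piMl ?cmod_ge0// ltW.
Qed.

Lemma cintegrable_bounded_mul (F : mR * mR -> R[i]) (M : R) :
  cmeasurable D F -> (forall q, D q -> cmod (F q) <= M) ->
  cintegrable (dA R) D (fun q => g (plane q) * F q).
Proof.
move=> mF FM; have mD := measurable_disk (0 : R[i]) (1 : R).
have iH := integrableZl mD M (cintegrable_cmod mD ig).
apply: (cintegrable_dom mD _ iH).
  by apply: cmeasurableM => //; exact: cintegrable_measurable ig.
by move=> q Dq /=; rewrite cmodM mulrC ler_wpM2r ?cmod_ge0// FM.
Qed.

Lemma hadamard_bergmanE z :
  hadamard_bergman g f z =
  cintegral (dA R) D (fun q => g (plane q) * f (conjc (plane q) * z)).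
Proof. by rewrite /hadamard_bergman /area_cintegral unit_diskE. Qed.

Lemma cintegrable_convolution z : cmod z < 1 ->
  cintegrable (dA R) D (fun q => g (plane q) * f (conjc (plane q) * z)).
Proof.
move=> z1; have [M _ fM] := analytic_bounded (cmod_ge0 z) z1.
apply: (cintegrable_bounded_mul (cmeasurable_dilation z1)) => q.
rewrite /disk /= subr0 => q1; apply: fM.
by rewrite cmodM cmod_conj ler_piMl ?cmod_ge0// ltW.
Qed.

(** Integrate the second order expansion of f at conj w z, whose remainder is
    uniform in w, against g (w). *)
Lemma cdiff_hadamard_bergman z : cmod z < 1 -> cdiff (hadamard_bergman g f) z.
Proof.
move=> z1; pose r := (1 - cmod z) / 2; pose rho := cmod z + r.
have r0 : 0 < r by rewrite divr_gt0// subr_gt0.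
have z0 := cmod_ge0 z.
have rho0 : 0 <= rho by rewrite addr_ge0// ltW.
have rho1 : rho < 1 by rewrite /rho /r; lra.
have zrho : cmod z <= rho by rewrite lerDl ltW.
have [L [E [L0 [EL H]]]] := second_order df rho0 rho1.
have mD := measurable_disk (0 : R[i]) (1 : R).
have qz q v : D q -> cmod (conjc (plane q) * v) <= cmod v.
  rewrite /disk /= subr0 => q1.
  by rewrite cmodM cmod_conj ler_piMl ?cmod_ge0// ltW.
(* E is only known as a coefficient of the expansion of f; it is measurable as a
   limit of difference quotients with increments d n. *)
have mE : cmeasurable D (fun q => E (conjc (plane q) * z)).
  pose n0 := Num.truncn r^-1.
  pose d n : R := (n + n0).+1%:R^-1.
  have d0 n : 0 < d n by rewrite invr_gt0.
  have dr n : d n <= r.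
    rewrite invf_ple ?posrE// ltW//; apply: lt_le_trans (truncnS_gt _) _.
    by rewrite ler_nat ltnS leq_addl.
  have in_rho n q : D q -> cmod (conjc (plane q) * z + (d n)%:C%C) <= rho.
    move=> Dq; apply: le_trans (cmodD _ _) _; rewrite cmodC gtr0_norm//.
    by apply: lerD; [exact: qz|exact: dr].
  apply: (@cmeasurable_lim _ _ _ _ (fun n q => ((d n)^-1)%:C%C *
     (f (conjc (plane q) * z + (d n)%:C%C) - f (conjc (plane q) * z)))).
    move=> n; apply: cmeasurableM; first exact: cmeasurable_cst.
    apply: cmeasurableD; last by apply: cmeasurableN; exact: cmeasurable_dilation.
    apply: cmeasurable_analytic => //.
      apply: cmeasurableD; last exact: cmeasurable_cst.
      by apply: cmeasurableM; [apply: cmeasurable_conj; exact: cmeasurable_plane|exact: cmeasurable_cst].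
    by move=> q Dq; apply: le_lt_trans (in_rho n q Dq) _.
  move=> q Dq e e0; exists (Num.truncn ((L + 1) / e)) => n nN.
  have qr : cmod (conjc (plane q) * z) <= rho by rewrite (le_trans (qz _ _ Dq)).
  have Hn := H _ _ qr (in_rho n q Dq).
  have dC : (d n)%:C%C != 0 :> R[i] by rewrite -cmod_gt0 cmodC normr_gt0 gt_eqF.
  set A := f _ - f _ in Hn *.
  have -> : ((d n)^-1)%:C%C * A - E (conjc (plane q) * z) =
      ((d n)^-1)%:C%C * (A - E (conjc (plane q) * z) * (d n)%:C%C).
    rewrite [RHS]mulrBr; congr (_ - _); rewrite mulrCA -rmorphM /= mulVf ?mulr1//.
    by rewrite gt_eqF.
  rewrite cmodM cmodC ger0_norm ?invr_ge0 ?(ltW (d0 n))//.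
  rewrite mulrC ltr_pdivrMr//; apply: (le_lt_trans Hn).
  rewrite cmodC gtr0_norm// expr2 mulrA ltr_pM2r//.
  rewrite ltr_pdivrMr// mulrC -ltr_pdivrMr//.
  apply: (@lt_trans _ _ ((L + 1) / e)); first by rewrite ltr_pM2r ?invr_gt0// ltrDl.
  apply: lt_le_trans (truncnS_gt _) _; rewrite ler_nat ltnS.
  by rewrite (leq_trans nN)// leq_addr.
have mc : cmeasurable D (fun q : mR * mR => conjc (plane q)).
  by apply: cmeasurable_conj; exact: cmeasurable_plane.
have iE : cintegrable (dA R) D
    (fun q => g (plane q) * (E (conjc (plane q) * z) * conjc (plane q))).
  apply: (@cintegrable_bounded_mul _ L); first exact: cmeasurableM.
  move=> q Dq; rewrite cmodM -[leRHS]mulr1; apply: ler_pM; rewrite ?cmod_ge0//.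
    by apply: EL; exact: le_trans (qz _ _ Dq) zrho.
  by rewrite cmod_conj; move: Dq; rewrite /disk /= subr0 => /ltW.
apply: (@cdiff_second_order _ _ (cintegral (dA R) D
   (fun q => g (plane q) * (E (conjc (plane q) * z) * conjc (plane q))))
   (2 * (L * Rintegral (dA R) D (fun q => cmod (g (plane q))))) r) => // h hr.
have zh : cmod (z + h) <= rho.
  by apply: le_trans (cmodD _ _) _; rewrite /rho lerD2l ltW.
have zh1 : cmod (z + h) < 1 := le_lt_trans zh rho1.
rewrite !hadamard_bergmanE [_ * h]mulrC -cintegralZ//.
rewrite -cintegralB//; [|exact: cintegrable_convolution..].
rewrite -cintegralB//; last 2 first.
- have := cintegrableD mD (cintegrable_convolution zh1)
    (cintegrableZ (-1) mD (cintegrable_convolution z1)).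
  by congr cintegrable; apply/funext => q; rewrite mulN1r.
- exact: cintegrableZ.
rewrite [leRHS](_ : _ = 2 * (L * cmod h ^+ 2 *
  Rintegral (dA R) D (fun q => cmod (g (plane q))))); last by ring.
have iN := cintegrable_cmod mD ig.
have iK : cintegrable (dA R) D (fun q => g (plane q) * f (conjc (plane q) * (z + h)) -
    g (plane q) * f (conjc (plane q) * z) -
    h * (g (plane q) * (E (conjc (plane q) * z) * conjc (plane q)))).
  have i1 := cintegrableD mD (cintegrable_convolution zh1)
    (cintegrableZ (-1) mD (cintegrable_convolution z1)).
  have := cintegrableD mD i1 (cintegrableZ (- h) mD iE).
  by congr cintegrable; apply/funext => q; rewrite mulN1r mulNr.
have iZ : (dA R).-integrable D (EFin \o (fun q => L * cmod h ^+ 2 * cmod (g (plane q)))).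
  exact: (integrableZl mD (L * cmod h ^+ 2) iN).
apply: le_trans (cmod_cintegral_dom mD iK iZ _) _.
  move=> q Dq; rewrite (_ : _ - _ = g (plane q) * (f (conjc (plane q) * z + conjc (plane q) * h)
     - f (conjc (plane q) * z) - E (conjc (plane q) * z) * (conjc (plane q) * h))); last first.
    by rewrite mulrDr; ring.
  rewrite cmodM mulrC ler_wpM2r ?cmod_ge0//.
  have qr : cmod (conjc (plane q) * z) <= rho by rewrite (le_trans (qz _ _ Dq)).
  have qr2 : cmod (conjc (plane q) * z + conjc (plane q) * h) <= rho.
    by rewrite -mulrDr (le_trans (qz _ _ Dq)).
  apply: (le_trans (H _ _ qr qr2)); rewrite ler_wpM2l// lerXn2r ?nnegrE ?cmod_ge0//.
  exact: qz.
by rewrite RintegralZl.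
Qed.

End convolution_analytic.
End convolution.

(** * Box means of the convolution *)

Section boundedness.
Context {R : realType}.
Local Open Scope ereal_scope.
Notation mR := (measurableTypeR R).
Implicit Types (f g : R[i] -> R[i]) (u v w z : R[i]).
Notation D := (disk (0%R : R[i]) (1%R : R)).

Lemma bergman_normE g :
  bergman_norm g = \int[dA R]_(q in D) (cmod (g (plane q)))%:E.
Proof. by rewrite /bergman_norm /area_integral unit_diskE. Qed.

Lemma bergman_cintegrable g : bergman_A1 g ->
  cintegrable (dA R) D (fun q => g (plane q)).
Proof.
move=> [ag gfin]; have dg := analytic_cdiff ag.
have mD := measurable_disk (0%R : R[i]) (1%R : R).
have mg : cmeasurable D (fun q => g (plane q)).
  exact: cmeasurable_disk.
apply: (cintegrable_dom mD mg (h := fun q => cmod (g (plane q)))) => //.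
apply/integrableP; split.
  by apply/measurable_EFinP; exact: cmeasurable_cmod.
rewrite bergman_normE in gfin; move: gfin; congr (_ < _).
by apply: eq_integral => q _; rewrite /= ger0_norm ?cmod_ge0.
Qed.

(** The bound G on the norm of g is a separate positive number, so that g = 0 needs
    no special treatment in the power mean. *)
Lemma convolution_power_le (p G : R) f g z : (1 <= p)%R -> (0 < G)%R ->
  (forall w, cmod w < 1 -> cdiff f w)%R -> bergman_A1 g ->
  bergman_norm g <= G%:E -> (cmod z < 1)%R ->
  (cmod (hadamard_bergman g f z) `^ p)%:E <=
  (2 * 2 * (2 * 2 * G) `^ (p - 1))%:E *
   \int[dA R]_(q in D) (cmod (g (plane q)) * cmod (f (conjc (plane q) * z)%R) `^ p)%:E.
Proof.
move=> p1 G0 df bg gG z1; have ig := bergman_cintegrable bg.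
have mD := measurable_disk (0%R : R[i]) (1%R : R).
have iK := cintegrable_convolution df ig z1.
apply: (@weighted_power_mean _ _ R (dA R) D (fun q => cmod (g (plane q)))
  (fun q => cmod (f (conjc (plane q) * z)%R))) => //.
- by apply: cmeasurable_cmod; exact: cintegrable_measurable ig.
- by apply: cmeasurable_cmod; exact: cmeasurable_dilation.
- by move=> q _; exact: cmod_ge0.
- by move=> q _; exact: cmod_ge0.
- exact: cmod_ge0.
- by rewrite -bergman_normE.
rewrite hadamard_bergmanE; have := cmod_cintegral mD iK; rewrite -lee_fin => /le_trans; apply.
rewrite EFinM; apply: lee_wpmul2l => //.
rewrite /Rintegral fineK; last exact: integrable_fin_num (cintegrable_cmod mD iK).
rewrite le_eqVlt; apply/orP; left; apply/eqP.
by apply: eq_integral => q _; rewrite cmodM.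
Qed.

(** Exchanging the integrals over the box and over the disk makes the dilated
    functions appear, each with the box integral that does not depend on the
    dilation. *)
Lemma convolution_box_integral (p alpha r0 : R) :
  (1 <= p)%R -> (-1 < alpha)%R -> (0 <= r0)%R -> (r0 < 1)%R ->
  exists2 C : R, (0 < C)%R & forall N G f g, box_bounded p alpha r0 N f ->
  bergman_A1 g -> (0 < G)%R -> bergman_norm g <= G%:E ->
  forall u, (cmod u < 1)%R ->
  box_mean p alpha (hadamard_bergman g f) u <=
    (C * N * G `^ (p - 1))%:E * bergman_norm g.
Proof.
move=> p1 a1 r00 r01; have [C C0 HC] := dilated_box_bound p1 a1 r00 r01.
exists (2 * 2 * (2 * 2) `^ (p - 1) * C)%R.
  by rewrite mulr_gt0// mulr_gt0 ?powR_gt0.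
move=> N G f g fN bg G0 gG u u1; have [df N0 _] := fN.
have ig := bergman_cintegrable bg.
have dK := cdiff_hadamard_bergman df ig.
have mD := measurable_disk (0%R : R[i]) (1%R : R).
have mb := measurable_box u1.
have s0 := sqr_modulus_gt0 u1.
have aa : (0 <= alpha + 1)%R by move: a1; lra.
rewrite /box_mean lee_pdivrMl//.
pose c := (2 * 2 * (2 * 2 * G) `^ (p - 1))%R.
have c0 : (0 <= c)%R by rewrite mulr_ge0 ?powR_ge0// mulr_ge0.
have cE : c = (2 * 2 * ((2 * 2) `^ (p - 1) * G `^ (p - 1)))%R.
  by rewrite /c [((2 * 2 * G) `^ _)%R]powRM ?(ltW G0)//; exact: mulr_ge0.
pose F (x : (mR * mR) * (mR * mR)) : \bar R :=
  (cmod (g (plane x.2)) * dilated_density p alpha f (conjc (plane x.2)) x.1)%:E.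
have F0 x : 0 <= F x by rewrite lee_fin mulr_ge0 ?cmod_ge0 ?dilated_density_ge0.
have mF : measurable_fun (box u `*` D) F.
  have mp1 : cmeasurable (box u `*` D) (fun x => @plane R x.1).
    split; apply: measurable_funTS.
      exact: (measurableT_comp measurable_fst measurable_fst).
    exact: (measurableT_comp measurable_snd measurable_fst).
  have mp2 : cmeasurable (box u `*` D) (fun x => @plane R x.2).
    split; apply: measurable_funTS.
      exact: (measurableT_comp measurable_fst measurable_snd).
    exact: (measurableT_comp measurable_snd measurable_snd).
  apply/measurable_EFinP; apply: measurable_funM.
    apply: cmeasurable_cmod; apply: (cmeasurable_analytic (analytic_cdiff bg.1)) => //.
    by move=> [q w] [_]; rewrite /disk /= subr0.
  apply: measurable_funM.
    apply: (measurableT_comp (measurable_powR p)).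
    apply: cmeasurable_cmod; apply: cmeasurable_analytic => //.
      by apply: cmeasurableM => //; exact: cmeasurable_conj.
    move=> [q w] [/= /box_subset_disk]; rewrite /disk /= !subr0 => q1 w1.
    rewrite cmodM cmod_conj; apply: le_lt_trans q1.
    by rewrite ler_piMl ?cmod_ge0// ltW.
  apply: (measurableT_comp (measurable_powR _)).
  apply: measurable_funB; first exact: measurable_cst.
  by apply: measurable_funX; exact: cmeasurable_cmod.
have [mF1 mF2 FE] := tonelli_on dA_sf dA_sf mb mD mF (fun q _ => F0 q).
apply: (@le_trans _ _ (\int[dA R]_(q in box u) (c%:E * \int[dA R]_(w in D) F (q, w)))).
  refine (@ge0_le_integral _ _ R (dA R) _ mb _ _ _ _ _ _).
  - by move=> q _; rewrite lee_fin tent_density_ge0.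
  - apply/measurable_EFinP; exact: (measurable_tent_density p alpha dK (@box_subset_disk _ u)).
  - by apply: measurable_funeM; exact: mF1.
  - move=> q /box_subset_disk; rewrite /disk /= subr0 => q1.
    have := convolution_power_le p1 G0 df bg gG q1; rewrite -/c => H.
    pose t := ((1 - cmod (plane q) ^+ 2) `^ (alpha + 1))%R.
    have t0 : (0 <= t)%R by exact: powR_ge0.
    rewrite /tent_density -/t mulrC EFinM.
    have t0E : 0 <= t%:E by rewrite lee_fin.
    have c0E : 0 <= c%:E by rewrite lee_fin.
    apply: (le_trans (lee_wpmul2l t0E H)).
    rewrite muleCA; apply: (lee_wpmul2l c0E).
    rewrite -(@ge0_integralZl _ _ R (dA R) _ mD _ _ _ _ t0E); last 2 first.
    + apply/measurable_EFinP; apply: measurable_funM.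
        by apply: cmeasurable_cmod; exact: cintegrable_measurable ig.
      apply: (measurableT_comp (measurable_powR p)).
      by apply: cmeasurable_cmod; exact: cmeasurable_dilation.
    + by move=> w _; rewrite lee_fin mulr_ge0 ?cmod_ge0 ?powR_ge0.
    rewrite le_eqVlt; apply/orP; left; apply/eqP.
    apply: eq_integral => w _; rewrite /F /dilated_density /= -/t -EFinM.
    by congr EFin; ring.
have c0E : 0 <= c%:E by rewrite lee_fin.
rewrite (@ge0_integralZl _ _ R (dA R) _ mb _ mF1 _ _ c0E); last first.
  by move=> q _; apply: integral_ge0 => w _; exact: F0.
have -> : \int[dA R]_(q in box u) \int[dA R]_(w in D) F (q, w) =
    \int[dA R]_(w in D) \int[dA R]_(q in box u) F (q, w) := FE.
have mg : measurable_fun D (fun q => (cmod (g (plane q)))%:E).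
  apply/measurable_EFinP; apply: cmeasurable_cmod.
  exact: cintegrable_measurable ig.
pose k := (C * N * (1 - cmod u ^+ 2))%R.
have k0 : (0 <= k)%R := mulr_ge0 (mulr_ge0 (ltW C0) N0) (ltW s0).
have k0E : 0 <= k%:E by rewrite lee_fin; exact: k0.
have inner : \int[dA R]_(w in D) \int[dA R]_(q in box u) F (q, w) <=
    k%:E * bergman_norm g.
  rewrite bergman_normE -(@ge0_integralZl _ _ R (dA R) _ mD _ mg _ _ k0E); last first.
    by move=> w _; rewrite lee_fin cmod_ge0.
  refine (@ge0_le_integral _ _ R (dA R) _ mD _ _ _ _ _ _).
  - by move=> w _; apply: integral_ge0 => q _; exact: F0.
  - exact: mF2.
  - by apply: measurable_funeM; exact: mg.
  - move=> w; rewrite /disk /= subr0 => w1.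
    have cw1 : (cmod (conjc (plane w)) < 1)%R by rewrite cmod_conj.
    have H := HC N f fN _ u cw1 u1.
    rewrite /F /= muleC.
    under eq_integral do rewrite EFinM.
    have g0E : 0 <= (cmod (g (plane w)))%:E by rewrite lee_fin cmod_ge0.
    have mq : measurable_fun (box u) (fun q : (mR * mR)%type =>
        (dilated_density p alpha f (conjc (plane w)) q)%:E).
      apply/measurable_EFinP.
      apply: measurable_funS (measurable_dilated_density p alpha df cw1).
        exact: measurable_disk.
      exact: box_subset_disk.
    rewrite (@ge0_integralZl _ _ R (dA R) _ mb _ mq _ _ g0E); last first.
      by move=> q _; rewrite lee_fin dilated_density_ge0.
    exact: (lee_wpmul2l g0E H).
apply: (le_trans (lee_wpmul2l c0E inner)).
rewrite !muleA -!EFinM le_eqVlt; apply/orP; left; apply/eqP; congr (_%:E * _).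
rewrite cE /k; ring.
Qed.

End boundedness.

(** * Boundedness on the tent space *)

Section tent_spaces.
Context {R : realType}.
Local Open Scope ereal_scope.
Implicit Types (f g : R[i] -> R[i]) (u v w z : R[i]).

(** The supremum is nonnegative because it dominates the mean over some box, for
    which a vertex with r0 < |u| < 1 is taken on the real axis. *)
Lemma tent_sup_box_bounded zeta p alpha r0 f :
  (1 / 2 < zeta)%R -> (0 <= r0)%R -> (r0 < 1)%R ->
  (forall r, r0 < r -> 1 < zeta * (1 + r))%R ->
  (forall w, cmod w < 1 -> cdiff f w)%R -> tent_sup zeta p alpha f < +oo ->
  exists2 N : R, tent_sup zeta p alpha f = N%:E & box_bounded p alpha r0 N f.
Proof.
move=> z2 r00 r01 zr df fin.
have le_sup u : (r0 < cmod u)%R -> (cmod u < 1)%R ->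
    box_mean p alpha f u <= tent_sup zeta p alpha f.
  by move=> u0 u1; apply: box_mean_le_tent_sup => //; exact: zr.
have sup0 : 0 <= tent_sup zeta p alpha f.
  pose r := ((1 + r0) / 2)%R.
  have rE : cmod r%:C%C = r by rewrite cmodC ger0_norm// /r; move: r00; lra.
  have r1 : (cmod r%:C%C < 1)%R by rewrite rE /r; move: r01; lra.
  apply: (le_trans (box_mean_ge0 p alpha f r1)); apply: le_sup => //.
  by rewrite rE /r; move: r01; lra.
have supE : tent_sup zeta p alpha f = (fine (tent_sup zeta p alpha f))%:E.
  by rewrite fineK// ge0_fin_numE.
exists (fine (tent_sup zeta p alpha f)) => //; split=> //; first exact: fine_ge0.
by move=> u u0 u1; rewrite -supE; exact: le_sup.
Qed.

Lemma measurable_on_disk_cdiff f : (forall w, cmod w < 1 -> cdiff f w)%R ->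
  measurable_on_disk f.
Proof.
by move=> df; rewrite /measurable_on_disk unit_diskE; exact: cmeasurable_disk.
Qed.

End tent_spaces.

Unset Implicit Arguments.

Theorem theorem2p5 (R : realType) (zeta p alpha : R) (hzeta : 1 / 2 < zeta)
    (hp : 1 <= p) (halpha : -1 < alpha) :
  exists C : R, 0 < C /\
    forall f g : R[i] -> R[i],
      analytic_tent_space zeta p alpha f -> bergman_A1 g ->
      analytic_tent_space zeta p alpha (hadamard_bergman g f) /\
      (tent_norm zeta p alpha (hadamard_bergman g f) <=
        C%:E * tent_norm zeta p alpha f * bergman_norm g)%E.
Proof.
have zeta0 : 0 < zeta by move: hzeta; lra.
have p0 : 0 < p := lt_le_trans ltr01 hp.
have ip0 : 0 < p^-1 by rewrite invr_gt0.
(* Beyond r0 the condition 1 < zeta (1 + |u|) holds; r0 < 1 is zeta > 1 / 2. *)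
pose r0 := Num.max 0 (1 / zeta - 1).
have r00 : 0 <= r0 by rewrite /r0 le_max lexx.
have r01 : r0 < 1.
  rewrite /r0 gt_max ltr01 /= ltrBlDr ltr_pdivrMr//.
  by move: hzeta; lra.
have zr r : r0 < r -> 1 < zeta * (1 + r).
  rewrite /r0 gt_max => /andP[_]; rewrite ltrBlDr ltr_pdivrMr// mulrC.
  by rewrite [r + 1]addrC.
have [C C0 HC] := convolution_box_integral hp halpha r00 r01.
exists (C `^ p^-1); split; first by rewrite powR_gt0.
move=> f g [[mf ffin] af] bg.
have df := analytic_cdiff af.
have supfin : (tent_sup zeta p alpha f < +oo)%E.
  by apply: (@lty_poweRy _ _ p^-1); [rewrite gt_eqF|exact: ffin].
have [N fN bN] := tent_sup_box_bounded hzeta r00 r01 zr df supfin.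
have [_ N0 _] := bN.
have ig := bergman_cintegrable bg.
have dK := cdiff_hadamard_bergman df ig.
have g0 : (0 <= bergman_norm g)%E.
  by rewrite bergman_normE; apply: integral_ge0 => q _; rewrite lee_fin cmod_ge0.
pose gam := fine (bergman_norm g).
have gE : bergman_norm g = gam%:E by rewrite /gam fineK// ge0_fin_numE// bg.2.
have gam0 : 0 <= gam by rewrite /gam fine_ge0.
have KB : (tent_sup zeta p alpha (hadamard_bergman g f) <= (C * N * gam `^ p)%:E)%E.
  apply: tent_sup_le => u u1.
  (* If g has norm 0, any positive bound such as 1 serves. *)
  have [gz|gn0] := eqVneq gam 0.
    have := HC N 1 f g bN bg ltr01; rewrite gE gz => /(_ _ _ u1); rewrite mule0.
    by rewrite powR0 ?gt_eqF// mulr0; apply; rewrite lee_fin.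
  have gp : 0 < gam by rewrite lt_neqAle eq_sym gn0.
  have := HC N gam f g bN bg gp; rewrite gE => /(_ (lexx _) u u1).
  rewrite -EFinM => /le_trans; apply; rewrite lee_fin.
  by rewrite -(mulr_powRB1 gam0 p0) [(gam * _)%R]mulrC !mulrA.
have norm_le : (tent_norm zeta p alpha (hadamard_bergman g f) <=
    (C `^ p^-1 * N `^ p^-1 * gam)%:E)%E.
  have [M KM [_ M0 _]] :=
    tent_sup_box_bounded hzeta r00 r01 zr dK (le_lt_trans KB (ltry _)).
  rewrite tent_normE; apply: (@le_trans _ _ ((C * N * gam `^ p)%:E `^ p^-1)%E).
    move: KB; rewrite KM !poweR_EFin !lee_fin => MB.
    by apply: (ge0_ler_powR (ltW ip0) _ _ MB); rewrite nnegrE ?(le_trans M0 MB).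
  rewrite poweR_EFin lee_fin powRM ?powR_ge0//; last exact: mulr_ge0 (ltW C0) N0.
  by rewrite powRM ?(ltW C0)// -powRrM mulfV ?gt_eqF// powRr1.
split; last by rewrite (tent_normE _ _ _ f) fN poweR_EFin gE -!EFinM.
split; last by move=> z z1; apply/cdiffP; exact: dK.
split; first exact: measurable_on_disk_cdiff.
by apply: le_lt_trans norm_le _; rewrite ltry.
Qed.
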